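(* Let $n\ge1$ and let $\psi:\mathbb{R}\to[0,\infty)$ be a smooth, even, compactly supported function with $\|\psi\|_{L^\infty}\le1$, with associated localized surface measure $d\sigma_{loc}=\psi(\nu)\,d\sigma$ on $S=\{(\alpha,\lambda,\nu)\in\mathbb{N}_0^n\times\mathbb{R}^*\times\mathbb{R}:\nu=(2|\alpha|+n)|\lambda|\}$. If $1\le q\le p<2$, then there is a constant $C(p,q)$ such that $$\|\mathcal{R}_{S_{loc}}f\|_{L^2(S,d\sigma_{loc})}\le C(p,q)\,\|f\|_{L_t^1L_s^qL_x^p}$$ for all functions $f\in\mathcal{S}(\mathbb{R}^{n+2})$.
   Context: Points of $\mathbb{R}^{n+2}$ are $(x,t,s)$ with $x\in\mathbb{R}^n$, $t,s\in\mathbb{R}$; $\mathcal{S}$ is the Schwartz class; $\mathbb{R}^*=\mathbb{R}\setminus\{0\}$. Hermite functions: $h_k(x)=(2^k\sqrt{\pi}\,k!)^{-1/2}H_k(x)e^{-x^2/2}$ with $H_k(x)=(-1)^k e^{x^2}\frac{d^k}{dx^k}e^{-x^2}$; for $\alpha\in\mathbb{N}_0^n$, $\Phi_\alpha(x)=\prod_{j=1}^n h_{\alpha_j}(x_j)$, $|\alpha|=\sum_j\alpha_j$; for $\lambda\in\mathbb{R}^*$, $\Phi_\alpha^\lambda(x)=|\lambda|^{n/4}\Phi_\alpha(\sqrt{|\lambda|}\,x)$. Scaled Hermite-Fourier transform on $\mathbb{R}^{n+2}$: for $(\alpha,\lambda,\nu)\in\mathbb{N}_0^n\times\mathbb{R}^*\times\mathbb{R}$,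 $$\hat f(\alpha,\lambda,\nu)=\int_{\mathbb{R}^n}\int_{\mathbb{R}}\int_{\mathbb{R}}e^{i\lambda t}e^{i\nu s}f(x,t,s)\Phi_\alpha^\lambda(x)\,ds\,dt\,dx.$$ Measure: $\int_S\Theta\,d\sigma_{loc}=\sum_{\alpha\in\mathbb{N}_0^n}\int_{\mathbb{R}^*}\Theta(\alpha,\lambda,(2|\alpha|+n)|\lambda|)\,\psi((2|\alpha|+n)|\lambda|)\,d\lambda$. Restriction operator: $\mathcal{R}_{S_{loc}}f=\hat f|_S$. Mixed norm: $\|f\|_{L_t^rL_s^qL_x^p}=\Big(\int_{\mathbb{R}}\Big(\int_{\mathbb{R}}\Big(\int_{\mathbb{R}^n}|f(x,t,s)|^p\,dx\Big)^{q/p}ds\Big)^{r/q}dt\Big)^{1/r}$, with the usual modification for infinite exponents. The dimension $n$ and the cutoff $\psi$ are fixed; constants may depend on them. *)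

(* Defs.v *)
From HB Require Import structures.
From mathcomp Require Import all_boot all_order all_algebra.
From mathcomp Require Import complex.
From mathcomp Require Import all_classical all_reals all_analysis.

Set Implicit Arguments.
Unset Strict Implicit.
Unset Printing Implicit Defensive.

Import Order.TTheory GRing.Theory Num.Theory.
Import numFieldNormedType.Exports.

Local Open Scope classical_set_scope.
Local Open Scope ring_scope.

(* Lebesgue measure on R^n, carried by n-tuples: built by recursion on n as
   the image of the product measure under (a, x) |-> a :: x. *)
Section LebesgueTuple.
Context {R : realType}.
Local Notation mR := (measurableTypeR R).

Definition tcons {n} (z : mR * n.-tuple mR) : n.+1.-tuple mR :=
  [the n.+1.-tuple mR of z.1 :: z.2].

Lemma measurable_tcons n : measurable_fun setT (@tcons n).
Proof. exact: measurable_cons. Qed.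

Section step.
Variables (n : nat) (mu : {sigma_finite_measure set (n.-tuple mR) -> \bar R}).

Definition lebesgue_step : set (n.+1.-tuple mR) -> \bar R :=
  pushforward (@lebesgue_measure R \x mu)%E (@tcons n).

Let lebesgue_step0 : lebesgue_step set0 = 0%E.
Proof. by rewrite /lebesgue_step /pushforward preimage_set0 measure0. Qed.

Let lebesgue_step_ge0 A : (0 <= lebesgue_step A)%E.
Proof. by rewrite /lebesgue_step /pushforward measure_ge0. Qed.

Let lebesgue_step_sigma_additive : semi_sigma_additive lebesgue_step.
Proof.
move=> F mF tF mUF; rewrite /lebesgue_step /pushforward preimage_bigcup.
apply: measure_semi_sigma_additive.
- by move=> k; rewrite -[X in measurable X]setTI; exact: measurable_tcons.
- apply/trivIsetP => /= i j _ _ ij; rewrite -preimage_setI.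
  by move/trivIsetP : tF => /(_ _ _ _ _ ij) ->//; rewrite preimage_set0.
- by rewrite -preimage_bigcup -[X in measurable X]setTI; exact: measurable_tcons.
Qed.

HB.instance Definition _ := isMeasure.Build _ _ _ lebesgue_step
  lebesgue_step0 lebesgue_step_ge0 lebesgue_step_sigma_additive.

Let lebesgue_step_sigma_finite : sigma_finite setT lebesgue_step.
Proof.
have [F FT Foo] : sigma_finite setT (@lebesgue_measure R \x mu)%E.
  have /sigma_finiteP[F [TF ndF Foo]] := sigma_finiteT (@lebesgue_measure R).
  have /sigma_finiteP[G [TG ndG Goo]] := sigma_finiteT mu.
  exists (fun k => F k `*` G k).
    rewrite -setXTT TF TG predeqE => -[x y]; split.
      move=> [/= [k _ Fkx] [l _ Gly]]; exists (maxn k l) => //; split.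
      - by move: x Fkx; exact/subsetPset/ndF/leq_maxl.
      - by move: y Gly; exact/subsetPset/ndG/leq_maxr.
    by move=> [k _ []/= ? ?]; split; exists k.
  move=> k; have [? ?] := Foo k; have [? ?] := Goo k.
  split; first exact: measurableX.
  by rewrite product_measure1E// lte_mul_pinfty// ge0_fin_numE.
pose unc (x : n.+1.-tuple mR) : mR * n.-tuple mR := (thead x, [tuple of behead x]).
have uncK : cancel unc (@tcons n).
  by move=> x; apply/val_inj; rewrite /= [in RHS](tuple_eta x).
have tconsK : cancel (@tcons n) unc.
  by move=> [a x]; congr pair; apply/val_inj.
have munc : measurable_fun setT unc.
  apply/measurable_fun_pairP; split; first exact: measurable_tnth.
  exact: measurable_behead.
exists (fun k => unc @^-1` F k) => [|k].
  by rewrite -preimage_bigcup -FT preimage_setT.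
have [mFk Fkoo] := Foo k; split.
  by rewrite -[X in measurable X]setTI; exact: munc.
rewrite /lebesgue_step /pushforward -comp_preimage.
by rewrite (_ : unc \o _ = id) ?preimage_id//; exact/funext.
Qed.

HB.instance Definition _ := Measure_isSigmaFinite.Build _ _ _ lebesgue_step
  lebesgue_step_sigma_finite.

End step.

Fixpoint lebesgue_tuple (n : nat) :
    {sigma_finite_measure set (n.-tuple mR) -> \bar R} :=
  match n with
  | 0 => @dirac _ (0.-tuple mR) [tuple] R
  | n'.+1 => lebesgue_step (lebesgue_tuple n')
  end.

End LebesgueTuple.
Arguments lebesgue_tuple {R} n.

Section Schwartz.
Context {R : realType} (m : nat).
Implicit Type g : 'rV[R]_m -> R.

(* Iterated partial derivatives along the coordinate directions listed in js,
   the head of js being the last one taken; every multi-index derivative is of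
   this form. *)
Definition iter_partial (js : seq 'I_m) g : 'rV[R]_m -> R :=
  foldr (fun j h z => 'D_(delta_mx 0 j) h z) g js.

Definition smooth g := forall js : seq 'I_m,
  continuous (iter_partial js g) /\
  forall (j : 'I_m) z, derivable (iter_partial js g) z (delta_mx 0 j).

Definition real_schwartz g := smooth g /\
  forall (b : 'I_m -> nat) (js : seq 'I_m), exists C : R, forall z : 'rV[R]_m,
    `| (\prod_(j < m) z 0 j ^+ b j) * iter_partial js g z | <= C.

(* R[i] is not a normed space over R in the library, so derivatives of
   complex-valued functions are taken componentwise. *)
Definition schwartz (f : 'rV[R]_m -> R[i]) :=
  real_schwartz (fun z => complex.Re (f z)) /\
  real_schwartz (fun z => complex.Im (f z)).

End Schwartz.

Section Hermite.
Context {R : realType}.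

Definition hermite_poly (k : nat) (x : R) : R :=
  (-1) ^+ k * expR (x ^+ 2) * derive1n k (fun y : R => expR (- y ^+ 2)) x.

Definition hermite_fun (k : nat) (x : R) : R :=
  (2 ^+ k * Num.sqrt pi * k`!%:R) `^ (- 2^-1) *
  hermite_poly k x * expR (- x ^+ 2 / 2).

Definition hermite_tuple n (a : n.-tuple nat) (x : n.-tuple R) : R :=
  \prod_(j < n) hermite_fun (tnth a j) (tnth x j).

Definition scaled_hermite n (a : n.-tuple nat) (l : R) (x : n.-tuple R) : R :=
  `|l| `^ (n%:R / 4) *
  hermite_tuple a [tuple Num.sqrt `|l| * tnth x j | j < n].

End Hermite.

Section HermiteFourier.
Context {R : realType}.

Definition xts {n} (x : n.-tuple R) (t s : R) : 'rV[R]_(n + 2) :=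
  row_mx (\row_j tnth x j) (row_mx t%:M s%:M).

Definition expi (x : R) : R[i] := Complex (cos x) (sin x).

Definition Cintegral d (T : measurableType d)
    (mu : {measure set T -> \bar R}) (g : T -> R[i]) : R[i] :=
  Complex (Rintegral mu setT (fun x => complex.Re (g x)))
          (Rintegral mu setT (fun x => complex.Im (g x))).

Definition hermite_fourier n (f : 'rV[R]_(n + 2) -> R[i])
    (z : n.-tuple nat * R * R) : R[i] :=
  let: (a, l, nu) := z in
  Cintegral (lebesgue_tuple n) (fun x =>
    Cintegral lebesgue_measure (fun t =>
      Cintegral lebesgue_measure (fun s =>
        expi (l * t) * expi (nu * s) * f (xts x t s) *
        (scaled_hermite a l x)%:C%C))).

End HermiteFourier.

Section Surface.
Context {R : realType} (n : nat).

Definition frequency (a : n.-tuple nat) (l : R) : R :=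
  (2 * (\sum_(j < n) tnth a j) + n)%:R * `|l|.

Definition surface : set (n.-tuple nat * R * R) :=
  [set z | z.1.2 != 0 /\ z.2 = frequency z.1.1 z.1.2].

(* A function on the surface is represented by its extension by zero. *)
Definition restriction (f : 'rV[R]_(n + 2) -> R[i]) :
    n.-tuple nat * R * R -> R[i] :=
  patch (fun=> 0) surface (hermite_fourier f).

(* The integral against the localized surface measure, for nonnegative Theta. *)
Definition sigma_loc_integral (psi : R -> R)
    (Theta : n.-tuple nat * R * R -> \bar R) : \bar R :=
  (\esum_(a in [set: n.-tuple nat])
    \int[lebesgue_measure]_(l in [set~ (0%R : R)])
      (Theta (a, l, frequency a l) * (psi (frequency a l))%:E))%E.

Definition L2_sigma_loc (psi : R -> R) (g : n.-tuple nat * R * R -> R[i]) :=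
  (sigma_loc_integral psi (fun z => (Normc.normc (g z) ^+ 2)%:E) `^ (2^-1)%R)%E.

(* Lnorm is the essential supremum when the exponent is +oo. *)
Definition mixed_norm (r q p : \bar R) (f : 'rV[R]_(n + 2) -> R[i]) : \bar R :=
  Lnorm lebesgue_measure r (fun t =>
    Lnorm lebesgue_measure q (fun s =>
      Lnorm (lebesgue_tuple n) p (fun x => (Normc.normc (f (xts x t s)))%:E))).

End Surface.

Section Cutoff.
Context {R : realType}.
Implicit Type psi : R -> R.

Definition smooth1 psi := forall (k : nat) (x : R), derivable (derive1n k psi) x 1.

Definition even_fun psi := forall x, psi (- x) = psi x.

Definition compactly_supported psi := compact (closure [set x | psi x != 0]).

End Cutoff.

(* Main.v *)
(* Fix a degree k = |alpha| and put N = 2 k + n: on the surface nu = N |lambda|, and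
   the cutoff confines lambda to |lambda| <= B / N. For fixed t, the square
   integral over this window of the coefficients of degree k of g(x, s) is bounded
   by the squares of three norms of g:
   - the L^1 norm, with constant O(N^(-5/4)): the sum of Phi_alpha^2 over
     |alpha| = k is O(N^(n/2 - 1/4)), by Sonin's bound in one coordinate and a
     telescoping bound for sums of h_j^2 in the others;
   - the L^1_s L^2_x norm, with constant O(1/N), by Bessel's inequality in x;
   - the L^2 norm, with constant O(1/N), by Bessel's inequality and a local
     Plancherel inequality in lambda.
   Cutting g at height tau times its mixed norm, with tau = N^(-1/(4p)), gives for
   the L^q_s L^p_x norm the constant O(N^(-1 - eta)) with eta = (2 - p)/(4p) > 0,
   which is summable in k. Minkowski's inequality in t then gives the L^1_t norm. *)
Require Import Defs.
From HB Require Import structures.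
From mathcomp Require Import all_boot all_order all_algebra.
From mathcomp Require Import ring lra.
From mathcomp Require Import complex.
From mathcomp Require Import all_classical all_reals all_analysis.
From mathcomp Require Import measurable_realfun.

Set Implicit Arguments.
Unset Strict Implicit.
Unset Printing Implicit Defensive.

Import Order.TTheory GRing.Theory Num.Theory.
Import numFieldNormedType.Exports.

Local Open Scope classical_set_scope.
Local Open Scope ring_scope.

(** * Calculus on the real line *)

Section RealCalculus.
Context {R : realType}.
Local Notation mu := (@lebesgue_measure R).
Implicit Types (f g F u v : R -> R) (x y : R).

(** At [p = 2] the three pieces balance at 1/N, and the sum over the degree diverges
    logarithmically. All the room comes from [p < 2], converted into a power of N through the L^1
    endpoint. There the trivial bound N^(n/2) for the sum of the squares of the [Phi_alpha] would
    again give only 1/N, so any power gained over it suffices; this is why a crude pointwise bound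
    in a single coordinate is enough. The L^p_x norm of a slice varies with s, so the truncation
    height follows it where it is large and stays at the level of the full norm where it is small;
    this is where [q <= p] enters. The degree is the right unit because the phase lambda t + N
    |lambda| s depends on alpha only through N. At fixed t and s it factors out of Bessel's
    inequality in x, and at fixed t the term lambda t only rotates the pair (cosine, sine), so the
    bounds are uniform in t. Everything is carried out for real functions: the real and imaginary
    parts of f against cosine and sine. *)

Lemma is_derive1_fun f F : (forall x, is_derive x 1 F (f x)) -> F^`()%classic = f.
Proof. by move=> dF; apply/funext => x; rewrite derive1E; apply: derive_val. Qed.

Lemma is_derive1_derivable F x (df : R) : is_derive x 1 F df -> derivable F x 1.
Proof. by case. Qed.

Lemma is_derive1_continuous f F : (forall x, is_derive x 1 F (f x)) -> continuous F.
Proof.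
move=> dF x; apply: differentiable_continuous; apply/derivable1_diffP.
exact: is_derive1_derivable (dF x).
Qed.

Lemma FTC_segment f F a b : (forall x, is_derive x 1 F (f x)) -> continuous f ->
  a <= b -> (\int[mu]_(x in `[a, b]) (f x)%:E = (F b - F a)%:E)%E.
Proof.
move=> dF cf; rewrite le_eqVlt => /predU1P[->|ab].
  by rewrite set_itv1 integral_set1 subrr.
have cF := is_derive1_continuous dF.
rewrite EFinB; apply: continuous_FTC2 => //.
- exact: continuous_subspaceT.
- split=> [x _||].
  + exact: is_derive1_derivable (dF x).
  + by apply: cvg_at_right_filter; exact: cF.
  + by apply: cvg_at_left_filter; exact: cF.
- by move=> x _; rewrite (is_derive1_fun dF).
Qed.

Lemma oneDsqr_gt0 x : 0 < 1 + x ^+ 2.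
Proof. by rewrite ltr_pwDl// sqr_ge0. Qed.

Lemma continuous_inv_oneDsqr : continuous (fun x : R => (1 + x ^+ 2)^-1).
Proof. exact: continuous_oneDsqrV. Qed.

Lemma measurable_inv_oneDsqr : measurable_fun setT (fun x : R => (1 + x ^+ 2)^-1).
Proof. by apply: continuous_measurable_fun; exact: continuous_inv_oneDsqr. Qed.

Lemma integral_inv_oneDsqr :
  (\int[mu]_x ((1 + x ^+ 2)^-1)%:E = (pi : R)%:E)%E.
Proof.
rewrite ge0_symfun_integralT.
- rewrite -set_itvcy (_ : (fun x => _) = fun x : R => ((oneDsqr x)^-1)%:E)//.
  by rewrite integral0y_oneDsqr -EFinM mulrC divfK.
- by move=> x; rewrite invr_ge0 ltW// oneDsqr_gt0.
- exact: continuous_inv_oneDsqr.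
- by move=> x /=; rewrite sqrrN.
Qed.

(** One weight serves two purposes: it is integrable, with integral [pi], and it tends to 0, which
    removes the boundary terms at infinity. *)
Definition decays u := exists C, forall x, `|u x| <= C / (1 + x ^+ 2).

Lemma decays_bound u C : (forall x, `|u x| <= C / (1 + x ^+ 2)) -> 0 <= C.
Proof.
by move=> /(_ 0); rewrite expr0n addr0 divr1; apply: le_trans.
Qed.

Lemma decaysM u v C : decays u -> (forall x, `|v x| <= C) -> decays (u \* v).
Proof.
move=> [D uD] vC; have D0 := decays_bound uD.
exists (D * C) => x /=; rewrite normrM mulrAC.
by apply: ler_pM => //.
Qed.

Lemma decaysD u v : decays u -> decays v -> decays (u \+ v).
Proof.
move=> [D uD] [C vC]; exists (D + C) => x /=.
by rewrite mulrDl (le_trans (ler_normD _ _))// lerD.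
Qed.

Lemma decays_bounded u : decays u -> exists C, forall x, `|u x| <= C.
Proof.
move=> [D uD]; exists D => x; rewrite (le_trans (uD x))//.
rewrite ler_pdivrMr ?oneDsqr_gt0// ler_peMr ?(decays_bound uD)//.
by rewrite lerDl sqr_ge0.
Qed.

Lemma integrable_inv_oneDsqr C :
  mu.-integrable setT (fun x => (C / (1 + x ^+ 2))%:E).
Proof.
under eq_fun do rewrite EFinM.
apply: integrableZl => //; apply/integrableP; split.
  by apply/measurable_EFinP; exact: measurable_inv_oneDsqr.
under eq_integral do rewrite gee0_abs ?lee_fin ?invr_ge0 ?(ltW (oneDsqr_gt0 _))//.
by rewrite integral_inv_oneDsqr ltry.
Qed.

Lemma decays_integrable u : continuous u -> decays u ->
  mu.-integrable setT (EFin \o u).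
Proof.
move=> cu [C uC]; apply: le_integrable (integrable_inv_oneDsqr C) => //.
  by apply/measurable_EFinP; exact: continuous_measurable_fun.
move=> x _ /=; rewrite lee_fin (le_trans (uC x))// ler_norm//.
Qed.

Lemma decays_le_seq F a : decays F -> forall e, 0 < e ->
  exists2 y, a <= y & `|F y| <= e /\ `|F (- y)| <= e.
Proof.
move=> [C FC] e e0; have C0 := decays_bound FC.
(* Since [y >= 1], one has y^2 >= y >= C / e, whence C / (1 + y^2) <= e. *)
pose y := `|a| + C / e + 1; have y1 : 1 <= y.
  by rewrite lerDr addr_ge0// divr_ge0// ltW.
exists y; first by rewrite /y -addrA (le_trans (ler_norm _))// lerDl addr_ge0// divr_ge0// ltW.
have Cy : C / (1 + y ^+ 2) <= e.
  rewrite ler_pdivrMr ?oneDsqr_gt0// mulrC -ler_pdivrMr//.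
  rewrite (@le_trans _ _ y)//; first by rewrite /y addrAC lerDr addr_ge0.
  by rewrite (@le_trans _ _ (y ^+ 2))// ?lerDr// ler_eXnr.
by split; rewrite (le_trans (FC _))// sqrrN.
Qed.

Lemma leq_sqr_aux (n : nat) : (n <= n * n)%N.
Proof. by case: n => // n; rewrite leq_pmulr. Qed.

(** The integrals over [-n, n] equal F(n) - F(-n), which tends to 0; dominated convergence
    identifies their limit with the full integral. *)
Lemma integral_derivative_eq0 f F : (forall x, is_derive x 1 F (f x)) ->
  continuous f -> decays f -> decays F -> (\int[mu]_x (f x)%:E = 0)%E.
Proof.
move=> dF cf df dFF.
have intf := decays_integrable cf df.
have mf : measurable_fun [set: R] (EFin \o f) by exact: measurable_int intf.
have cvgI : (fun n : nat => (F n%:R - F (- n%:R))%:E) @ \oo -->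
    (\int[mu]_x (f x)%:E)%E.
  rewrite (_ : (fun n : nat => _) =
      fun n : nat => (\int[mu]_x ((f \_ `[- n%:R, n%:R]) x)%:E)%E); last first.
    apply/funext => n; rewrite -(FTC_segment dF cf) ?ge0_cp//.
    by rewrite integral_mkcond; apply: eq_integral => x _; rewrite restrict_EFin.
  apply: (@dominated_cvg _ _ _ mu setT measurableT _ _ (abse \o (EFin \o f))) => //.
  - move=> n; apply/measurable_EFinP; apply: (measurable_restrictT _ _).1 => //.
    by apply: measurable_funTS; exact: continuous_measurable_fun.
  - move=> x _; apply: cvg_near_cst; near=> n.
    rewrite patchE ifT// inE/= in_itv/=; rewrite -ler_norml.
    near: n; exact: nbhs_infty_ger.
  - exact: integrable_abse.
  - move=> n x _ /=; rewrite patchE; case: ifPn => // _.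
    by rewrite normr0 lee_fin.
have : (fun n : nat => (F n%:R - F (- n%:R))%:E) @ \oo --> (0 : \bar R)%E.
  have [C FC] := dFF; have C0 := decays_bound FC.
  apply/cvg_EFin; first by near=> n.
  apply/cvgr0Pnorm_le => e e0; near=> n => /=.
  have : C / (1 + n%:R ^+ 2) <= e / 2.
    rewrite ler_pdivrMr ?oneDsqr_gt0// mulrC -ler_pdivrMr ?divr_gt0//.
    rewrite (@le_trans _ _ n%:R)//; first by near: n; exact: nbhs_infty_ger.
    rewrite (@le_trans _ _ (n%:R ^+ 2))// ?lerDr// -natrX ler_nat.
    by rewrite -mulnn; exact: leq_sqr_aux.
  move=> Cn; rewrite (le_trans (ler_normB _ _))// (splitr e).
  by rewrite lerD// (le_trans (FC _))// ?sqrrN.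
by move=> /cvg_lim <- //; apply/esym/cvg_lim.
Unshelve. all: by end_near. Qed.

(** F vanishes at infinity, so F(x) is the integral of f over [x, oo), at most the integral of the
    nonnegative majorant g over the whole line. This turns L^2 identities for Hermite functions into
    pointwise bounds. *)
Lemma le_of_derivative f g F A : (forall x, is_derive x 1 F (- f x)) ->
  continuous f -> decays F ->
  measurable_fun setT g -> (forall x, 0 <= g x) -> (forall x, f x <= g x) ->
  (\int[mu]_x (g x)%:E <= A%:E)%E -> forall x, F x <= A.
Proof.
move=> dF cf dFF mg g0 fg gA x; apply/ler_addgt0Pr => e e0.
have [y xy [Fy _]] := decays_le_seq x dFF e0.
have dNF (z : R) : is_derive z (1 : R) (\- F) (f z).
  rewrite -[f z]opprK; exact: is_deriveN.
have := FTC_segment dNF cf xy => /= I.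
have : ((F x - F y)%:E <= A%:E)%E.
  rewrite (_ : F x - F y = - F y - - F x); last by rewrite opprK addrC.
  rewrite -I.
  apply: (le_trans _ gA).
  apply: (@le_trans _ _ (\int[mu]_(x0 in `[x, y]) (g x0)%:E)%E).
    apply: (@le_integral _ _ _ mu) => //.
    - apply: continuous_compact_integrable; first exact: segment_compact.
      exact: continuous_subspaceT.
    - apply/integrableP; split.
        by apply/measurable_EFinP; exact: measurable_funTS.
      under eq_integral do rewrite gee0_abs ?lee_fin//.
      apply: (@le_lt_trans _ _ A%:E); last by rewrite ltry.
      apply: (le_trans _ gA); apply: ge0_subset_integral => //.
        exact/measurable_EFinP.
      by move=> z _; rewrite lee_fin.
    - by move=> z _; rewrite lee_fin fg.
  apply: ge0_subset_integral => //; first exact/measurable_EFinP.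
  by move=> z _; rewrite lee_fin.
rewrite lee_fin; have := le_trans (ler_norm _) Fy; lra.
Qed.

End RealCalculus.

(** * Hermite functions *)

Section HermiteFunctions.
Context {R : realType}.
Local Notation mu := (@lebesgue_measure R).
Implicit Types x : R.

(** The physicists' Hermite polynomials as formal polynomials; their agreement with the Rodrigues
    formula of [hermite_poly] is established inside [hermite_funE]. *)
Fixpoint hermite_p (k : nat) : {poly R} :=
  if k is k'.+1 then 2%:R%:P * 'X * hermite_p k' - (hermite_p k')^`() else 1.

Arguments hermite_p : simpl never.

Let hE := (@hornerM R, @hornerC R, @hornerX R, @hornerD R, @hornerN R).

Lemma hermite_pS k :
  hermite_p k.+1 = 2%:R%:P * 'X * hermite_p k - (hermite_p k)^`().
Proof. by []. Qed.

Lemma deriv_hermite_p k : (hermite_p k.+1)^`() = (2 * k.+1)%:R%:P * hermite_p k.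
Proof.
elim: k => [|k IH].
  rewrite hermite_pS (_ : hermite_p 0 = 1%:P)// derivC subr0 !derivM derivX !derivC.
  by rewrite muln1; ring.
rewrite hermite_pS derivB !derivM derivX derivC IH !derivM derivC mul0r !add0r mulr1.
have -> : (2 * k.+2)%:R = 2%:R + (2 * k.+1)%:R :> R by rewrite mulnS natrD.
by rewrite polyCD hermite_pS; ring.
Qed.

Definition gauss_half x := expR (- x ^+ 2 / 2).

Definition poly_gauss (p : {poly R}) x := p.[x] * gauss_half x.

Lemma is_derive_gauss_half x : is_derive x 1 gauss_half (- x * gauss_half x).
Proof.
rewrite /gauss_half.
have d : is_derive x 1 (fun y : R => - y ^+ 2 / 2) (- x).
  have -> : (fun y : R => - y ^+ 2 / 2) = horner (- 'X^2 * (2^-1)%:P).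
    by apply/funext => y; rewrite !hornerE.
  apply: is_derive_eq.
  rewrite derivM derivC mulr0 addr0 derivN derivXn !hornerE/=; lra.
have := is_derive1_comp (is_derive_expR _) d.
by rewrite /comp mulrC.
Qed.

Lemma is_derive_poly_gauss p x :
  is_derive x 1 (poly_gauss p) (poly_gauss (p^`() - 'X * p) x).
Proof.
have := is_deriveM (is_derive_poly p x) (is_derive_gauss_half x).
move=> H; apply: is_derive_eq; rewrite /poly_gauss !hornerE /GRing.scale /=; ring.
Qed.

(** Monomials are handled by one term of the exponential series, general polynomials by Horner's
    decomposition p X + c. *)
Lemma poly_gauss_bounded p : exists C, forall x, `|poly_gauss p x| <= C.
Proof.
have mono m : exists C, forall x, `|x ^+ m * gauss_half x| <= C.
  exists (1 + m.+1`!%:R * 2 ^+ m.+1) => x.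
  rewrite normrM normrX [`|gauss_half x|]ger0_norm ?expR_ge0//.
  have e1 : gauss_half x <= 1.
    by rewrite /gauss_half expR_le1 mulNr oppr_le0 divr_ge0// sqr_ge0.
  have g0 : 0 < gauss_half x by exact: expR_gt0.
  have [x1|x1] := lerP `|x| 1.
    rewrite (@le_trans _ _ 1)//; last by rewrite lerDl mulr_ge0// exprn_ge0.
    by rewrite mulr_ile1 ?exprn_ge0 ?exprn_ile1 ?(ltW g0).
  (* The Taylor term of order [m.+1] of exp(x^2/2) dominates |x|^m, because |x|^m <= |x|^(2(m+1))
     for |x| > 1. *)
  have h : (x ^+ 2 / 2) ^+ m.+1 / m.+1`!%:R <= expR (x ^+ 2 / 2).
    have := @expR_ge1Dxn R (x ^+ 2 / 2) m; rewrite divr_ge0 ?sqr_ge0// => /(_ isT).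
    by apply: le_trans; rewrite lerDr.
  rewrite ler_wpDl//.
  have -> : gauss_half x = (expR (x ^+ 2 / 2))^-1.
    by rewrite /gauss_half mulNr expRN.
  rewrite ler_pdivrMr ?expR_gt0//.
  apply: (@le_trans _ _ (`|x| ^+ 2 ^+ m.+1)).
    by rewrite -exprM ler_weXn2l ?(ltW x1)// ltnW//; exact: leq_pmull.
  move: h; rewrite expr_div_n -real_normK ?num_real//.
  by rewrite ler_pdivrMr ?ltr0n ?fact_gt0// ler_pdivrMr ?exprn_gt0// => /le_trans; apply;
     rewrite [leRHS]mulrC mulrA.
(* The extra factor x^m makes the induction on p close: passing from p to p X + c raises m by
   one. *)
suff : forall m, exists C, forall x, `|p.[x] * x ^+ m * gauss_half x| <= C.
  move=> /(_ 0%N) [C pC]; exists C => x; have := pC x.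
  by rewrite expr0 mulr1.
elim/poly_ind: p => [m|p c IH m].
  by exists 0 => x; rewrite horner0 !mul0r normr0.
have [C1 h1] := IH m.+1; have [C2 h2] := mono m.
exists (C1 + `|c| * C2) => x.
rewrite (_ : _ * _ = p.[x] * x ^+ m.+1 * gauss_half x + c * (x ^+ m * gauss_half x)).
  by rewrite (le_trans (ler_normD _ _))// lerD// normrM ler_wpM2l.
by rewrite !hE exprS; ring.
Qed.

(** Multiplication by 1 + x^2 stays in the class of polynomials times the Gaussian, so boundedness
    already gives decay. *)
Lemma poly_gauss_decays p : decays (poly_gauss p).
Proof.
have [C pC] := poly_gauss_bounded (p * (1 + 'X^2)); exists C => x.
rewrite ler_pdivlMr ?oneDsqr_gt0//.
rewrite -[1 + x ^+ 2]gtr0_norm ?oneDsqr_gt0// -normrM.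
by rewrite (le_trans _ (pC x))// /poly_gauss !hornerE mulrAC.
Qed.

Definition hermite_norm k := (2 ^+ k * Num.sqrt pi * k`!%:R : R) `^ (- 2^-1).

(** The coefficient sqrt(2(k+1)) of the creation operator: x h_k - h_k' = [ladder k] h_{k+1}. *)
Definition ladder k : R := Num.sqrt (2 * k.+1%:R).

Lemma ladder_gt0 k : 0 < ladder k. Proof. by rewrite sqrtr_gt0 mulr_gt0. Qed.

Lemma ladder_sqr k : ladder k ^+ 2 = 2 * k.+1%:R.
Proof. by rewrite sqr_sqrtr// mulr_ge0. Qed.

Lemma hermite_normS k : hermite_norm k = ladder k * hermite_norm k.+1.
Proof.
rewrite /hermite_norm.
set a := 2 ^+ k * Num.sqrt pi * k`!%:R.
have a0 : 0 < a.
  by rewrite !mulr_gt0 ?exprn_gt0 ?ltr0n ?fact_gt0// sqrtr_gt0 pi_gt0.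
have -> : 2 ^+ k.+1 * Num.sqrt pi * k.+1`!%:R = 2 * k.+1%:R * a.
  by rewrite factS natrM exprS /a; ring.
rewrite (@powRM _ (2 * k.+1%:R) a) ?mulr_ge0 ?(ltW a0)// mulrA.
rewrite [X in _ = X * _](_ : _ = 1) ?mul1r//.
by rewrite powRN powR12_sqrt ?mulr_ge0// mulfV// gt_eqF// ladder_gt0.
Qed.

Local Notation h := (@hermite_fun R).

Lemma hermite_funE k : h k = poly_gauss ((hermite_norm k)%:P * hermite_p k).
Proof.
apply/funext => x; rewrite /hermite_fun /hermite_poly.
suff -> : derive1n k (fun y : R => expR (- y ^+ 2)) x =
  (-1) ^+ k * (hermite_p k).[x] * expR (- x ^+ 2).
  rewrite /poly_gauss hornerM hornerC -/(hermite_norm k); congr (_ * _ * _).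
  rewrite (_ : _ * _ = (-1) ^+ (k + k) * (expR (x ^+ 2) * expR (- x ^+ 2)) *
    (hermite_p k).[x]); last by rewrite exprD; ring.
  by rewrite expRxMexpNx_1 addnn -signr_odd odd_double !mul1r.
elim: k x => [|k IH] x; first by rewrite derive1n0 /= expr0 hornerC !mul1r.
rewrite derive1nS (_ : derive1n k _ =
  fun y => (-1) ^+ k * (hermite_p k).[y] * expR (- y ^+ 2)); last exact/funext.
rewrite derive1E.
have d : is_derive x 1 (fun y : R => - y ^+ 2) (- (2 * x)).
  have -> : (fun y : R => - y ^+ 2) = horner (- 'X^2).
    by apply/funext => y; rewrite !hornerE.
  by apply: is_derive_eq; rewrite derivN derivXn !hornerE/=; ring.
have de : is_derive x 1 (fun y => expR (- y ^+ 2)) (- (2 * x) * expR (- x ^+ 2)).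
  by have := is_derive1_comp (is_derive_expR _) d; rewrite /comp mulrC.
have dp := is_deriveM (is_derive_poly (hermite_p k) x) de.
have := is_deriveZ ((-1) ^+ k) dp => dd.
rewrite (_ : (fun y => _) = (-1) ^+ k \*: (horner (hermite_p k) * (fun y => expR (- y ^+ 2)))); last first.
  by apply/funext => y /=; rewrite -mulrA.
rewrite derive_val [(-1) ^+ k.+1]exprS hermite_pS !hE.
rewrite -![_ *: _]/(_ * _).
set E := expR _; ring.
Qed.

Lemma hermite_decays k : decays (h k).
Proof. by rewrite hermite_funE; exact: poly_gauss_decays. Qed.

Lemma mulx_hermite_decays k : decays (fun x => x * h k x).
Proof.
rewrite hermite_funE (_ : (fun x => _) =
  poly_gauss ('X * ((hermite_norm k)%:P * hermite_p k))).
  exact: poly_gauss_decays.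
by apply/funext => x; rewrite /poly_gauss /= !hE; ring.
Qed.

Lemma is_derive_hermite k x :
  is_derive x 1 (h k) (x * h k x - ladder k * h k.+1 x).
Proof.
have -> : x * h k x - ladder k * h k.+1 x = poly_gauss
    (((hermite_norm k)%:P * hermite_p k)^`() - 'X * ((hermite_norm k)%:P * hermite_p k)) x.
  rewrite !hermite_funE /poly_gauss hermite_normS hermite_pS derivM derivC.
  by rewrite mul0r add0r !hE; ring.
rewrite hermite_funE; exact: is_derive_poly_gauss.
Qed.

(** The three-term recurrence, from H_{k+1}' = 2(k+1) H_k. It is solved for the lowest index, so
    that no predecessor and no case k = 0 arise. *)
Lemma hermite_ladder_down k x :
  ladder k * h k x = 2 * x * h k.+1 x - ladder k.+1 * h k.+2 x.
Proof.
rewrite !hermite_funE /poly_gauss (hermite_normS k) (hermite_normS k.+1).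
rewrite (hermite_pS k.+1) deriv_hermite_p !hE natrM -(ladder_sqr k); ring.
Qed.

Lemma continuous_hermite k : continuous (h k).
Proof. exact: is_derive1_continuous (is_derive_hermite k). Qed.

Lemma hermite_parity k x : h k (- x) ^+ 2 = h k x ^+ 2.
Proof.
suff H : h k (- x) = (-1) ^+ k * h k x.
  by rewrite H exprMn -exprM mulnC exprM sqrrN expr1n expr1n mul1r.
(* Two consecutive indices are carried along, since the recurrence has order two. *)
have : h k (- x) = (-1) ^+ k * h k x /\ h k.+1 (- x) = (-1) ^+ k.+1 * h k.+1 x.
  elim: k => [|k [IH1 IH2]].
    rewrite !hermite_funE /poly_gauss /gauss_half (hermite_pS 0) (_ : hermite_p 0 = 1%:P)// derivC !hE sqrrN.
    by split; ring.
  split => //; apply: (mulfI (lt0r_neq0 (ladder_gt0 k.+1))).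
  have -> : ladder k.+1 * h k.+2 (- x) =
      2 * (- x) * h k.+1 (- x) - ladder k * h k (- x).
    by rewrite hermite_ladder_down; ring.
  have -> : ladder k.+1 * ((-1) ^+ k.+2 * h k.+2 x) =
      (-1) ^+ k.+2 * (2 * x * h k.+1 x - ladder k * h k x).
    by rewrite hermite_ladder_down; ring.
  by rewrite IH1 IH2 !exprS; ring.
by case.
Qed.

End HermiteFunctions.

(** * Orthonormality and pointwise bounds in one variable *)

Section HermiteBounds.
Context {R : realType}.
Local Notation mu := (@lebesgue_measure R).
Local Notation h := (@hermite_fun R).
Local Notation s := (@ladder R).
Implicit Types x : R.

Lemma hermite1E x : s 0 * h 1 x = 2 * x * h 0 x.
Proof.
rewrite !hermite_funE /poly_gauss (hermite_normS 0) (hermite_pS 0).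
rewrite (_ : hermite_p 0 = 1%:P)// derivC.
by rewrite !(hornerM, hornerC, hornerX, hornerD, hornerN); ring.
Qed.

(** The derivative h_k', in the form supplied by the creation operator. *)
Definition hermite_d k x := x * h k x - s k * h k.+1 x.

(** The Hermite equation h_k'' = (x^2 - (2k+1)) h_k, source of the Wronskian, Sonin and monotonicity
    arguments below. *)
Lemma is_derive_hermite_d k x :
  is_derive x 1 (hermite_d k) ((x ^+ 2 - (2 * k + 1)%:R) * h k x).
Proof.
have d1 := is_deriveM (is_derive_id x (1 : R)) (is_derive_hermite k x).
have d2 := is_deriveZ (s k) (is_derive_hermite k.+1 x).
have := is_deriveB d1 d2.
rewrite (_ : id * h k - s k \*: h k.+1 = hermite_d k)// => d.
apply: is_derive_eq; rewrite -![_ *: _]/(_ * _).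
have e1 : s k ^+ 2 = 2 * (k%:R + 1) by rewrite ladder_sqr natr1.
have e2 : s k.+1 * h k.+2 x = 2 * x * h k.+1 x - s k * h k x.
  by rewrite hermite_ladder_down; ring.
rewrite e2 (natrD _ (2 * k) 1) natrM; ring: e1.
Qed.

Lemma is_derive_hermite_sqr k x :
  is_derive x 1 (fun y => h k y ^+ 2) (2 * h k x * hermite_d k x).
Proof.
have := is_deriveM (is_derive_hermite k x) (is_derive_hermite k x).
rewrite (_ : h k * h k = fun y => h k y ^+ 2)//.
move=> d; apply: is_derive_eq; rewrite -![_ *: _]/(_ * _) /hermite_d; ring.
Qed.

Lemma hermite_d_decays k : decays (hermite_d k).
Proof.
have [C hC] := hermite_decays (R := R) k.+1.
apply: (@decaysD _ (fun x => x * h k x) (fun x => - (s k * h k.+1 x))).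
  exact: mulx_hermite_decays.
exists (s k * C) => x; rewrite normrN normrM gtr0_norm ?ladder_gt0// -mulrA.
by rewrite ler_wpM2l// ltW// ladder_gt0.
Qed.

Lemma hermiteM_decays j k : decays (fun x => h j x * h k x).
Proof.
have [C hC] := decays_bounded (hermite_decays (R := R) k).
exact: decaysM (hermite_decays j) hC.
Qed.

Lemma continuous_hermiteM j k : continuous (fun x => h j x * h k x).
Proof. by move=> x; apply: cvgM; exact: continuous_hermite. Qed.

Lemma integrable_hermiteM j k :
  mu.-integrable setT (fun x => (h j x * h k x)%:E).
Proof.
exact: decays_integrable (@continuous_hermiteM j k) (hermiteM_decays j k).
Qed.

Lemma decaysZ (u : R -> R) c : decays u -> decays (fun x => c * u x).
Proof.
move=> [C uC]; exists (`|c| * C) => x.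
by rewrite normrM -mulrA ler_wpM2l.
Qed.

(** The Wronskian W = h_j' h_k - h_j h_k' decays and, by the Hermite equation, has derivative 2(k-j)
    h_j h_k, whose integral therefore vanishes. *)
Lemma hermite_orthogonal j k : j != k ->
  (\int[mu]_x (h j x * h k x)%:E = 0)%E.
Proof.
move=> jk.
pose W x := hermite_d j x * h k x - h j x * hermite_d k x.
pose c : R := 2 * (k%:R - j%:R).
have c0 : c != 0.
  by rewrite mulf_neq0// subr_eq0 eqr_nat eq_sym.
have dW x : is_derive x 1 W (c * (h j x * h k x)).
  have d1 := is_deriveM (is_derive_hermite_d j x) (is_derive_hermite k x).
  have d2 := is_deriveM (is_derive_hermite j x) (is_derive_hermite_d k x).
  have := is_deriveB d1 d2.
  rewrite (_ : _ - _ = W)// => d.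
  apply: is_derive_eq; rewrite -![_ *: _]/(_ * _) /hermite_d /c (natrD _ (2 * j) 1) (natrD _ (2 * k) 1) !natrM; ring.
have decW : decays W.
  have [Cj hj] := decays_bounded (hermite_decays (R := R) j).
  have [Ck hk] := decays_bounded (hermite_decays (R := R) k).
  apply: (@decaysD _ (hermite_d j \* h k) (fun x => - (h j x * hermite_d k x))).
    exact: decaysM (hermite_d_decays j) hk.
  have [C dC] := decaysM (hermite_d_decays k) hj.
  by exists C => x; rewrite normrN mulrC; exact: dC.
have := integral_derivative_eq0 dW _ _ decW.
have -> : (\int[mu]_x (c * (h j x * h k x))%:E =
    c%:E * \int[mu]_x (h j x * h k x)%:E)%E.
  under eq_integral do rewrite EFinM.
  by rewrite integralZl//; exact: integrable_hermiteM.
move=> /(_ _ _)/eqP; rewrite mule_eq0 eqe (negbTE c0)/= => H.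
apply/eqP; apply: H.
  by move=> x; apply: cvgM; [exact: cvg_cst|exact: continuous_hermiteM].
by apply: decaysZ; exact: hermiteM_decays.
Qed.

(** The derivative of h_k h_{k+1} is [s k] (h_k^2 - h_{k+1}^2); its integral is 0, so consecutive
    norms agree, and the norm of h_0 is a Gaussian integral. *)
Lemma hermite_normalized k : (\int[mu]_x (h k x * h k x)%:E = 1)%E.
Proof.
elim: k => [|k IH].
  have -> : (fun x => (h 0 x * h 0 x)%:E) =
      fun x => ((Num.sqrt pi)^-1%:E * (gauss_fun x)%:E)%E.
    apply/funext => x; rewrite -EFinM; congr EFin.
    rewrite hermite_funE /poly_gauss (_ : hermite_p 0 = 1%:P)// !(hornerM, hornerC) mulr1.
    rewrite mulrACA; congr (_ * _).
      rewrite /hermite_norm expr0 fact0 mulr1 mul1r -expr2.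
      rewrite powRN powR12_sqrt ?sqrtr_ge0// exprVn sqr_sqrtr// sqrtr_ge0//.
    by rewrite /gauss_half /gauss_fun -expRD; congr expR; lra.
  rewrite integralZl//; last exact: integrableT_gauss.
  by rewrite integralT_gauss -EFinM mulVf// gt_eqF// sqrtr_gt0 pi_gt0.
pose F x := h k x * h k.+1 x.
have dF x : is_derive x 1 F (s k * (h k x * h k x - h k.+1 x * h k.+1 x)).
  have := is_deriveM (is_derive_hermite k x) (is_derive_hermite k.+1 x).
  rewrite (_ : h k * h k.+1 = F)// => d.
  apply: is_derive_eq; rewrite -![_ *: _]/(_ * _).
  have := hermite_ladder_down k x => e2.
  have {}e2 : s k.+1 * h k.+2 x = 2 * x * h k.+1 x - s k * h k x.
    by rewrite e2; ring.
  by rewrite e2; ring.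
have cdiff : continuous (fun x => h k x * h k x - h k.+1 x * h k.+1 x).
  by move=> x; apply: cvgB; exact: continuous_hermiteM.
have := integral_derivative_eq0 dF.
have -> : (\int[mu]_x (s k * (h k x * h k x - h k.+1 x * h k.+1 x))%:E =
    (s k)%:E * (\int[mu]_x (h k x * h k x)%:E -
      \int[mu]_x (h k.+1 x * h k.+1 x)%:E))%E.
  rewrite -integralB//; [|exact: integrable_hermiteM..].
  rewrite -integralZl//.
  by apply: (integrableB measurableT); exact: integrable_hermiteM.
rewrite IH => H; have : ((s k)%:E * (1 - \int[mu]_x (h k.+1 x * h k.+1 x)%:E) = 0)%E.
  apply: H.
  - by move=> x; apply: cvgM; [exact: cvg_cst|exact: cdiff].
  - apply: decaysZ.
    apply: (@decaysD _ (fun x => h k x * h k x) (fun x => - (h k.+1 x * h k.+1 x))).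
      exact: hermiteM_decays.
    have [C hC] := hermiteM_decays k.+1 k.+1; exists C => x.
    by rewrite normrN.
  - exact: hermiteM_decays.
move/eqP; rewrite mule_eq0 eqe gt_eqF ?ladder_gt0//=.
have fI : (\int[mu]_x (h k.+1 x * h k.+1 x)%:E)%E \is a fin_num.
  by apply: integrable_fin_num => //; exact: integrable_hermiteM.
by rewrite -(fineK fI) -EFinB eqe subr_eq0 => /eqP <-.
Qed.

(** By the recurrence the derivatives of the h_j^2 telescope to -[s k] h_k h_{k+1}. The majorant
    [s k] (h_k^2 + h_{k+1}^2) / 2 has integral [s k]. *)
Lemma hermite_sqr_sum_bound k x :
  \sum_(j < k.+1) h j x ^+ 2 <= s k.
Proof.
pose g x := s k / 2 * (h k x * h k x + h k.+1 x * h k.+1 x).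
have cg : continuous g.
  move=> y; apply: cvgM; first exact: cvg_cst.
  by apply: cvgD; exact: continuous_hermiteM.
apply: (@le_of_derivative _ (fun y => s k * (h k y * h k.+1 y)) g
  (fun y => \sum_(j < k.+1) h j y ^+ 2)).
- elim: {g cg} k x => [|k IH] x y.
    rewrite (_ : (fun y => _) = fun y => h 0 y ^+ 2); last first.
      by apply/funext => z; rewrite big_ord1.
    have := is_derive_hermite_sqr 0 y => d; apply: is_derive_eq.
    rewrite [X in _ = - X](_ : _ = h 0 y * (s 0 * h 1 y)); last by ring.
    by rewrite /hermite_d !hermite1E; ring.
  rewrite (_ : (fun y => _) = (fun y => \sum_(j < k.+1) h j y ^+ 2) +
    (fun y => h k.+1 y ^+ 2)); last first.
    by apply/funext => z; rewrite big_ord_recr.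
  have := is_deriveD (IH x y) (is_derive_hermite_sqr k.+1 y) => d.
  apply: is_derive_eq; rewrite /hermite_d.
  rewrite (_ : s k * _ = s k * h k y * h k.+1 y); last by ring.
  by rewrite hermite_ladder_down; ring.
- by move=> y; apply: cvgM; [exact: cvg_cst|exact: continuous_hermiteM].
- elim: {g cg x} k => [|k IH].
    rewrite (_ : (fun y => _) = fun y => h 0 y * h 0 y); last first.
      by apply/funext => z; rewrite big_ord1.
    exact: hermiteM_decays.
  rewrite (_ : (fun y => _) = (fun y => \sum_(j < k.+1) h j y ^+ 2) \+
    (fun y => h k.+1 y * h k.+1 y)); last first.
    by apply/funext => z; rewrite big_ord_recr.
  by apply: decaysD => //; exact: hermiteM_decays.
- exact: continuous_measurable_fun.
- by move=> y; rewrite /g mulr_ge0 ?divr_ge0 ?(ltW (ladder_gt0 _))// -!expr2 addr_ge0// sqr_ge0.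
- move=> y; rewrite /g -mulrA ler_wpM2l ?(ltW (ladder_gt0 _))//.
  have := sqr_ge0 (h k y - h k.+1 y); rewrite sqrrB; lra.
- rewrite /g; under eq_integral do rewrite EFinM EFinD.
  rewrite integralZl//=; last by apply: (integrableD measurableT); exact: integrable_hermiteM.
  rewrite integralD//; [|exact: integrable_hermiteM..].
  by rewrite !hermite_normalized -EFinD -EFinM lee_fin; lra.
Qed.

(** The recurrence squared, with (a+b)^2 <= 2a^2 + 2b^2. After integration it gives the second
    moment bound 2k+1. At k = 0 the value [0.-1 = 0] carries the coefficient 0. *)
Lemma mulx_hermite_sqr_le k x :
  x ^+ 2 * h k x ^+ 2 <= k.+1%:R * h k.+1 x ^+ 2 + k%:R * h k.-1 x ^+ 2.
Proof.
case: k => [|k] /=.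
  have : 2 * h 1 x ^+ 2 = 4 * (x ^+ 2 * h 0 x ^+ 2).
    have := congr1 (fun z => z ^+ 2) (hermite1E x).
    by rewrite exprMn ladder_sqr mulr1 => ->; ring.
  have := sqr_ge0 (h 1 x); rewrite mulr0n mul0r addr0 mul1r; lra.
have := hermite_ladder_down k x => e.
have {}e : 2 * (x * h k.+1 x) = s k * h k x + s k.+1 * h k.+2 x by rewrite e; ring.
have e2 : (2 * (x * h k.+1 x)) ^+ 2 <=
    2 * ((s k * h k x) ^+ 2 + (s k.+1 * h k.+2 x) ^+ 2).
  rewrite e; have := sqr_ge0 (s k * h k x - s k.+1 * h k.+2 x).
  by rewrite sqrrB sqrrD; lra.
move: e2; rewrite !exprMn !ladder_sqr; lra.
Qed.

(** Sonin's function for the Hermite equation: differentiation cancels all terms except -2 x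
    h_k^2. *)
Definition sonin k x := ((2 * k + 1)%:R - x ^+ 2) * h k x ^+ 2 + hermite_d k x ^+ 2.

Lemma sonin_bound k x : sonin k x <= 2 * Num.sqrt (2 * k + 1)%:R.
Proof.
set N : R := (2 * k + 1)%:R; set r := Num.sqrt N.
have N0 : 0 < N by rewrite /N ltr0n addn1.
have r0 : 0 < r by rewrite sqrtr_gt0.
have rr : r ^+ 2 = N by rewrite sqr_sqrtr// ltW.
(* From 2 x h^2 <= x^2 h^2 / r + r h^2 and the second moment bound, g has integral N / r + r; the
   choice r = sqrt N balances the two terms. *)
pose g x := (k.+1%:R * (h k.+1 x * h k.+1 x) + k%:R * (h k.-1 x * h k.-1 x)) / r +
  r * (h k x * h k x).
have cg : continuous g.
  move=> y; apply: cvgD.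
    apply: cvgM; last exact: cvg_cst.
    by apply: cvgD; apply: cvgM; (try exact: cvg_cst); exact: continuous_hermiteM.
  by apply: cvgM; [exact: cvg_cst|exact: continuous_hermiteM].
apply: (@le_of_derivative _ (fun y => 2 * y * (h k y * h k y)) g).
- move=> y.
  pose q y := N - y ^+ 2 : R.
  have dq : is_derive y 1 q (- (2 * y)).
    rewrite /q (_ : (fun y => _) = horner (N%:P - 'X^2)).
      by apply: is_derive_eq; rewrite derivB derivC derivXn sub0r !hornerE/=; ring.
    by apply/funext => z; rewrite !hornerE.
  have d1 := is_deriveM dq (is_derive_hermite_sqr k y).
  have d2 := is_deriveM (is_derive_hermite_d k y) (is_derive_hermite_d k y).
  have := is_deriveD d1 d2.
  rewrite (_ : _ + _ = sonin k)//.
  move=> d; apply: is_derive_eq; rewrite -![_ *: _]/(_ * _) /q -/N; ring.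
- move=> y; apply: cvgM; last exact: continuous_hermiteM.
  by apply: cvgM; [exact: cvg_cst|exact: cvg_id].
- have -> : sonin k = (fun x => (- (x * h k x)) * (x * h k x)) \+
      ((fun x => N * (h k x * h k x)) \+ (fun x => hermite_d k x * hermite_d k x)).
    by apply/funext => y /=; rewrite /sonin -/N; ring.
  have [C1 hC1] := decays_bounded (mulx_hermite_decays (R := R) k).
  have [C2 hC2] := decays_bounded (hermite_d_decays k).
  apply: decaysD; last apply: decaysD.
  + apply: (@decaysM _ (fun x => - (x * h k x)) (fun x => x * h k x)) hC1.
    have [C hC] := mulx_hermite_decays (R := R) k.
    by exists C => y; rewrite normrN.
  + by apply: decaysZ; exact: hermiteM_decays.
  + exact: decaysM (hermite_d_decays k) hC2.
- exact: continuous_measurable_fun.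
- move=> y; rewrite /g addr_ge0//.
    by rewrite divr_ge0 ?(ltW r0)// addr_ge0// mulr_ge0// -expr2 sqr_ge0.
  by rewrite mulr_ge0 ?(ltW r0)// -expr2 sqr_ge0.
- move=> y; rewrite /g.
  apply: (@le_trans _ _ ((y ^+ 2 * h k y ^+ 2) / r + r * (h k y * h k y))); last first.
    rewrite lerD2r ler_wpM2r ?invr_ge0 ?(ltW r0)//.
    by have := mulx_hermite_sqr_le k y; rewrite !expr2.
  rewrite -subr_ge0 (_ : _ - _ = (y - r) ^+ 2 * h k y ^+ 2 / r).
    by rewrite divr_ge0 ?(ltW r0)// mulr_ge0// sqr_ge0.
  by field; rewrite gt_eqF.
- have -> : (fun x => (g x)%:E) = fun x => (r^-1%:E * (k.+1%:R%:E * (h k.+1 x * h k.+1 x)%:E +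
      k%:R%:E * (h k.-1 x * h k.-1 x)%:E) + r%:E * (h k x * h k x)%:E)%E.
    by apply/funext => y; rewrite /g mulrC.
  have iZ c j : mu.-integrable setT (fun x => (c%:E * (h j x * h j x)%:E)%E).
    by apply: (integrableZl measurableT); exact: integrable_hermiteM.
  have iS : mu.-integrable setT (fun x => (k.+1%:R%:E * (h k.+1 x * h k.+1 x)%:E +
      k%:R%:E * (h k.-1 x * h k.-1 x)%:E)%E).
    by apply: (integrableD measurableT); exact: iZ.
  rewrite integralD//; last by apply: (integrableZl measurableT); exact: iS.
  rewrite integralZl// integralD//; [|exact: iZ..].
  rewrite !integralZl//; [|exact: integrable_hermiteM..].
  rewrite !hermite_normalized !mule1.
  rewrite [leLHS](_ : _ = (r^-1 * (k.+1%:R + k%:R) + r)%:E)// lee_fin.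
  rewrite -natrD (_ : (k.+1 + k)%:R = N) -?rr; last first.
    by rewrite rr /N; congr (_%:R); rewrite addSn addnn -mul2n addn1.
  by rewrite expr2 mulKf ?gt_eqF//; lra.
Qed.

(** Beyond the turning point sqrt N, u = h h' has derivative h'^2 + (x^2 - N) h^2 >= 0 and tends to
    0, hence u <= 0; and 2u is the derivative of h^2. *)
Lemma hermite_sqr_nonincreasing k x y : Num.sqrt (2 * k + 1)%:R <= x -> x <= y ->
  h k y ^+ 2 <= h k x ^+ 2.
Proof.
set N : R := (2 * k + 1)%:R => Nx xy.
have sqrN z : Num.sqrt N <= z -> 0 <= z ^+ 2 - N.
  move=> Nz; rewrite subr_ge0 -[N]sqr_sqrtr ?ler0n//.
  by rewrite lerXn2r// nnegrE ?sqrtr_ge0// (le_trans _ Nz)// sqrtr_ge0.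
pose u z := h k z * hermite_d k z.
have du (z : R) : is_derive z 1 u (hermite_d k z ^+ 2 + (z ^+ 2 - N) * h k z ^+ 2).
  have := is_deriveM (is_derive_hermite k z) (is_derive_hermite_d k z).
  rewrite (_ : _ * _ = u)// => d.
  by apply: is_derive_eq; rewrite -![_ *: _]/(_ * _) /hermite_d; ring.
have decu : decays u.
  have [C hC] := decays_bounded (hermite_d_decays k).
  exact: decaysM (hermite_decays k) hC.
have u_le0 z : Num.sqrt N <= z -> u z <= 0.
  move=> Nz; apply/ler_addgt0Pr => e e0; rewrite add0r.
  have [w zw [uw _]] := decays_le_seq z decu e0.
  apply: le_trans (le_trans (ler_norm _) uw).
  apply: (@ger0_derive1_ndecry _ u z) => //.
  - move=> v; rewrite in_itv/= andbT => zv; rewrite (is_derive1_fun du).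
    by rewrite addr_ge0 ?sqr_ge0// mulr_ge0 ?sqr_ge0// sqrN// (le_trans Nz)// ltW.
  - by apply: continuous_subspaceT; exact: is_derive1_continuous du.
apply: (@ler0_derive1_nincry _ (fun z => h k z ^+ 2) x _ _ _ x y _ xy).
- by move=> v _; exact: is_derive1_derivable (is_derive_hermite_sqr k v).
- move=> v; rewrite in_itv/= andbT => xv.
  rewrite (is_derive1_fun (is_derive_hermite_sqr k)) -mulrA mulr_ge0_le0//.
  by rewrite u_le0// (le_trans Nx)// ltW.
- by apply: continuous_subspaceT; exact: is_derive1_continuous (is_derive_hermite_sqr k).
- exact: lexx.
Qed.

Lemma hermite_sqr_bound_aux k x (r : R) : 1 <= r -> r ^+ 8 = (2 * k + 1)%:R ->
  0 <= x -> x <= r ^+ 4 -> h k x ^+ 2 <= 8 * r ^+ 2.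
Proof.
move=> r1 rN x0 xr.
have r0 : 0 < r by rewrite (lt_le_trans _ r1).
have r84 : r ^+ 8 = (r ^+ 4) ^+ 2 by rewrite -exprM.
have S z : (r ^+ 8 - z ^+ 2) * h k z ^+ 2 + hermite_d k z ^+ 2 <= 2 * r ^+ 4.
  have := sonin_bound k z; rewrite /sonin -rN.
  by rewrite [in Num.sqrt _]r84 sqrtr_sqr ger0_norm// exprn_ge0// ltW.
(* The point y lies within 1/r of x but at distance at least 1/r from the turning point r^4 = sqrt
   N. *)
pose y := Num.max 0 (x - r^-1).
have y0 : 0 <= y by rewrite /y le_max lexx.
have yx : y <= x by rewrite /y ge_max x0 gerBl invr_ge0 ltW.
have xy : x - y <= r^-1 by rewrite lerBlDl -lerBlDr /y le_max lexx orbT.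
have rV1 : r^-1 <= 1 by rewrite invf_le1.
have r41 : 1 <= r ^+ 4 by rewrite exprn_ege1.
have ry : r^-1 <= r ^+ 4 - y.
  rewrite lerBrDl -lerBrDr /y ge_max subr_ge0 lerD2r xr andbT.
  exact: le_trans rV1 r41.
(* At y the factor r^8 - y^2 = (r^4 - y)(r^4 + y) is at least r^3, so Sonin's bound 2 r^4 controls
   h^2. *)
have hy : h k y ^+ 2 <= 2 * r.
  have h1 : r ^+ 3 <= r ^+ 8 - y ^+ 2.
    rewrite (_ : r ^+ 8 - y ^+ 2 = (r ^+ 4 - y) * (r ^+ 4 + y)); last by ring.
    rewrite (_ : r ^+ 3 = r^-1 * r ^+ 4); last by field; rewrite gt_eqF.
    by rewrite ler_pM ?invr_ge0 ?exprn_ge0 ?(ltW r0)// lerDl.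
  have h2 : r ^+ 3 * h k y ^+ 2 <= 2 * r ^+ 4.
    apply: le_trans (S y); rewrite -[leLHS]addr0 lerD ?sqr_ge0//.
    by rewrite ler_wpM2r ?sqr_ge0.
  rewrite -(@ler_pM2l _ (r ^+ 3)) ?exprn_gt0// (le_trans h2)// le_eqVlt.
  by apply/orP; left; apply/eqP; ring.
(* Between y and x only the slope is controlled, by h'^2 <= 2 r^4; over a length at most 1/r this
   changes h by at most sqrt 2 times r. *)
have [c cyx hc] : exists2 c, c \in `[y, x] & h k x - h k y = hermite_d k c * (x - y).
  apply: (MVT_segment yx); first by move=> z _; exact: is_derive_hermite.
  by apply: continuous_subspaceT; exact: continuous_hermite.
have dc : hermite_d k c ^+ 2 <= 2 * r ^+ 4.
  apply: le_trans (S c); rewrite -[leLHS]add0r lerD2r mulr_ge0 ?sqr_ge0//.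
  move: cyx; rewrite in_itv/= => /andP[yc cx].
  rewrite subr_ge0 r84.
  by rewrite lerXn2r ?nnegrE ?(le_trans y0 yc) ?exprn_ge0 ?(ltW r0) ?(le_trans cx xr).
have hxy : (h k x - h k y) ^+ 2 <= 2 * r ^+ 2.
  rewrite hc exprMn.
  have -> : 2 * r ^+ 2 = 2 * r ^+ 4 * r^-1 ^+ 2 by field; rewrite gt_eqF.
  rewrite ler_pM ?sqr_ge0// lerXn2r// nnegrE ?subr_ge0// invr_ge0 ltW//.
have rr : r <= r ^+ 2 by rewrite ler_eXnr.
have -> : h k x = (h k x - h k y) + h k y by rewrite subrK.
move: hxy hy; set d := h k x - h k y; set w := h k y => hxy hy.
rewrite (_ : (d + w) ^+ 2 = 2 * d ^+ 2 + 2 * w ^+ 2 - (d - w) ^+ 2); last by ring.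
have := sqr_ge0 (d - w); lra.
Qed.

(* With r = N^(1/8), N = 2k+1, the Sonin function controls h_k on [0, sqrt N - 1/r]
   and its slope on the remaining interval; the exponent 1/4 is not optimal, but
   any exponent below 1/2 suffices. *)
Lemma hermite_sqr_bound k x :
  h k x ^+ 2 <= 8 * Num.sqrt (Num.sqrt (2 * k + 1)%:R).
Proof.
set N : R := (2 * k + 1)%:R.
have N1 : 1 <= N by rewrite /N ler1n addn1.
pose r := Num.sqrt (Num.sqrt (Num.sqrt N)).
have r2 : r ^+ 2 = Num.sqrt (Num.sqrt N) by rewrite sqr_sqrtr// sqrtr_ge0.
have r4 : r ^+ 4 = Num.sqrt N.
  by rewrite (exprM r 2 2) r2 sqr_sqrtr// sqrtr_ge0.
have r8 : r ^+ 8 = N.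
  by rewrite (exprM r 4 2) r4 sqr_sqrtr// (le_trans ler01).
have r1 : 1 <= r by rewrite -[1]sqrtr1 ler_wsqrtr// -[1]sqrtr1 ler_wsqrtr// -[1]sqrtr1 ler_wsqrtr.
rewrite -r2.
wlog x0 : x / 0 <= x => [hw|].
  have [x0|/ltW x0] := lerP 0 x; first exact: hw.
  by rewrite -hermite_parity hw// oppr_ge0.
have [xr|/ltW xr] := lerP x (r ^+ 4).
  exact: hermite_sqr_bound_aux.
apply: (@le_trans _ _ (h k (r ^+ 4) ^+ 2)).
  by apply: hermite_sqr_nonincreasing => //; rewrite -/N -r4.
by apply: hermite_sqr_bound_aux => //; rewrite exprn_ge0// (le_trans ler01).
Qed.

End HermiteBounds.

(** * Minkowski and Bessel inequalities *)

Section SquareIntegrals.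
Local Open Scope ereal_scope.
Context d (T : measurableType d) (R : realType) (mu : {measure set T -> \bar R}).
Context (I : Type) (A : seq I).
Implicit Types f g : I -> T -> R.

Let Z f g := \sum_(a <- A) \int[mu]_x `|f a x * g a x|%:E.

(** The pointwise inequality 2|fg| <= e f^2 + g^2 / e, integrated. It remains meaningful with
    infinite integrals; optimizing e gives Cauchy-Schwarz. *)
Lemma sum_integral_AMGM f g (e : R) : (0 < e)%R ->
  (forall a, measurable_fun setT (f a)) -> (forall a, measurable_fun setT (g a)) ->
  2%:E * Z f g <= e%:E * \sum_(a <- A) \int[mu]_x (f a x ^+ 2)%:E +
     e^-1%:E * \sum_(a <- A) \int[mu]_x (g a x ^+ 2)%:E.
Proof.
move=> e0 mf mg.
have sq_ge0 (h : I -> T -> R) a : 0 <= \int[mu]_x (h a x ^+ 2)%:E.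
  by apply: integral_ge0 => x _; rewrite lee_fin sqr_ge0.
have msq (h : I -> T -> R) a : measurable_fun setT (h a) ->
    measurable_fun setT (fun x => (h a x ^+ 2)%:E).
  by move=> mh; apply/measurable_EFinP; exact: measurable_funX.
have eZ (k : R) (h : T -> R) : (0 <= k)%R -> measurable_fun setT h ->
    k%:E * (\int[mu]_x `|h x|%:E) = \int[mu]_x (k * `|h x|)%:E.
  move=> k0 mh; rewrite -ge0_integralZl_EFin//.
  by apply/measurable_EFinP; exact: measurableT_comp.
have eZ2 (k : R) (h : I -> T -> R) a : (0 <= k)%R -> measurable_fun setT (h a) ->
    k%:E * (\int[mu]_x (h a x ^+ 2)%:E) = \int[mu]_x (k * h a x ^+ 2)%:E.
  move=> k0 mh; rewrite -ge0_integralZl_EFin//; last exact: msq.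
  by move=> x _; rewrite lee_fin sqr_ge0.
have mk (k : R) (h : I -> T -> R) a : measurable_fun setT (h a) ->
    measurable_fun setT (fun x => (k * h a x ^+ 2)%:E).
  by move=> mh; apply/measurable_EFinP; apply: measurable_funM => //; exact: measurable_funX.
rewrite /Z !ge0_sume_distrr; try (by move=> a _; exact: integral_ge0);
  try (by move=> a _; exact: sq_ge0).
rewrite -big_split/=; apply: lee_sum => a _.
rewrite eZ//; last exact: measurable_funM.
rewrite eZ2 ?(ltW e0)// eZ2 ?invr_ge0 ?(ltW e0)//.
rewrite -ge0_integralD//; last 4 first.
- by move=> x _; rewrite lee_fin mulr_ge0 ?sqr_ge0// ltW.
- exact: mk.
- by move=> x _; rewrite lee_fin mulr_ge0 ?sqr_ge0 ?invr_ge0 ?ltW.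
- exact: mk.
apply: ge0_le_integral => //.
- apply/measurable_EFinP; apply: measurable_funM => //.
  by apply: measurableT_comp => //; exact: measurable_funM.
- by apply: emeasurable_funD; exact: mk.
- move=> x _; rewrite -EFinD lee_fin normrM.
  rewrite -(real_normK (num_real (f a x))) -(real_normK (num_real (g a x))).
  set u := `|f a x|%R; set v := `|g a x|%R.
  rewrite -subr_ge0 (_ : _ - _ = e^-1 * (e * u - v) ^+ 2)%R.
    by rewrite mulr_ge0 ?sqr_ge0// invr_ge0 ltW.
  by field; rewrite gt_eqF.
Qed.

(** The bounds are given as L c^2 and L k^2, the form in which [Minkowski_integral] supplies them.
    As c or k may vanish, both are shifted by e > 0, the weight (k+e)/(c+e) is used, and e tends to
    0. *)
Lemma sum_integral_CauchySchwarz f g (L c k : R) : (0 <= L)%R -> (0 <= c)%R -> (0 <= k)%R ->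
  (forall a, measurable_fun setT (f a)) -> (forall a, measurable_fun setT (g a)) ->
  \sum_(a <- A) \int[mu]_x (f a x ^+ 2)%:E <= (L * c ^+ 2)%:E ->
  \sum_(a <- A) \int[mu]_x (g a x ^+ 2)%:E <= (L * k ^+ 2)%:E ->
  Z f g <= (L * (c * k))%:E.
Proof.
move=> L0 c0 k0 mf mg hf hg.
have H (e : R) : (0 < e)%R -> Z f g <= (L * ((c + e) * (k + e)))%:E.
  move=> e0.
  have ce : (0 < c + e)%R by rewrite ltr_wpDl.
  have ke : (0 < k + e)%R by rewrite ltr_wpDl.
  have q0 : (0 < (k + e) / (c + e))%R by rewrite divr_gt0.
  have := sum_integral_AMGM q0 mf mg => h.
  have {}h : 2%:E * Z f g <= 2%:E * (L * ((c + e) * (k + e)))%:E.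
    apply: (le_trans h); rewrite -EFinM.
    rewrite (_ : (2 * (L * ((c + e) * (k + e))))%R = ((k + e) / (c + e) * (L * (c + e) ^+ 2) +
      ((k + e) / (c + e))^-1 * (L * (k + e) ^+ 2))%R); last first.
      by field; rewrite !gt_eqF.
    rewrite EFinD; apply: leeD.
      rewrite [leRHS]EFinM lee_wpmul2l ?lee_fin ?(ltW q0)//.
      apply: (le_trans hf); rewrite lee_fin ler_wpM2l// lerXn2r ?nnegrE ?(ltW ce)//.
      by rewrite lerDl ltW.
    rewrite [leRHS]EFinM lee_wpmul2l ?lee_fin ?invr_ge0 ?(ltW q0)//.
    apply: (le_trans hg); rewrite lee_fin ler_wpM2l// lerXn2r ?nnegrE ?(ltW ke)//.
    by rewrite lerDl ltW.
  by move: h; rewrite lee_pmul2l// lte_fin.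
have Zfin : Z f g \is a fin_num.
  rewrite ge0_fin_numE.
    by rewrite (le_lt_trans (H 1%R ltr01))// ltry.
  by apply: sume_ge0 => a _; exact: integral_ge0.
move: H; rewrite -(fineK Zfin); set z := fine _ => H.
rewrite lee_fin; apply/ler_addgt0Pr => e e0.
(* For t <= 1 the excess of L (c+t)(k+t) over L c k is at most t m. *)
pose m := (L * (c + k + 1) + 1)%R.
have m0 : (0 < m)%R by rewrite /m ltr_wpDl// mulr_ge0// !addr_ge0.
pose t := Num.min 1%R (e / m)%R.
have t0 : (0 < t)%R by rewrite /t lt_min ltr01 divr_gt0.
have t1 : (t <= 1)%R by rewrite /t ge_min lexx.
have tm : (t * m <= e)%R by rewrite -ler_pdivlMr// /t ge_min lexx orbT.
have := H _ t0; rewrite lee_fin => h; apply: (le_trans h).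
rewrite (_ : (L * ((c + t) * (k + t)))%R = (L * (c * k) + t * (L * (c + k + t)))%R); last by ring.
rewrite lerD2l (le_trans _ tm)// ler_wpM2l ?(ltW t0)// /m.
by rewrite ler_wpDr// ler_wpM2l// lerD2l.
Qed.

End SquareIntegrals.

Section SigmaFiniteProduct.
Context d1 d2 (T1 : measurableType d1) (T2 : measurableType d2) (R : realType).
Variables (m1 : {sigma_finite_measure set T1 -> \bar R}).
Variables (m2 : {sigma_finite_measure set T2 -> \bar R}).

(* The library gives the product m1 \x m2 no canonical sigma-finite structure. *)
Definition sfprod : set (T1 * T2) -> \bar R := (m1 \x m2)%E.

HB.instance Definition _ := Measure.copy sfprod (m1 \x m2)%E.

Let sfprod_sigma_finite : sigma_finite setT sfprod.
Proof.
have /sigma_finiteP[F [TF ndF Foo]] := sigma_finiteT m1.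
have /sigma_finiteP[G [TG ndG Goo]] := sigma_finiteT m2.
exists (fun k => F k `*` G k).
  rewrite -setXTT TF TG predeqE => -[x y]; split.
    move=> [/= [k _ Fkx] [l _ Gly]]; exists (maxn k l) => //; split.
    - by move: x Fkx; exact/subsetPset/ndF/leq_maxl.
    - by move: y Gly; exact/subsetPset/ndG/leq_maxr.
  by move=> [k _ []/= ? ?]; split; exists k.
move=> k; have [? ?] := Foo k; have [? ?] := Goo k.
split; first exact: measurableX.
by rewrite /sfprod product_measure1E// lte_mul_pinfty// ge0_fin_numE.
Qed.

HB.instance Definition _ := Measure_isSigmaFinite.Build _ _ _ sfprod
  sfprod_sigma_finite.

End SigmaFiniteProduct.
Section MinkowskiIntegral.
Local Open Scope ereal_scope.
Context d1 d2 (S : measurableType d1) (L : measurableType d2) (R : realType).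
Variables (m1 : {sigma_finite_measure set S -> \bar R}).
Variables (m2 : {sigma_finite_measure set L -> \bar R}).

Lemma integral_sqr_tensor (v : S -> \bar R) : measurable_fun setT v ->
  (forall s, 0 <= v s) ->
  \int[sfprod m1 m1]_z (v z.1 * v z.2) = \int[m1]_s v s * \int[m1]_s v s.
Proof.
move=> mv v0; rewrite [LHS]fubini_tonelli1//; last 2 first.
- by apply: emeasurable_funM; apply: measurableT_comp.
- by move=> z; rewrite mule_ge0.
rewrite -ge0_integralZr//; last exact: integral_ge0.
by apply: eq_integral => s _; rewrite /fubini_F/= ge0_integralZl.
Qed.

(** The square of the inner integral is a double integral over (s, s'). Tonelli moves it outside,
    and Cauchy-Schwarz over A x L at each pair gives C v(s) v(s'). The squared form avoids roots of
    possibly infinite quantities. It is applied below in (x, s), in s, and in t. *)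
Lemma Minkowski_integral (I : Type) (A : seq I) (G : I -> S * L -> R) (v : S -> R) (C : R) :
  (0 <= C)%R -> (forall a, measurable_fun setT (G a)) ->
  measurable_fun setT v -> (forall s, (0 <= v s)%R) ->
  (forall s, \sum_(a <- A) \int[m2]_l (G a (s, l) ^+ 2)%:E <= (C * v s ^+ 2)%:E) ->
  \sum_(a <- A) \int[m2]_l (\int[m1]_s `|G a (s, l)|%:E * \int[m1]_s `|G a (s, l)|%:E)
    <= C%:E * (\int[m1]_s (v s)%:E * \int[m1]_s (v s)%:E).
Proof.
move=> C0 mG mv v0 Gv.
have mGs a l : measurable_fun setT (fun s => G a (s, l)).
  exact: measurable_fun_pair1.
have mGl a s : measurable_fun setT (fun l => G a (s, l)).
  exact: measurable_fun_pair2.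
pose H a (w : (S * S) * L) := `|G a (w.1.1, w.2) * G a (w.1.2, w.2)|%:E.
have mH a : measurable_fun setT (H a).
  apply/measurable_EFinP; apply: measurableT_comp => //.
  apply: measurable_funM.
    apply: (measurableT_comp (mG a)); apply: measurable_fun_pair => //.
    exact: measurableT_comp.
  apply: (measurableT_comp (mG a)); apply: measurable_fun_pair => //.
  exact: measurableT_comp.
have H0 a x : 0 <= H a x by rewrite lee_fin.
rewrite (eq_bigr (fun a => \int[sfprod m1 m1]_z \int[m2]_l H a (z, l))); last first.
  move=> a _; rewrite (@fubini_tonelli _ _ _ _ _ (sfprod m1 m1) m2 (H a))//.
  apply: eq_integral => l _; rewrite -integral_sqr_tensor//.
    by apply: eq_integral => z _; rewrite /H/= normrM EFinM.
  by apply/measurable_EFinP; exact: measurableT_comp.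
rewrite -ge0_integral_sum//; last 2 first.
- by move=> a; apply: measurable_fun_fubini_tonelli_F.
- by move=> a z _; exact: integral_ge0.
rewrite -integral_sqr_tensor//; last first.
  exact/measurable_EFinP.
rewrite -ge0_integralZl_EFin//; last 2 first.
- by move=> z _; rewrite mule_ge0// lee_fin.
- apply: emeasurable_funM; apply/measurable_EFinP; exact: measurableT_comp.
apply: ge0_le_integral => //.
- by move=> z _; apply: sume_ge0 => a _; exact: integral_ge0.
- by apply: emeasurable_sum => a; apply: measurable_fun_fubini_tonelli_F.
- apply: measurable_funeM.
  by apply: emeasurable_funM; apply/measurable_EFinP; exact: measurableT_comp.
move=> [s s'] _ /=; rewrite -!EFinM.
exact: (@sum_integral_CauchySchwarz _ _ _ m2 _ _ (fun a l => G a (s, l)) (fun a l => G a (s', l))).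
Qed.

End MinkowskiIntegral.

Section ParametricIntegral.
Local Open Scope ereal_scope.
Context d1 d2 (S : measurableType d1) (L : measurableType d2) (R : realType).
Variables (m1 : {sigma_finite_measure set S -> \bar R}).

(** Tonelli's measurability for the positive and the negative part, so that the sections of h may
    fail to be integrable. *)
Lemma measurable_param_integral (h : S * L -> \bar R) : measurable_fun setT h ->
  measurable_fun setT (fun l => \int[m1]_s h (s, l)).
Proof.
move=> mh.
have H1 := @measurable_fun_fubini_tonelli_G _ _ _ _ _ m1 _ (measurable_funepos mh)
  (fun z => funepos_ge0 h z).
have H2 := @measurable_fun_fubini_tonelli_G _ _ _ _ _ m1 _ (measurable_funeneg mh)
  (fun z => funeneg_ge0 h z).
rewrite [X in measurable_fun _ X](_ : _ = fubini_G m1 h^\+ \- fubini_G m1 h^\-).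
  exact: emeasurable_funB.
apply/funext => l; rewrite [LHS]integralE.
by congr (_ - _); apply: eq_integral => s _; rewrite ?funeposE ?funenegE.
Qed.

Lemma measurable_param_Rintegral (h : S * L -> R) : measurable_fun setT h ->
  measurable_fun setT (fun l => (\int[m1]_s h (s, l))%R).
Proof.
move=> mh; apply: (measurableT_comp (@fine_measurable R setT measurableT)).
apply: (@measurable_param_integral (EFin \o h)).
exact/measurable_EFinP.
Qed.

End ParametricIntegral.

Section Bessel.
Context d (T : measurableType d) (R : realType) (mu : {measure set T -> \bar R}).
Implicit Types u v : T -> R.

Definition square_integrable u :=
  measurable_fun setT u /\ (\int[mu]_x (u x ^+ 2)%:E < +oo)%E.

Lemma square_integrableM u v : square_integrable u -> square_integrable v ->
  mu.-integrable setT (fun x => (u x * v x)%:E).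
Proof.
move=> [mu' u2] [mv v2]; apply/integrableP; split.
  by apply/measurable_EFinP; exact: measurable_funM.
have msq (w : T -> R) : measurable_fun setT w -> measurable_fun setT (fun x => (w x ^+ 2)%:E).
  by move=> mw; apply/measurable_EFinP; exact: measurable_funX.
apply: (@le_lt_trans _ _ (\int[mu]_x ((u x ^+ 2)%:E + (v x ^+ 2)%:E))%E).
  apply: ge0_le_integral => //.
  - apply: measurableT_comp => //; apply/measurable_EFinP.
    exact: measurable_funM.
  - by apply: emeasurable_funD; exact: msq.
  - move=> x _; rewrite -EFinD abse_EFin lee_fin normrM.
    rewrite -(real_normK (num_real (u x))) -(real_normK (num_real (v x))).
    have := sqr_ge0 (`|u x| - `|v x|); rewrite sqrrB.
    have := mulr_ge0 (normr_ge0 (u x)) (normr_ge0 (v x)); lra.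
rewrite ge0_integralD//; first by rewrite lte_add_pinfty.
- by move=> x _; rewrite lee_fin sqr_ge0.
- exact: msq.
- by move=> x _; rewrite lee_fin sqr_ge0.
- exact: msq.
Qed.

Lemma Rintegral_sum (I : Type) (s : seq I) (f : I -> T -> R) :
  (forall i, mu.-integrable setT (EFin \o f i)) ->
  \int[mu]_x (\sum_(i <- s) f i x) = \sum_(i <- s) \int[mu]_x f i x.
Proof.
move=> fi; rewrite /Rintegral.
under eq_integral do rewrite -sumEFin.
rewrite integral_sum// sum_fine// => i _.
exact: integrable_fin_num (fi i).
Qed.

(** The square of u minus its projection has nonnegative integral; expanding it uses the L^2
    products, and for u outside L^2 the right-hand side is infinite. *)
Lemma Bessel (I : eqType) (A : seq I) (phi : I -> T -> R) u : uniq A ->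
  (forall a, square_integrable (phi a)) ->
  (forall a b, \int[mu]_x (phi a x * phi b x) = (a == b)%:R) ->
  measurable_fun setT u ->
  ((\sum_(a <- A) (\int[mu]_x (u x * phi a x)) ^+ 2)%:E <=
   \int[mu]_x (u x ^+ 2)%:E)%E.
Proof.
move=> uA L2phi orth mu'.
have [u2|] := ltP (\int[mu]_x (u x ^+ 2)%:E)%E +oo%E; last first.
  by rewrite leye_eq => /eqP ->; rewrite leey.
have L2u : square_integrable u by [].
pose c a := \int[mu]_x (u x * phi a x).
have iup a : mu.-integrable setT (EFin \o (fun x => u x * phi a x)).
  exact: square_integrableM.
have ipp a b : mu.-integrable setT (EFin \o (fun x => phi a x * phi b x)).
  exact: square_integrableM.
have iuu : mu.-integrable setT (EFin \o (fun x => u x * u x)).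
  exact: square_integrableM.
have iZ (k : R) (w : T -> R) : mu.-integrable setT (EFin \o w) ->
    mu.-integrable setT (EFin \o (fun x => k * w x)).
  move=> iw; rewrite (_ : _ \o _ = fun x => (k%:E * (EFin \o w) x)%E)//.
  exact: integrableZl.
have iS (w : I -> T -> R) : (forall a, mu.-integrable setT (EFin \o w a)) ->
    mu.-integrable setT (EFin \o (fun x => \sum_(a <- A) w a x)).
  move=> iw; rewrite (_ : _ \o _ = fun x => \sum_(a <- A) (EFin \o w a) x)%E.
    exact: integrable_sum.
  by apply/funext => x; rewrite /= sumEFin.
have e1 : \int[mu]_x (\sum_(a <- A) c a * (u x * phi a x)) = \sum_(a <- A) c a ^+ 2.
  rewrite Rintegral_sum; last by move=> a; exact/iZ.
  by apply: eq_bigr => a _; rewrite RintegralZl// expr2.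
have e2 : \int[mu]_x (\sum_(a <- A) \sum_(b <- A) c a * c b * (phi a x * phi b x)) =
    \sum_(a <- A) c a ^+ 2.
  rewrite Rintegral_sum; last first.
    by move=> a; apply: iS => b; exact/iZ.
  rewrite big_seq [RHS]big_seq; apply: eq_bigr => a aA.
  rewrite Rintegral_sum; last by move=> b; exact/iZ.
  rewrite (bigD1_seq a)//= big1 ?addr0.
    by rewrite RintegralZl// orth eqxx mulr1 expr2.
  by move=> b ba; rewrite RintegralZl// orth eq_sym (negbTE ba) mulr0.
have e3 : 0 <= \int[mu]_x ((u x - \sum_(a <- A) c a * phi a x) ^+ 2).
  by apply: Rintegral_ge0 => x _; rewrite sqr_ge0.
have e4 x : (u x - \sum_(a <- A) c a * phi a x) ^+ 2 =
    u x * u x - 2 * (\sum_(a <- A) c a * (u x * phi a x)) +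
    \sum_(a <- A) \sum_(b <- A) c a * c b * (phi a x * phi b x).
  have -> : \sum_(a <- A) c a * (u x * phi a x) = u x * \sum_(a <- A) c a * phi a x.
    by rewrite mulr_sumr; apply: eq_bigr => a _; rewrite mulrCA.
  have -> : \sum_(a <- A) \sum_(b <- A) c a * c b * (phi a x * phi b x) =
      (\sum_(a <- A) c a * phi a x) * (\sum_(a <- A) c a * phi a x).
    rewrite mulr_suml; apply: eq_bigr => a _; rewrite mulr_sumr.
    by apply: eq_bigr => b _; rewrite mulrACA.
  ring.
move: e3; under eq_Rintegral do rewrite e4.
rewrite RintegralD//; last 2 first.
- rewrite (_ : _ \o _ = fun x => ((u x * u x)%:E -
    (2 * (\sum_(a <- A) c a * (u x * phi a x)))%R%:E)%E)//.
  apply: integrableB => //; apply: (iZ); apply: (iS) => a; exact/iZ.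
- by apply: (iS) => a; apply: (iS) => b; exact/iZ.
rewrite RintegralB//; last by apply: (iZ); apply: (iS) => a; exact/iZ.
rewrite RintegralZl//; last by apply: (iS) => a; exact/iZ.
rewrite e1 e2 => e3.
have -> : (\int[mu]_x (u x ^+ 2)%:E = (\int[mu]_x (u x * u x))%:E)%E.
  by rewrite /Rintegral fineK//; exact: integrable_fin_num iuu.
rewrite lee_fin -subr_ge0; move: e3; rewrite /c; lra.
Qed.

End Bessel.

Section Tensor.
Context d1 d2 (S : measurableType d1) (L : measurableType d2) (R : realType).
Variables (m1 : {sigma_finite_measure set S -> \bar R}).
Variables (m2 : {sigma_finite_measure set L -> \bar R}).

Lemma integrable_tensor (u : S -> R) (v : L -> R) :
  m1.-integrable setT (EFin \o u) -> m2.-integrable setT (EFin \o v) ->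
  (sfprod m1 m2).-integrable setT (fun z => (u z.1 * v z.2)%:E).
Proof.
move=> /integrableP[/measurable_EFinP mu iu] /integrableP[/measurable_EFinP mv iv].
apply/integrable12ltyP.
  by apply/measurable_EFinP; apply: measurable_funM; exact: measurableT_comp.
under eq_integral => x _.
  under eq_integral do rewrite /= normrM EFinM.
  rewrite ge0_integralZl//; last by apply/measurable_EFinP; exact: measurableT_comp.
  over.
rewrite ge0_integralZr//.
- by rewrite lte_mul_pinfty// ?integral_ge0// ge0_fin_numE// integral_ge0.
- by apply/measurable_EFinP; exact: measurableT_comp.
- exact: integral_ge0.
Qed.

Lemma Rintegral_tensor (u : S -> R) (v : L -> R) :
  m1.-integrable setT (EFin \o u) -> m2.-integrable setT (EFin \o v) ->
  \int[sfprod m1 m2]_z (u z.1 * v z.2) = (\int[m1]_x u x) * (\int[m2]_y v y).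
Proof.
move=> iu iv; have iuv := integrable_tensor iu iv.
have fu := integrable_fin_num measurableT iu.
have fv := integrable_fin_num measurableT iv.
rewrite /Rintegral -(integral12_prod_meas1 iuv) -fineM//; congr fine.
transitivity (\int[m1]_x ((u x)%:E * \int[m2]_y (v y)%:E))%E.
  apply: eq_integral => x _; rewrite /fubini_F/=.
  by under eq_integral do rewrite EFinM; rewrite integralZl.
rewrite -(fineK fv) -[in LHS](fineK fv).
by rewrite integralZr// fineK.
Qed.

End Tensor.

Section AffineSubstitution.
Context {R : realType}.
Local Notation mu := (@lebesgue_measure R).

Lemma integral_affine (G : R -> R) (a c : R) : 0 < a -> continuous G ->
  (forall x, 0 <= G x) ->
  (\int[mu]_x (a * G (a * x + c))%:E = \int[mu]_x (G x)%:E)%E.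
Proof.
move=> a0 cG G0; pose F x := a * x + c : R.
have dF (x : R) : is_derive x (1 : R) F ((fun _ => a) x).
  rewrite /F (_ : (fun x => _) = horner (a%:P * 'X + c%:P)).
    by apply: is_derive_eq; rewrite derivD derivM derivX !derivC !hornerE; ring.
  by apply/funext => y; rewrite !hornerE.
have F' : F^`()%classic = fun=> a := is_derive1_fun dF.
rewrite (@increasing_ge0_integration_by_substitutionT _ F G).
- by apply: eq_integral => x _; rewrite /= F' mulrC.
- by move=> x y xy; rewrite /F ltrD2r ltr_pM2l.
- by rewrite F'; exact: cst_continuous.
- by rewrite F'; exact: is_cvg_cst.
- by rewrite F'; exact: is_cvg_cst.
- by move=> x; exact: is_derive1_derivable (dF x).
- apply/cvgrNyPle => M; apply: filterS (nbhs_ninfty_le (num_real ((M - c) / a))) => x.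
  by rewrite ler_pdivlMr// lerBrDr mulrC.
- apply/cvgryPge => M; apply: filterS (nbhs_pinfty_ge (num_real ((M - c) / a))) => x.
  by rewrite ler_pdivrMr// lerBlDr mulrC.
- exact: cG.
- exact: G0.
Qed.

Lemma integral_inv_oneDsqr_subr (y : R) :
  (\int[mu]_x ((1 + (y - x) ^+ 2)^-1)%:E = (pi : R)%:E)%E.
Proof.
rewrite -integral_inv_oneDsqr -(@integral_affine (fun x => (1 + x ^+ 2)^-1) 1 (- y))//.
- by apply: eq_integral => x _; rewrite !mul1r -sqrrN opprB.
- exact: continuous_inv_oneDsqr.
- by move=> x; rewrite invr_ge0 ltW// oneDsqr_gt0.
Qed.

End AffineSubstitution.

(** * Local Plancherel inequality *)

Section HannWindow.
Context {R : realType}.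
Local Notation mu := (@lebesgue_measure R).
Variable b : R.
Hypothesis b0 : 0 < b.
Let L := 2 * b.
Let a := pi / L.
Let L0 : 0 < L. Proof. by rewrite mulr_gt0. Qed.

(** The Hann window (raised cosine) on [-2b, 2b]: at least 1 on [-b, b], and vanishing with its
    derivative at the end points, whence a Fourier transform of order w^(-2). *)
Definition hann (l : R) := 1 + cos (pi / (2 * b) * l).

Lemma hann_ge0 l : 0 <= hann l.
Proof. by rewrite /hann -lerBlDl sub0r cos_geN1. Qed.

Lemma hann_le2 l : hann l <= 2.
Proof. by rewrite /hann -[2]/(1 + 1) lerD2l cos_le1. Qed.

Lemma hann_ge1 l : `|l| <= b -> 1 <= hann l.
Proof.
move=> lb; rewrite /hann lerDl cos_ge0_pihalf// -ler_norml normrM ger0_norm.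
  rewrite mulrAC ler_pdivrMr// /L mulrA divfK// ler_pM2l ?pi_gt0//.
by rewrite divr_ge0// ?pi_ge0// ltW.
Qed.

Lemma continuous_cosM (c : R) : continuous (fun l : R => cos (c * l)).
Proof.
move=> x; apply: (@continuous_comp _ _ _ (fun l => c * l) cos).
  by apply: mulrl_continuous.
exact: continuous_cos.
Qed.

Lemma continuous_sinM (c : R) : continuous (fun l : R => sin (c * l)).
Proof.
move=> x; apply: (@continuous_comp _ _ _ (fun l => c * l) sin).
  by apply: mulrl_continuous.
exact: continuous_sin.
Qed.

Lemma continuous_hann : continuous hann.
Proof. by move=> x; apply: cvgD; [exact: cvg_cst|exact: continuous_cosM]. Qed.

(** The window is even, so this cosine integral is its whole Fourier transform. *)
Definition hann_kernel (w : R) := \int[mu]_(l in `[- (2 * b), 2 * b]) (hann l * cos (w * l)).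

Let lenL : mu `[- L, L] = (2 * L)%:E.
Proof.
rewrite lebesgue_measure_itv/= lte_fin; rewrite ifT; last by have := L0; lra.
by rewrite opprK -EFinD; congr EFin; ring.
Qed.

Lemma Rintegral_segment_bound (f : R -> R) (M : R) : continuous f ->
  (forall x, `|f x| <= M) -> `|\int[mu]_(l in `[- (2 * b), 2 * b]) f l| <= M * (4 * b).
Proof.
move=> cf fM; have M0 : 0 <= M by exact: le_trans (fM 0).
have intf : mu.-integrable `[- L, L] (EFin \o f).
  apply: continuous_compact_integrable; first exact: segment_compact.
  exact: continuous_subspaceT.
apply: (le_trans (le_normr_Rintegral _ intf)) => //.
apply: (@le_trans _ _ (\int[mu]_(l in `[- L, L]) M)).
  apply: le_Rintegral => //.
    rewrite (_ : EFin \o _ = abse \o (EFin \o f))//; exact: integrable_abse.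
  apply: continuous_compact_integrable; first exact: segment_compact.
  by apply: continuous_subspaceT; exact: cst_continuous.
rewrite Rintegral_cst// [X in M * X](_ : _ = 2 * L) /L; last exact: (congr1 fine lenL).
lra.
Qed.

Lemma hann_kernel_bound w : `|hann_kernel w| <= 8 * b.
Proof.
rewrite (_ : 8 * b = 2 * (4 * b)); last by ring.
apply: Rintegral_segment_bound.
  by move=> x; apply: cvgM; [exact: continuous_hann|exact: continuous_cosM].
move=> x; rewrite normrM ger0_norm ?hann_ge0// -[leRHS]mulr1 ler_pM ?hann_ge0 ?hann_le2//.
by rewrite ler_norml cos_geN1 cos_le1.
Qed.

(* Two integrations by parts; the boundary terms vanish since the window and
   its derivative vanish at the end points. *)
Lemma hann_kernel_decay w : w ^+ 2 * `|hann_kernel w| <= pi ^+ 2 / b.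
Proof.
(* [Psi] gathers the boundary terms of both integrations by parts and is a primitive of [psi]; it
   vanishes at both end points because a L = pi. *)
pose Psi l := w * sin (w * l) * (1 + cos (a * l)) - a * cos (w * l) * sin (a * l).
pose psi l := w ^+ 2 * (hann l * cos (w * l)) - a ^+ 2 * (cos (w * l) * cos (a * l)).
have dm (c l : R) : is_derive l (1 : R) (fun l => c * l) c.
  rewrite (_ : (fun l => _) = horner (c%:P * 'X)).
    by apply: is_derive_eq; rewrite derivM derivX derivC !hornerE; ring.
  by apply/funext => y; rewrite !hornerE.
have dcos (c l : R) : is_derive l (1 : R) (fun l => cos (c * l)) (- c * sin (c * l)).
  have := is_derive1_comp (is_derive_cos (c * l)) (dm c l).
  by rewrite /comp => d; apply: is_derive_eq; ring.
have dsin (c l : R) : is_derive l (1 : R) (fun l => sin (c * l)) (c * cos (c * l)).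
  have := is_derive1_comp (is_derive_sin (c * l)) (dm c l).
  by rewrite /comp => d; apply: is_derive_eq; ring.
have dPsi l : is_derive l (1 : R) Psi (psi l).
  have d1 := is_deriveM (is_deriveZ w (dsin w l))
    (is_deriveD (is_derive_cst (1 : R) l (1 : R)) (dcos a l)).
  have d2 := is_deriveM (is_deriveZ a (dcos w l)) (dsin a l).
  have := is_deriveB d1 d2; rewrite (_ : _ - _ = Psi)// => d.
  apply: is_derive_eq; rewrite /psi /hann -/L -/a.
  change (w * sin (w * l) * (0 + - a * sin (a * l)) +
    (1 + cos (a * l)) * (w * (w * cos (w * l))) -
    (a * cos (w * l) * (a * cos (a * l)) + sin (a * l) * (a * (- w * sin (w * l)))) =
    w ^+ 2 * ((1 + cos (a * l)) * cos (w * l)) - a ^+ 2 * (cos (w * l) * cos (a * l))).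
  ring.
have cpsi : continuous psi.
  move=> x; apply: cvgB; apply: cvgM; (try exact: cvg_cst).
    by apply: cvgM; [exact: continuous_hann|exact: continuous_cosM].
  by apply: cvgM; exact: continuous_cosM.
have aL : a * L = pi by rewrite /a divfK// gt_eqF.
have I0 : \int[mu]_(l in `[- L, L]) psi l = 0.
  rewrite /Rintegral (FTC_segment dPsi cpsi); last by have := L0; lra.
  rewrite /Psi/= !mulrN aL !cosN !sinN cospi sinpi; ring.
have intc (f : R -> R) : continuous f -> mu.-integrable `[- L, L] (EFin \o f).
  move=> cf; apply: continuous_compact_integrable; first exact: segment_compact.
  exact: continuous_subspaceT.
have c1 : continuous (fun l => hann l * cos (w * l)).
  by move=> x; apply: cvgM; [exact: continuous_hann|exact: continuous_cosM].
have c2 : continuous (fun l => cos (w * l) * cos (a * l)).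
  by move=> x; apply: cvgM; exact: continuous_cosM.
have : w ^+ 2 * hann_kernel w = a ^+ 2 * \int[mu]_(l in `[- L, L]) (cos (w * l) * cos (a * l)).
  apply/eqP; rewrite -subr_eq0 -I0 /psi RintegralB//; last 2 first.
  - by apply: (intc) => x; apply: cvgM; [exact: cvg_cst|exact: c1].
  - by apply: (intc) => x; apply: cvgM; [exact: cvg_cst|exact: c2].
  by rewrite !RintegralZl//; exact: intc.
move=> /(congr1 Num.norm); rewrite (normrM (w ^+ 2)) (normrM (a ^+ 2)).
rewrite (ger0_norm (sqr_ge0 w)) (ger0_norm (sqr_ge0 a)) => ->.
apply: (@le_trans _ _ (a ^+ 2 * (1 * (4 * b)))).
  rewrite ler_wpM2l ?sqr_ge0//; apply: Rintegral_segment_bound => // x.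
  by rewrite normrM mulr_ile1// ler_norml cos_geN1 cos_le1.
rewrite le_eqVlt; apply/orP; left; apply/eqP; rewrite /a /L; field.
by rewrite gt_eqF.
Qed.

End HannWindow.

Section Window.
Context {R : realType}.
Implicit Types c l : R.

Definition window c : set R := `[- c, c].

Lemma mem_window c l : (l \in window c) = (`|l| <= c).
Proof. by rewrite ler_norml; apply/idP/idP; rewrite inE /window/= in_itv. Qed.

Lemma measurable_window c : measurable (window c).
Proof. exact: measurable_itv. Qed.

Lemma measurable_fun_window c : measurable_fun setT (\1_(window c) : R -> R).
Proof. by apply: measurable_indic; exact: measurable_window. Qed.

Lemma lebesgue_window c : 0 <= c -> (@lebesgue_measure R) (window c) = (2 * c)%:E.
Proof.
move=> c0; rewrite lebesgue_measure_itv/= lte_fin.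
case: ltP => c1; first by rewrite opprK -EFinD; congr EFin; ring.
by congr EFin; lra.
Qed.

Lemma integral_window c : 0 <= c ->
  (\int[@lebesgue_measure R]_l (\1_(window c) l)%:E = (2 * c)%:E)%E.
Proof.
move=> c0; rewrite integral_indic//; last exact: measurable_window.
by rewrite setIT; exact: lebesgue_window.
Qed.

End Window.

Section LocalPlancherel.
Context {R : realType}.
Local Notation mu := (@lebesgue_measure R).
Variables (N B : R).
Hypotheses (N0 : 0 < N) (B0 : 0 < B).
Let b := B / N.
Let b0 : 0 < b. Proof. by rewrite divr_gt0. Qed.
Let D : set R := window (2 * b).

(** The bracket is the sum of the two kernel bounds at b = B / N with the powers of N removed; [pi]
    is the integral of 1 / (1 + u^2). *)
Definition plancherel_const : R := pi * (8 * B + pi ^+ 2 / B).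

(** The uniform bound and the w^(-2) bound added at w = N u. Since b N = B, the width of the kernel
    in u does not depend on N, and only the factor 1/N remains. *)
Let hann_kernel_le u :
  `|hann_kernel b (N * u)| <= (8 * B + pi ^+ 2 / B) / N / (1 + u ^+ 2).
Proof.
rewrite ler_pdivlMr ?oneDsqr_gt0// mulrDr mulr1 [X in _ <= X]mulrDl lerD//.
  by rewrite (le_trans (hann_kernel_bound b0 _))// /b mulrA.
have := hann_kernel_decay b0 (N * u); rewrite exprMn => h.
rewrite mulrC -(@ler_pM2l _ (N ^+ 2)) ?exprn_gt0// mulrA (le_trans h)//.
rewrite le_eqVlt; apply/orP; left; apply/eqP; rewrite /b; field.
by rewrite !gt_eqF.
Qed.

(* T T* argument: majorize the indicator of [-b, b] by the Hann window, whose
   Fourier transform is integrable, and apply Schur's test to the kernel. *)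
Lemma local_Plancherel (h : R -> R) : mu.-integrable setT (EFin \o h) ->
  (\int[mu]_l (\1_(window (B / N)) l *
     ((\int[mu]_s (h s * cos (N * l * s))) ^+ 2 +
      (\int[mu]_s (h s * sin (N * l * s))) ^+ 2))%R%:E <=
   (plancherel_const / N)%:E * \int[mu]_s (h s ^+ 2)%:E)%E.
Proof.
move=> ih; have mh : measurable_fun setT h by apply/measurable_EFinP; exact: measurable_int ih.
have bnd (e : R -> R) : continuous e -> (forall x, `|e x| <= 1) ->
    mu.-integrable setT (EFin \o (fun s => h s * e s)).
  move=> ce e1; apply: le_integrable ih => //.
    by apply/measurable_EFinP; apply: measurable_funM => //; exact: continuous_measurable_fun.
  by move=> s _ /=; rewrite lee_fin normrM ler_piMr.
have cos1 x : `|cos x : R| <= 1 by rewrite ler_norml cos_geN1 cos_le1.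
have sin1 x : `|sin x : R| <= 1 by rewrite ler_norml sin_geN1 sin_le1.
pose mm : {sigma_finite_measure set _ -> \bar R} := sfprod mu mu.
(* The squared modulus of the Fourier integral, written as a double integral with the cosine of the
   difference of the two variables. *)
pose T2 l := \int[mm]_z (h z.1 * h z.2 * cos (N * l * (z.1 - z.2))).
have T2E l : (\int[mu]_s (h s * cos (N * l * s))) ^+ 2 +
      (\int[mu]_s (h s * sin (N * l * s))) ^+ 2 = T2 l.
  have ic := bnd _ (@continuous_cosM R (N * l)) (fun x => cos1 _).
  have is_ := bnd _ (@continuous_sinM R (N * l)) (fun x => sin1 _).
  rewrite !expr2 -(Rintegral_tensor ic ic) -(Rintegral_tensor is_ is_).
  rewrite -RintegralD//; [|exact: (integrable_tensor ic ic)|exact: (integrable_tensor is_ is_)].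
  by apply: eq_Rintegral => z _; rewrite mulrBr cosB; ring.
pose W (w : (R * R) * R) := \1_D w.2 * hann b w.2 *
  (h w.1.1 * h w.1.2 * cos (N * w.2 * (w.1.1 - w.1.2))).
have mD : measurable D by exact: measurable_window.
have mW : measurable_fun setT W.
  apply: measurable_funM.
    apply: measurable_funM.
      exact: (measurableT_comp (measurable_indic mD)).
    apply: (measurableT_comp (continuous_measurable_fun (@continuous_hann _ b))) => //.
  apply: measurable_funM.
    apply: measurable_funM.
      exact: (measurableT_comp mh (measurableT_comp measurable_fst measurable_fst)).
    exact: (measurableT_comp mh (measurableT_comp measurable_snd measurable_fst)).
  apply: (measurableT_comp (continuous_measurable_fun (@continuous_cos R))).
  apply: measurable_funM.
    exact: measurable_funM.
  apply: measurable_funB.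
    exact: (measurableT_comp measurable_fst measurable_fst).
  exact: (measurableT_comp measurable_snd measurable_fst).
(* Absolute convergence of the triple integral, needed to integrate in l first; it rests on h being
   in L^1 and on the window having length 4b. *)
have iW : (sfprod mm mu).-integrable setT (EFin \o W).
  apply/integrable12ltyP; first exact/measurable_EFinP.
  apply: (@le_lt_trans _ _ (\int[mm]_z (`|h z.1| * `|h z.2| * (8 * b))%:E)%E).
    apply: ge0_le_integral => //.
    - by move=> z _; exact: integral_ge0.
    - apply: (@measurable_fun_fubini_tonelli_F _ _ _ _ _ mu (abse \o (EFin \o W))) => //.
        by apply: measurableT_comp => //; exact/measurable_EFinP.
      by move=> w; exact: abse_ge0.
    - apply/measurable_EFinP; apply: measurable_funM => //; apply: measurable_funM => //.
        by apply: measurableT_comp => //; apply: measurableT_comp.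
      by apply: measurableT_comp => //; apply: measurableT_comp.
    move=> z _; apply: (@le_trans _ _ (\int[mu]_l ((`|h z.1| * `|h z.2| * 2)%:E * (\1_D l)%:E))%E).
      apply: ge0_le_integral => //.
      - apply: measurableT_comp => //; apply/measurable_EFinP.
        exact: (measurableT_comp mW (pair1_measurable z)).
      - by apply: measurable_funeM; apply/measurable_EFinP; exact: measurable_indic.
      move=> l _; rewrite -EFinM lee_fin /W !normrM /= (ger0_norm (hann_ge0 _ _)).
      rewrite ger0_norm// [leRHS]mulrC -!mulrA ler_wpM2l// mulrC -!mulrA.
      rewrite ler_wpM2l// ler_wpM2l// mulrC -[leRHS]mulr1 ler_pM ?hann_ge0 ?hann_le2//.
    rewrite ge0_integralZl//; last by apply/measurable_EFinP; exact: measurable_indic.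
    rewrite [X in (_ * X)%E](_ : _ = (4 * b)%:E); last first.
      rewrite (_ : 4 * b = 2 * (2 * b)); last by ring.
      by rewrite integral_window// mulr_ge0// ltW.
    rewrite -EFinM lee_fin; lra.
  rewrite [X in (X < _)%E](_ : _ = ((8 * b)%:E * (\int[mu]_s `|h s|%:E * \int[mu]_s `|h s|%:E))%E).
    have /integrableP[_ hoo] := ih.
    have fI : (\int[mu]_s `|h s|%:E)%E \is a fin_num by rewrite ge0_fin_numE// integral_ge0.
    by rewrite -(fineK fI) -!EFinM ltry.
  rewrite -integral_sqr_tensor//; last by apply/measurable_EFinP; exact: measurableT_comp.
  rewrite -ge0_integralZl//.
  - by apply: eq_integral => z _; rewrite -!EFinM mulrC.
  - apply: emeasurable_funM; apply/measurable_EFinP; apply: measurableT_comp => //; exact: measurableT_comp.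
  - by rewrite lee_fin mulr_ge0// ltW.
have T2_ge0 l : 0 <= T2 l by rewrite -T2E addr_ge0// sqr_ge0.
have iWl l : mm.-integrable setT (EFin \o (fun z => h z.1 * h z.2 * cos (N * l * (z.1 - z.2)))).
  apply: le_integrable (integrable_tensor ih ih) => //.
    apply/measurable_EFinP; apply: measurable_funM.
      by apply: measurable_funM; exact: measurableT_comp.
    apply: (measurableT_comp (continuous_measurable_fun (@continuous_cos R))).
    by apply: measurable_funM => //; apply: measurable_funB.
  by move=> z _ /=; rewrite lee_fin normrM ler_piMr.
(* The Hann window dominates the indicator, and [T2] is nonnegative as a sum of two squares. *)
have step1 : (\int[mu]_l (\1_(window (B / N)) l *
     ((\int[mu]_s (h s * cos (N * l * s))) ^+ 2 +
      (\int[mu]_s (h s * sin (N * l * s))) ^+ 2))%R%:E <=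
      \int[mu]_l \int[mm]_z (W (z, l))%:E)%E.
  have -> : (\int[mu]_l \int[mm]_z (W (z, l))%:E = \int[mu]_l (\1_D l * hann b l * T2 l)%:E)%E.
    apply: eq_integral => l _; rewrite /W/= EFinM /T2 /Rintegral fineK.
      rewrite -integralZl//; exact: iWl.
    exact: integrable_fin_num (iWl l).
  have mT2 : measurable_fun setT T2.
    apply: (@measurable_param_Rintegral _ _ _ _ _ mm (fun w => h w.1.1 * h w.1.2 * cos (N * w.2 * (w.1.1 - w.1.2)))).
    apply: measurable_funM.
      apply: measurable_funM.
        exact: (measurableT_comp mh (measurableT_comp measurable_fst measurable_fst)).
      exact: (measurableT_comp mh (measurableT_comp measurable_snd measurable_fst)).
    apply: (measurableT_comp (continuous_measurable_fun (@continuous_cos R))).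
    apply: measurable_funM.
      exact: measurable_funM.
    apply: measurable_funB.
      exact: (measurableT_comp measurable_fst measurable_fst).
    exact: (measurableT_comp measurable_snd measurable_fst).
  under eq_integral do rewrite T2E.
  apply: ge0_le_integral => //.
  - by move=> l _; rewrite lee_fin mulr_ge0.
  - by apply/measurable_EFinP; apply: measurable_funM => //; exact: measurable_fun_window.
  - apply/measurable_EFinP; apply: measurable_funM => //.
    apply: measurable_funM; first exact: measurable_indic.
    exact: continuous_measurable_fun (@continuous_hann _ b).
  - move=> l _; rewrite lee_fin ler_wpM2r// !indicE.
    have [lb|_] := boolP (l \in window (B / N)); last by rewrite mulr_ge0// hann_ge0.
    move: lb; rewrite mem_window => lb; rewrite mem_window (le_trans lb); last first.
      by rewrite -/b; have := b0; lra.
    by rewrite mul1r hann_ge1.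
have e z : (\int[mu]_l (W (z, l))%:E =
    (h z.1 * h z.2 * hann_kernel b (N * (z.1 - z.2)))%:E)%E.
  have c1 : continuous (fun l => hann b l * cos (N * (z.1 - z.2) * l)).
    by move=> x; apply: cvgM; [exact: continuous_hann|exact: continuous_cosM].
  have i1 : mu.-integrable D (EFin \o (fun l => hann b l * cos (N * (z.1 - z.2) * l))).
    apply: continuous_compact_integrable; first exact: segment_compact.
    exact: continuous_subspaceT.
  transitivity (\int[mu]_(l in D) ((h z.1 * h z.2)%:E * (hann b l * cos (N * (z.1 - z.2) * l))%:E))%E.
    rewrite [RHS]integral_mkcond; apply: eq_integral => l _.
    rewrite patchE /W/= indicE; case: ifPn => lD'.
      rewrite -EFinM; congr EFin; rewrite mul1r.
      by rewrite (_ : N * (z.1 - z.2) * l = N * l * (z.1 - z.2)); ring.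
    by rewrite !mul0r.
  rewrite integralZl// [RHS]EFinM; congr (_ * _)%E.
  by rewrite /hann_kernel /Rintegral fineK//; exact: integrable_fin_num i1.
apply: (le_trans step1).
rewrite -(@Fubini _ _ _ _ _ mm mu _ iW).
pose C0 := 8 * B + pi ^+ 2 / B.
have C00 : 0 <= C0.
  by apply: addr_ge0; [rewrite mulr_ge0// ltW|rewrite divr_ge0 ?sqr_ge0// ltW].
pose K u := C0 / N / (1 + u ^+ 2).
have K0 u : 0 <= K u by rewrite !divr_ge0// ltW// oneDsqr_gt0.
have mK : measurable_fun setT K.
  by apply: measurable_funM => //; exact: measurable_inv_oneDsqr.
have intK s : (\int[mu]_x (K (s - x))%:E = (C0 / N * pi)%:E)%E.
  rewrite /K; under eq_integral do rewrite EFinM.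
  rewrite ge0_integralZl//.
  - by rewrite integral_inv_oneDsqr_subr -EFinM.
  - apply/measurable_EFinP; apply: (measurableT_comp measurable_inv_oneDsqr).
    exact: measurable_funB.
  - by move=> x _; rewrite lee_fin invr_ge0 ltW// oneDsqr_gt0.
  - by rewrite lee_fin divr_ge0// ltW.
have intK' s : (\int[mu]_x (K (x - s))%:E = (C0 / N * pi)%:E)%E.
  by rewrite -(intK s); apply: eq_integral => x _; rewrite /K -sqrrN opprB.
(* Schur's test: |h(s) h(s')| is at most the half sum of the squares, and each of [G1] and [G2] is
   integrated first in the variable in which K has constant mass. *)
pose G1 (z : R * R) := h z.1 ^+ 2 * K (z.1 - z.2).
pose G2 (z : R * R) := h z.2 ^+ 2 * K (z.1 - z.2).
have mK2 : measurable_fun setT (fun z : R * R => K (z.1 - z.2)).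
  by apply: (measurableT_comp mK); apply: measurable_funB.
have mG1 : measurable_fun setT (EFin \o G1).
  apply/measurable_EFinP; apply: measurable_funM => //.
  by apply: measurable_funX; apply: measurableT_comp.
have mG2 : measurable_fun setT (EFin \o G2).
  apply/measurable_EFinP; apply: measurable_funM => //.
  by apply: measurable_funX; apply: measurableT_comp.
have G10 z : (0 <= (EFin \o G1) z)%E by rewrite lee_fin mulr_ge0// sqr_ge0.
have G20 z : (0 <= (EFin \o G2) z)%E by rewrite lee_fin mulr_ge0// sqr_ge0.
have mh2 : measurable_fun setT (fun s => (h s ^+ 2)%:E).
  by apply/measurable_EFinP; exact: measurable_funX.
have h20 s : (0 <= (h s ^+ 2)%:E)%E by rewrite lee_fin sqr_ge0.
have I1 : (\int[mm]_z (G1 z)%:E = (C0 / N * pi)%:E * \int[mu]_s (h s ^+ 2)%:E)%E.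
  transitivity (\int[mu]_x fubini_F mu (EFin \o G1) x)%E.
    exact: (@fubini_tonelli1 _ _ _ _ _ mu mu (EFin \o G1) mG1 G10).
  rewrite muleC -ge0_integralZr//; last first.
    by rewrite lee_fin mulr_ge0 ?pi_ge0// divr_ge0// ltW.
  apply: eq_integral => s _; rewrite /fubini_F/= /G1.
  under eq_integral do rewrite EFinM /=.
  rewrite ge0_integralZl//; first by rewrite intK.
    by apply/measurable_EFinP; apply: (measurableT_comp mK); exact: measurable_funB.
  by move=> x _; rewrite lee_fin.
have I2 : (\int[mm]_z (G2 z)%:E = (C0 / N * pi)%:E * \int[mu]_s (h s ^+ 2)%:E)%E.
  transitivity (\int[mu]_x fubini_G mu (EFin \o G2) x)%E.
    exact: (@fubini_tonelli2 _ _ _ _ _ mu mu (EFin \o G2) mG2 G20).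
  rewrite muleC -ge0_integralZr//; last first.
    by rewrite lee_fin mulr_ge0 ?pi_ge0// divr_ge0// ltW.
  apply: eq_integral => s _; rewrite /fubini_G/= /G2.
  under eq_integral do rewrite EFinM /=.
  rewrite ge0_integralZl//.
  - by rewrite intK'.
  - by apply/measurable_EFinP; apply: (measurableT_comp mK); exact: measurable_funB.
  - by move=> x _; rewrite lee_fin.
have mE : measurable_fun setT (fun z : R * R => (h z.1 * h z.2 * hann_kernel b (N * (z.1 - z.2)))%:E).
  rewrite [X in measurable_fun _ X](_ : _ = fubini_F mu (EFin \o W)).
    exact: measurable_fubini_F iW.
  by apply/funext => z; rewrite -e.
under eq_integral do rewrite e.
apply: (le_trans (lee_abs _)); apply: (le_trans (le_abse_integral _ _ _)) => //.
apply: (@le_trans _ _ (\int[mm]_z (2^-1%:E * (G1 z)%:E + 2^-1%:E * (G2 z)%:E))%E).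
  apply: ge0_le_integral => //.
  - exact: measurableT_comp.
  - by apply: emeasurable_funD; exact: measurable_funeM.
  move=> z _; rewrite /= -!EFinM -EFinD lee_fin normrM /G1 /G2.
  apply: (@le_trans _ _ (`|h z.1 * h z.2| * K (z.1 - z.2))).
    by rewrite ler_wpM2l// hann_kernel_le.
  rewrite [leRHS](_ : _ = 2^-1 * (h z.1 ^+ 2 + h z.2 ^+ 2) * K (z.1 - z.2)); last by ring.
  rewrite ler_wpM2r ?K0// normrM.
  rewrite -(real_normK (num_real (h z.1))) -(real_normK (num_real (h z.2))).
  have := sqr_ge0 (`|h z.1| - `|h z.2|); rewrite sqrrB; lra.
rewrite ge0_integralD//; last 4 first.
- by move=> z _; apply: mule_ge0; [rewrite lee_fin invr_ge0|exact: G10].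
- exact: measurable_funeM.
- by move=> z _; apply: mule_ge0; [rewrite lee_fin invr_ge0|exact: G20].
- exact: measurable_funeM.
have IZ (G : R * R -> R) : measurable_fun setT (EFin \o G) ->
    (forall z, 0 <= (EFin \o G) z)%E ->
    (\int[mm]_z (2^-1%:E * (G z)%:E) = 2^-1%:E * \int[mm]_z (G z)%:E)%E.
  move=> mG G0; rewrite (@ge0_integralZl_EFin _ _ _ mm setT measurableT (EFin \o G))//.
rewrite (IZ _ mG1 G10) (IZ _ mG2 G20) I1 I2 -ge0_muleDl ?lee_fin ?invr_ge0// -EFinD.
rewrite [X in (X%:E * _)%E](_ : _ = 1); last by field.
rewrite mul1e le_eqVlt; apply/orP; left; apply/eqP; congr (_%:E * _)%E.
by rewrite /plancherel_const -/C0; ring.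
Qed.

End LocalPlancherel.

(** * Hermite functions of several variables *)

Section HermiteTupleSum.
Context {R : realType}.
Local Notation h := (@hermite_fun R).

Definition tbehead T n (x : n.+1.-tuple T) : n.-tuple T := [tuple of behead x].

Lemma hermite_tupleS n (a : n.+1.-tuple nat) (x : n.+1.-tuple R) :
  hermite_tuple a x = h (thead a) (thead x) * hermite_tuple (tbehead a) (tbehead x).
Proof.
rewrite /hermite_tuple big_ord_recl; congr (_ * _).
by apply: eq_bigr => j _; rewrite {1}(tuple_eta a) {1}(tuple_eta x) !tnthS.
Qed.

(** The multi-indices lie in the cube [0, k]^n, over which the sum factors into n sums bounded by
    [hermite_sqr_sum_bound]. As A is an arbitrary subset, the induction runs over the fibres [B i]
    of the first index. *)
Lemma hermite_tuple_sqr_sum n k (A : seq (n.-tuple nat)) (x : n.-tuple R) :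
  uniq A -> (forall a j, a \in A -> (tnth a j <= k)%N) ->
  \sum_(a <- A) hermite_tuple a x ^+ 2 <= ladder k ^+ n.
Proof.
elim: n A x => [|n IH] A x uA Ak.
  rewrite expr0; case: A uA {Ak} => [|a [|b A]] uA.
  - by rewrite big_nil.
  - by rewrite big_seq1 /hermite_tuple big_ord0 expr1n.
  - by move: uA; rewrite /= (tuple0 a) (tuple0 b) in_cons eqxx.
pose B i := [seq (tbehead a) | a <- A & thead a == i].
have uB i : uniq (B i).
  rewrite map_inj_in_uniq ?filter_uniq// => a b.
  rewrite !mem_filter => /andP[/eqP ai _] /andP[/eqP bi _] ab.
  by rewrite (tuple_eta a) (tuple_eta b) ai bi; move/(congr1 val): ab => /= ab; apply/val_inj; rewrite /= ab.
have Bk i (b : n.-tuple nat) j : b \in B i -> (tnth b j <= k)%N.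
  move=> /mapP[a]; rewrite mem_filter => /andP[_ aA] ->.
  by have := Ak a (lift ord0 j) aA; rewrite {1}(tuple_eta a) tnthS.
have -> : \sum_(a <- A) hermite_tuple a x ^+ 2 =
    \sum_(i < k.+1) h i (thead x) ^+ 2 *
      \sum_(b <- B i) hermite_tuple b (tbehead x) ^+ 2.
  transitivity (\sum_(a <- A) \sum_(i < k.+1 | thead a == i :> nat) hermite_tuple a x ^+ 2).
    rewrite big_seq [RHS]big_seq; apply: eq_bigr => a aA.
    have ak : (thead a < k.+1)%N by rewrite ltnS; exact: Ak.
    by rewrite (big_pred1 (Ordinal ak)).
  rewrite (exchange_big_dep xpredT)//=; apply: eq_bigr => i _.
  rewrite mulr_sumr /B big_map big_filter; apply: eq_bigr => a /eqP ai.
  by rewrite hermite_tupleS ai exprMn.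
apply: (@le_trans _ _ (\sum_(i < k.+1) h i (thead x) ^+ 2 * ladder k ^+ n)).
  apply: ler_sum => i _; rewrite ler_wpM2l ?sqr_ge0//.
  by apply: IH => // b j; exact: Bk.
rewrite -mulr_suml exprS ler_wpM2r ?exprn_ge0 ?(ltW (ladder_gt0 _))//.
exact: hermite_sqr_sum_bound.
Qed.

Definition hermite_sum_const n k : R :=
  8 * Num.sqrt (Num.sqrt (2 * k + 1)%:R) * ladder k ^+ n.-1.

(* One coordinate is bounded pointwise, and the total degree k turns the sum
   into a free sum over the others: this beats the trivial bound k^(n/2). *)
Lemma hermite_tuple_sqr_sum_degree n k (A : seq (n.-tuple nat)) (x : n.-tuple R) :
  (0 < n)%N -> uniq A -> (forall a, a \in A -> (\sum_(j < n) tnth a j)%N = k) ->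
  \sum_(a <- A) hermite_tuple a x ^+ 2 <= hermite_sum_const n k.
Proof.
case: n A x => // n A x _ uA Ak.
have Ak' a j : a \in A -> (tnth a j <= k)%N.
  by move=> aA; rewrite -(Ak a aA) (bigD1 j)//= leq_addr.
pose B := [seq (tbehead a) | a <- A].
(* At fixed total degree the tail determines the first index, so dropping that index is injective on
   A. *)
have thA (a : n.+1.-tuple nat) : a \in A ->
    thead a = (k - \sum_(j < n) tnth (tbehead a) j)%N.
  move=> aA; rewrite -(Ak a aA) big_ord_recl.
  rewrite [X in (_ + X - _)%N](_ : _ = \sum_(j < n) tnth (tbehead a) j)%N ?addnK//.
  by apply: eq_bigr => j _; rewrite {1}(tuple_eta a) tnthS.
have uB : uniq B.
  rewrite map_inj_in_uniq// => a b aA bA ab.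
  rewrite (tuple_eta a) (tuple_eta b) (thA a aA) (thA b bA) ab.
  by move/(congr1 val): ab => /= ab; apply/val_inj; rewrite /= ab.
have Bk (b : n.-tuple nat) j : b \in B -> (tnth b j <= k)%N.
  move=> /mapP[a aA ->].
  by have := Ak' a (lift ord0 j) aA; rewrite {1}(tuple_eta a) tnthS.
set M := 8 * Num.sqrt (Num.sqrt (2 * k + 1)%:R) : R.
have M0 : 0 <= M by rewrite mulr_ge0// sqrtr_ge0.
apply: (@le_trans _ _ (\sum_(a <- A) M * hermite_tuple (tbehead a) (tbehead x) ^+ 2)).
  rewrite big_seq [leRHS]big_seq; apply: ler_sum => a aA.
  rewrite hermite_tupleS exprMn ler_wpM2r ?sqr_ge0//.
  rewrite (le_trans (hermite_sqr_bound _ _))// ler_wpM2l//.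
  rewrite !ler_wsqrtr// ler_nat leq_add2r leq_mul2l/=.
  exact: Ak'.
rewrite -mulr_sumr ler_wpM2l//.
rewrite -(big_map (fun a : n.+1.-tuple nat => (tbehead a)) xpredT
  (fun b => hermite_tuple b (tbehead x) ^+ 2)).
exact: hermite_tuple_sqr_sum.
Qed.

End HermiteTupleSum.

Section LebesgueTupleIntegral.
Context {R : realType}.
Local Notation mR := (measurableTypeR R).
Local Notation mu := (@lebesgue_measure R).

Lemma integral_lebesgue_tuple0 (f : 0.-tuple mR -> \bar R) :
  measurable_fun setT f -> (\int[lebesgue_tuple 0]_x f x = f [tuple])%E.
Proof.
move=> mf; have := integral_dirac ([tuple] : 0.-tuple mR) measurableT mf.
by rewrite diracT mul1e => <-.
Qed.

Lemma ge0_integral_lebesgue_tupleS n (f : n.+1.-tuple mR -> \bar R) :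
  measurable_fun setT f -> (forall x, 0 <= f x)%E ->
  (\int[lebesgue_tuple n.+1]_x f x =
   \int[sfprod mu (lebesgue_tuple n)]_z f (tcons z))%E.
Proof.
move=> mf f0.
rewrite -[RHS](@ge0_integral_pushforward _ _ _ _ _ (@tcons R n) (@measurable_tcons R n)
  (sfprod mu (lebesgue_tuple n)) setT f)//.
Qed.

Lemma integrable_lebesgue_tupleS n (f : n.+1.-tuple mR -> \bar R) :
  measurable_fun setT f ->
  (sfprod mu (lebesgue_tuple n)).-integrable setT (f \o @tcons R n) ->
  (lebesgue_tuple n.+1).-integrable setT f.
Proof.
move=> mf /integrableP[_ fi]; apply/integrableP; split => //.
rewrite ge0_integral_lebesgue_tupleS//; exact: measurableT_comp.
Qed.

Lemma Rintegral_lebesgue_tupleS n (f : n.+1.-tuple mR -> R) :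
  measurable_fun setT f ->
  \int[lebesgue_tuple n.+1]_x f x = \int[sfprod mu (lebesgue_tuple n)]_z f (tcons z).
Proof.
move=> mf; rewrite /Rintegral; congr fine.
have mf' : measurable_fun setT (EFin \o f) by exact/measurable_EFinP.
rewrite [LHS]integralE [RHS]integralE.
rewrite !ge0_integral_lebesgue_tupleS//.
- by congr (_ - _)%E; apply: eq_integral => z _; rewrite ?funeposE ?funenegE.
- exact: measurable_funeneg.
- exact: measurable_funepos.
Qed.

Lemma measurable_prod_tnth n (F : 'I_n -> R -> R) :
  (forall j, measurable_fun setT (F j)) ->
  measurable_fun setT (fun x : n.-tuple mR => \prod_(j < n) F j (tnth x j)).
Proof.
move=> mF; apply: measurable_prod => j _.
by apply: (measurableT_comp (mF j)); exact: measurable_tnth.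
Qed.

(** Integrability and value are proved together, because Fubini in the induction step for the value
    needs the integrability of the tail product. *)
Lemma lebesgue_tuple_prod n (F : 'I_n -> R -> R) :
  (forall j, mu.-integrable setT (EFin \o F j)) ->
  (lebesgue_tuple n).-integrable setT (fun x => (\prod_(j < n) F j (tnth x j))%:E) /\
  \int[lebesgue_tuple n]_x (\prod_(j < n) F j (tnth x j)) = \prod_(j < n) \int[mu]_y F j y.
Proof.
elim: n F => [|n IH] F iF.
  split.
    apply/integrableP; split.
      by apply/measurable_EFinP; apply: measurable_prod_tnth; case.
    rewrite integral_lebesgue_tuple0; first by rewrite /= big_ord0 normr1 ltry.
    apply: measurableT_comp => //; apply/measurable_EFinP.
    by apply: measurable_prod_tnth; case.
  rewrite /Rintegral integral_lebesgue_tuple0; first by rewrite !big_ord0.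
  by apply/measurable_EFinP; apply: measurable_prod_tnth; case.
have mF j : measurable_fun setT (F j).
  by apply/measurable_EFinP; exact: measurable_int (iF j).
have [iIH eIH] := IH (fun j => F (lift ord0 j)) (fun j => iF (lift ord0 j)).
have eF (z : mR * n.-tuple mR) : \prod_(j < n.+1) F j (tnth (tcons z) j) =
    F ord0 z.1 * \prod_(j < n) F (lift ord0 j) (tnth z.2 j).
  rewrite big_ord_recl; congr (_ * _).
  by apply: eq_bigr => j _; rewrite /tcons /= tnthS.
have mP := measurable_prod_tnth mF.
split.
  apply: integrable_lebesgue_tupleS; first exact/measurable_EFinP.
  rewrite [X in _.-integrable _ X](_ : _ =
    fun z => (F ord0 z.1 * \prod_(j < n) F (lift ord0 j) (tnth z.2 j))%:E).
    exact: (integrable_tensor (iF ord0) iIH).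
  by apply/funext => z /=; rewrite eF.
rewrite Rintegral_lebesgue_tupleS// big_ord_recl -eIH.
rewrite -(Rintegral_tensor (iF ord0) iIH).
by apply: eq_Rintegral => z _; rewrite eF.
Qed.

End LebesgueTupleIntegral.

Section ScaledHermite.
Context {R : realType}.
Local Notation mR := (measurableTypeR R).
Local Notation mu := (@lebesgue_measure R).
Local Notation h := (@hermite_fun R).

Lemma integral_scaling (G : R -> R) (a : R) : 0 < a -> continuous G ->
  (\int[mu]_x (a * G (a * x))%:E = \int[mu]_x (G x)%:E)%E.
Proof.
move=> a0 cG; have aE x : a * x = a * x + 0 by rewrite addr0.
rewrite [LHS]integralE [RHS]integralE.
have cp : continuous (fun x => Num.max (G x) 0).
  by move=> x; apply: continuous_max; [exact: cG|exact: cvg_cst].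
have cn : continuous (fun x => Num.max (- G x) 0).
  have cN : continuous (fun x => - G x) by move=> x; apply: cvgN; exact: cG.
  by move=> x; exact: (continuous_max (cN x) (@cst_continuous _ _ (0 : R) x)).
congr (_ - _)%E.
- transitivity (\int[mu]_x (Num.max (G x) 0)%:E)%E; last first.
    by apply: eq_integral => x _; rewrite funeposE -EFin_max.
  rewrite -(integral_affine 0 a0 cp); last by move=> x; rewrite le_max lexx orbT.
  apply: eq_integral => x _; rewrite funeposE -EFin_max -aE; congr EFin.
  by rewrite maxr_pMr ?(ltW a0)// mulr0.
- transitivity (\int[mu]_x (Num.max (- G x) 0)%:E)%E; last first.
    by apply: eq_integral => x _; rewrite funenegE -EFinN -EFin_max.
  rewrite -(integral_affine 0 a0 cn); last by move=> x; rewrite le_max lexx orbT.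
  apply: eq_integral => x _; rewrite funenegE -EFinN -EFin_max -aE; congr EFin.
  by rewrite maxr_pMr ?(ltW a0)// mulr0 mulrN.
Qed.

(** The exponent 1/4 per coordinate makes the square carry sqrt|l|, the Jacobian of the dilation;
    the product over n coordinates restores |l|^(n/4). *)
Definition hermite_scaled1 (l : R) k y := `|l| `^ (4^-1) * h k (Num.sqrt `|l| * y).

Lemma hermite_scaled1M l j k y : l != 0 ->
  hermite_scaled1 l j y * hermite_scaled1 l k y =
  Num.sqrt `|l| * (h j (Num.sqrt `|l| * y) * h k (Num.sqrt `|l| * y)).
Proof.
move=> l0; rewrite /hermite_scaled1 mulrACA; congr (_ * _).
rewrite -powRD; last by rewrite normr_eq0 (negbTE l0) implybT.
by rewrite (_ : 4^-1 + 4^-1 = 2^-1) ?powR12_sqrt//; lra.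
Qed.

Lemma integrable_hermite_scaled1M l j k : l != 0 ->
  mu.-integrable setT (fun y => (hermite_scaled1 l j y * hermite_scaled1 l k y)%:E).
Proof.
move=> l0; under eq_fun do rewrite hermite_scaled1M//.
have sl : 0 < Num.sqrt `|l| by rewrite sqrtr_gt0 normr_gt0.
have cG : continuous (fun x => `|h j x * h k x|).
  by move=> x; apply: (continuous_comp (@continuous_hermiteM R j k x)); exact: norm_continuous.
apply/integrableP; split.
  apply/measurable_EFinP; apply: measurable_funM => //.
  apply: (measurableT_comp (continuous_measurable_fun (@continuous_hermiteM R j k))).
  exact: measurable_funM.
under eq_integral do rewrite abse_EFin normrM (gtr0_norm sl).
rewrite (integral_scaling sl cG).
by have /integrableP[] := @integrable_hermiteM R j k.
Qed.

Lemma hermite_scaled1_orthonormal l j k : l != 0 ->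
  \int[mu]_y (hermite_scaled1 l j y * hermite_scaled1 l k y) = (j == k)%:R.
Proof.
move=> l0; under eq_Rintegral do rewrite hermite_scaled1M//.
have sl : 0 < Num.sqrt `|l| by rewrite sqrtr_gt0 normr_gt0.
rewrite /Rintegral (integral_scaling sl (@continuous_hermiteM R j k)).
have [->|jk] := eqVneq j k; first by rewrite hermite_normalized.
by rewrite hermite_orthogonal.
Qed.

Lemma scaled_hermiteE n (a : n.-tuple nat) l (x : n.-tuple R) :
  scaled_hermite a l x = \prod_(j < n) hermite_scaled1 l (tnth a j) (tnth x j).
Proof.
rewrite /scaled_hermite /hermite_scaled1 big_split/=; congr (_ * _).
  by rewrite prodr_const card_ord -powR_mulrn ?powR_ge0// -powRrM mulrC.
by apply: eq_bigr => j _; rewrite tnth_mktuple.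
Qed.

Lemma measurable_scaled_hermite n (a : n.-tuple nat) :
  measurable_fun setT (fun z : R * n.-tuple mR => scaled_hermite a z.1 z.2).
Proof.
under eq_fun do rewrite scaled_hermiteE.
apply: measurable_prod => j _; apply: measurable_funM.
  by apply: (measurableT_comp (measurable_powR _)); exact: measurableT_comp.
apply: (measurableT_comp (continuous_measurable_fun (@continuous_hermite R (tnth a j)))).
apply: measurable_funM.
  apply: (measurableT_comp (continuous_measurable_fun (@sqrt_continuous R))).
  exact: measurableT_comp.
exact: (measurableT_comp (measurable_tnth j) measurable_snd).
Qed.

Lemma scaled_hermite_integrableM n (a b : n.-tuple nat) (l : R) : l != 0 ->
  (lebesgue_tuple n).-integrable setT (fun x => (scaled_hermite a l x * scaled_hermite b l x)%:E) /\
  \int[lebesgue_tuple n]_x (scaled_hermite a l x * scaled_hermite b l x) = (a == b)%:R.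
Proof.
move=> l0.
pose F (j : 'I_n) y := hermite_scaled1 l (tnth a j) y * hermite_scaled1 l (tnth b j) y.
have iF j : mu.-integrable setT (EFin \o F j) by exact: integrable_hermite_scaled1M.
have [i1 i2] := lebesgue_tuple_prod iF.
have e x : scaled_hermite a l x * scaled_hermite b l x = \prod_(j < n) F j (tnth x j).
  by rewrite !scaled_hermiteE -big_split.
split; first by under eq_fun do rewrite e.
under eq_Rintegral do rewrite e.
rewrite i2; under eq_bigr do rewrite hermite_scaled1_orthonormal//.
have [->|ab] := eqVneq a b; first by rewrite big1// => j _; rewrite eqxx.
apply/eqP; rewrite prodf_seq_eq0; apply/hasP.
have [j jab] : exists j, tnth a j != tnth b j.
  apply/existsP; rewrite -negb_forall; apply: contra ab => /forallP ab.
  by apply/eqP/eq_from_tnth => j; apply/eqP.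
by exists j; rewrite ?mem_index_enum//= (negbTE jab).
Qed.

Lemma scaled_hermite_square_integrable n (a : n.-tuple nat) (l : R) : l != 0 ->
  square_integrable (lebesgue_tuple n) (scaled_hermite a l).
Proof.
move=> l0; split.
  exact: (measurableT_comp (measurable_scaled_hermite a) (pair1_measurable l)).
have [/integrableP[_]] := @scaled_hermite_integrableM n a a l l0.
move=> + _; apply: le_lt_trans; rewrite le_eqVlt; apply/orP; left; apply/eqP.
by apply: eq_integral => x _; rewrite -expr2 gee0_abs// lee_fin sqr_ge0.
Qed.

(** Since 0^(n/4) = 0 for n > 0, Bessel's inequality also holds at l = 0, and no null set has to be
    removed from the integrals in l. *)
Lemma scaled_hermite0 n (a : n.-tuple nat) (x : n.-tuple R) : (0 < n)%N ->
  scaled_hermite a 0 x = 0.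
Proof.
move=> n0; rewrite /scaled_hermite normr0 powR0 ?mul0r// mulf_neq0// ?pnatr_eq0 -?lt0n//.
Qed.

Lemma scaled_hermite_sqr n (a : n.-tuple nat) l (x : n.-tuple R) :
  scaled_hermite a l x ^+ 2 =
  `|l| `^ (n%:R / 2) * hermite_tuple a [tuple Num.sqrt `|l| * tnth x j | j < n] ^+ 2.
Proof.
rewrite /scaled_hermite exprMn; congr (_ * _).
by rewrite -powR_mulrn ?powR_ge0// -powRrM; congr (_ `^ _); lra.
Qed.

Lemma scaled_hermite_bessel n (A : seq (n.-tuple nat)) l (u : n.-tuple mR -> R) :
  (0 < n)%N -> uniq A -> measurable_fun setT u ->
  ((\sum_(a <- A) (\int[lebesgue_tuple n]_x (u x * scaled_hermite a l x)) ^+ 2)%:E <=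
   \int[lebesgue_tuple n]_x (u x ^+ 2)%:E)%E.
Proof.
move=> n0 uA mu'; have [->|l0] := eqVneq l 0; last first.
  apply: Bessel => // [a|a b]; first exact: scaled_hermite_square_integrable.
  exact: (scaled_hermite_integrableM a b l0).2.
rewrite big1; first by apply: integral_ge0 => x _; rewrite lee_fin sqr_ge0.
move=> a _; under eq_Rintegral do rewrite scaled_hermite0// mulr0.
by rewrite Rintegral_cst// mul0r expr0n.
Qed.

Lemma scaled_hermite_sum_bound n k (A : seq (n.-tuple nat)) l (x : n.-tuple R) :
  (0 < n)%N -> uniq A -> (forall a, a \in A -> (\sum_(j < n) tnth a j)%N = k) ->
  \sum_(a <- A) scaled_hermite a l x ^+ 2 <= `|l| `^ (n%:R / 2) * hermite_sum_const n k.
Proof.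
move=> n0 uA Ak; under eq_bigr do rewrite scaled_hermite_sqr.
rewrite -mulr_sumr ler_wpM2l ?powR_ge0//.
exact: hermite_tuple_sqr_sum_degree.
Qed.

End ScaledHermite.

(** * Fubini's theorem for real-valued iterated integrals *)

Section RintegralFubini.
Context d1 d2 (S : measurableType d1) (L : measurableType d2) (R : realType).
Variables (m1 : {sigma_finite_measure set S -> \bar R}).
Variables (m2 : {sigma_finite_measure set L -> \bar R}).

(** Every section is required to be integrable, not merely almost every one, so that real-valued
    inner integrals can be exchanged by pointwise rewriting. *)
Definition fully_integrable (f : S * L -> R) :=
  [/\ (sfprod m1 m2).-integrable setT (EFin \o f),
      forall x, m2.-integrable setT (fun y => (f (x, y))%:E) &
      forall y, m1.-integrable setT (fun x => (f (x, y))%:E)].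

Lemma fully_integrable_measurable f : fully_integrable f -> measurable_fun setT f.
Proof. by move=> [fi _ _]; apply/measurable_EFinP; exact: measurable_int fi. Qed.

Lemma le_fully_integrable (f g : S * L -> R) : measurable_fun setT f ->
  (forall z, `|f z| <= `|g z|) -> fully_integrable g -> fully_integrable f.
Proof.
move=> mf fg [gi g1 g2]; split.
- apply: le_integrable gi => //; first exact/measurable_EFinP.
  by move=> z _ /=; rewrite lee_fin.
- move=> x; apply: le_integrable (g1 x) => //.
    by apply/measurable_EFinP; exact: (measurableT_comp mf (pair1_measurable x)).
  by move=> y _ /=; rewrite lee_fin.
- move=> y; apply: le_integrable (g2 y) => //.
    by apply/measurable_EFinP; exact: (measurableT_comp mf (pair2_measurable y)).
  by move=> x _ /=; rewrite lee_fin.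
Qed.

Lemma fully_integrableZl (f : S * L -> R) (k : R) :
  fully_integrable f -> fully_integrable (fun z => k * f z).
Proof.
move=> [fi f1 f2]; split.
- by apply: (integrableZl measurableT k fi).
- by move=> x; apply: (integrableZl measurableT k (f1 x)).
- by move=> y; apply: (integrableZl measurableT k (f2 y)).
Qed.

Lemma fully_integrableM (f w : S * L -> R) (C : R) : fully_integrable f ->
  measurable_fun setT w -> (forall z, `|w z| <= C) -> fully_integrable (fun z => f z * w z).
Proof.
move=> fi mw wC; apply: (@le_fully_integrable _ (fun z => C * f z)).
- by apply: measurable_funM => //; exact: fully_integrable_measurable.
- move=> z; rewrite normrM [leRHS]normrM mulrC ler_wpM2r//.
  exact: le_trans (wC z) (ler_norm C).
- exact: fully_integrableZl.
Qed.

Lemma fully_integrable_tensor (u : S -> R) (v : L -> R) :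
  m1.-integrable setT (EFin \o u) -> m2.-integrable setT (EFin \o v) ->
  fully_integrable (fun z => u z.1 * v z.2).
Proof.
move=> iu iv; split.
- exact: integrable_tensor.
- by move=> x; apply: (integrableZl measurableT (u x) iv).
- by move=> y; apply: (integrableZr measurableT (v y) iu).
Qed.

Lemma Rintegral_fubini12 f : fully_integrable f ->
  \int[sfprod m1 m2]_z f z = \int[m1]_x \int[m2]_y f (x, y).
Proof.
move=> [fi f1 _]; rewrite /Rintegral -[in LHS](integral12_prod_meas1 fi); congr fine.
by apply: eq_integral => x _; rewrite fineK//; exact: integrable_fin_num (f1 x).
Qed.

Lemma Rintegral_fubini21 f : fully_integrable f ->
  \int[sfprod m1 m2]_z f z = \int[m2]_y \int[m1]_x f (x, y).
Proof.
move=> [fi _ f2]; rewrite /Rintegral -[in LHS](integral21_prod_meas1 fi); congr fine.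
by apply: eq_integral => y _; rewrite fineK//; exact: integrable_fin_num (f2 y).
Qed.

End RintegralFubini.

(** The right-hand side is an extended real, so the inequality also covers functions that are not
    integrable. *)
Lemma sqr_Rintegral_le d (T : measurableType d) (R : realType)
  (mu : {measure set T -> \bar R}) (f : T -> R) : measurable_fun setT f ->
  (((\int[mu]_x f x) ^+ 2)%:E <= \int[mu]_x `|f x|%:E * \int[mu]_x `|f x|%:E)%E.
Proof.
move=> mf; have I0 : (0 <= \int[mu]_x `|f x|%:E)%E by exact: integral_ge0.
have h : (`|\int[mu]_x f x|%:E <= \int[mu]_x `|f x|%:E)%E.
  apply: (@le_trans _ _ `|\int[mu]_x (f x)%:E|%E).
    by rewrite /Rintegral; case: (\int[mu]_x _)%E => [r| |]//=; rewrite normr0 leey.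
  by apply: le_abse_integral => //; exact/measurable_EFinP.
rewrite -real_normK ?num_real// expr2 EFinM.
by apply: lee_pmul.
Qed.

Section PowerSplitting.
Context {R : realType}.
Implicit Types (y h c p q : R).

Lemma powRD_gt0 h p q : 0 < h -> h `^ (p + q) = h `^ p * h `^ q.
Proof. by move=> h0; rewrite powRD// (gt_eqF h0) implybT. Qed.

(** With [powR_split_small], the two halves of truncation at height h: above h the first power is
    paid for by the power p, below h the power p by a smaller power q. *)
Lemma powR_split_large p h y : 1 <= p -> 0 < h -> h <= y -> y <= h `^ (1 - p) * y `^ p.
Proof.
move=> p1 h0 hy; have y0 : 0 < y by exact: lt_le_trans hy.
have -> : y `^ p = y * y `^ (p - 1).
  by rewrite -[X in _ = X * _]powRr1 ?(ltW y0)// -powRD_gt0// addrC subrK.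
rewrite mulrCA ler_peMr ?(ltW y0)//.
have e1 : h `^ (1 - p) * h `^ (p - 1) = 1.
  by rewrite -powRD_gt0// addrA subrK subrr powRr0.
rewrite -[X in X <= _]e1.
by rewrite ler_wpM2l ?powR_ge0// ge0_ler_powR ?subr_ge0 ?nnegrE// ltW.
Qed.

Lemma powR_split_small p q h y : q <= p -> 0 < q -> 0 <= y -> 0 < h -> y <= h ->
  y `^ p <= h `^ (p - q) * y `^ q.
Proof.
move=> qp q0 y0 h0 yh; have [->|y0'] := eqVneq y 0.
  by rewrite !powR0 ?mulr0// gt_eqF// (lt_le_trans q0).
have yp : 0 < y by rewrite lt_neqAle eq_sym y0'.
rewrite (_ : y `^ p = y `^ (p - q) * y `^ q); last by rewrite -powRD_gt0// subrK.
by rewrite ler_wpM2r ?powR_ge0// ge0_ler_powR ?subr_ge0 ?nnegrE// ltW.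
Qed.

End PowerSplitting.

(** * Local Plancherel inequality with the phase of the surface *)

Section TrigPlancherel.
Context {R : realType}.
Local Notation mu := (@lebesgue_measure R).
Variable e : R -> R.
Hypothesis etrig : e = cos \/ e = sin.

Lemma trig_le1 x : `|e x| <= 1.
Proof.
by case: etrig => ->; rewrite ler_norml ?cos_geN1 ?cos_le1 ?sin_geN1 ?sin_le1.
Qed.

Lemma measurable_trig : measurable_fun setT e.
Proof.
by case: etrig => ->; apply: continuous_measurable_fun;
  [exact: continuous_cos|exact: continuous_sin].
Qed.

(** At fixed l the phase l t rotates the pair (cosine, sine) and |l| only changes the sign of the
    sine; the bound is therefore independent of t. *)
Lemma trig_Plancherel (N B t : R) (h : R -> R) : 0 < N -> 0 < B ->
  mu.-integrable setT (EFin \o h) ->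
  (\int[mu]_l (\1_(window (B / N)) l *
     (\int[mu]_s (h s * e (l * t + N * `|l| * s))) ^+ 2)%:E <=
   (plancherel_const B / N)%:E * \int[mu]_s (h s ^+ 2)%:E)%E.
Proof.
move=> N0 B0 ih; apply: le_trans (local_Plancherel N0 B0 ih).
have mh : measurable_fun setT h by apply/measurable_EFinP; exact: measurable_int ih.
have bnd (w : R -> R) : continuous w -> (forall x, `|w x| <= 1) ->
    mu.-integrable setT (EFin \o (fun s => h s * w s)).
  move=> cw w1; apply: le_integrable ih => //.
    by apply/measurable_EFinP; apply: measurable_funM => //; exact: continuous_measurable_fun.
  by move=> s _ /=; rewrite lee_fin normrM ler_piMr.
have cos1 x : `|cos x : R| <= 1 by rewrite ler_norml cos_geN1 cos_le1.
have sin1 x : `|sin x : R| <= 1 by rewrite ler_norml sin_geN1 sin_le1.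
have msl (w : R -> R) : measurable_fun setT w ->
    measurable_fun setT (fun l => \int[mu]_s (h s * w (N * l * s))).
  move=> mw; apply: (@measurable_param_Rintegral _ _ _ _ _ mu (fun z => h z.1 * w (N * z.2 * z.1))).
  apply: measurable_funM; first exact: measurableT_comp.
  by apply: (measurableT_comp mw); apply: measurable_funM => //; exact: measurable_funM.
apply: ge0_le_integral => //.
- by move=> l _; rewrite lee_fin mulr_ge0// sqr_ge0.
- apply/measurable_EFinP; apply: measurable_funM; first exact: measurable_fun_window.
  apply: measurable_funX.
  apply: (@measurable_param_Rintegral _ _ _ _ _ mu (fun z : R * R => h z.1 * e (z.2 * t + N * `|z.2| * z.1))).
  apply: measurable_funM; first exact: measurableT_comp.
  apply: (measurableT_comp measurable_trig); apply: measurable_funD.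
    exact: measurable_funM.
  by apply: measurable_funM => //; apply: measurable_funM => //; exact: measurableT_comp.
- apply/measurable_EFinP; apply: measurable_funM; first exact: measurable_fun_window.
  by apply: measurable_funD; apply: measurable_funX; apply: msl;
    apply: continuous_measurable_fun; [exact: continuous_cos|exact: continuous_sin].
move=> l _; rewrite lee_fin ler_wpM2l//.
set c := \int[mu]_s (h s * cos (N * l * s)); set s := \int[mu]_s (h s * sin (N * l * s)).
have [eps eps1 absl] : exists2 eps : R, eps ^+ 2 = 1 & `|l| = eps * l.
  have [l0|l0] := lerP 0 l.
    by exists 1; rewrite ?expr1n ?mul1r// ger0_norm.
  by exists (-1); rewrite ?sqrrN ?expr1n ?mulN1r// ltr0_norm.
have cE x : cos (N * `|l| * x) = cos (N * l * x).
  rewrite absl; have [->|->] : eps = 1 \/ eps = -1.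
  - by have /eqP := eps1; rewrite sqrf_eq1 => /orP[/eqP|/eqP]; [left|right].
  - by rewrite mul1r.
  - by rewrite mulN1r mulrN mulNr cosN.
have sE x : sin (N * `|l| * x) = eps * sin (N * l * x).
  rewrite absl; have [->|->] : eps = 1 \/ eps = -1.
  - by have /eqP := eps1; rewrite sqrf_eq1 => /orP[/eqP|/eqP]; [left|right].
  - by rewrite !mul1r.
  - by rewrite !mulN1r mulrN mulNr sinN.
have ic := bnd _ (@continuous_cosM R (N * l)) (fun x => cos1 _).
have is_ := bnd _ (@continuous_sinM R (N * l)) (fun x => sin1 _).
have lin (u v : R) : \int[mu]_s (h s * (u * cos (N * l * s) + v * sin (N * l * s))) = u * c + v * s.
  transitivity (\int[mu]_s (u * (h s * cos (N * l * s)) + v * (h s * sin (N * l * s)))).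
    by apply: eq_Rintegral => x _; ring.
  rewrite RintegralD//; last 2 first.
  - by apply: (integrableZl measurableT u ic).
  - by apply: (integrableZl measurableT v is_).
  by rewrite !RintegralZl.
have eps2 : eps ^+ 2 = 1 by [].
have cs := cos2Dsin2 (l * t).
(* The addition formula gives a unit vector (A, B'). Cauchy-Schwarz in the plane then ends the
   proof, the defect being the square of B' c - A s. *)
have [A [B' [AB eAB]]] : exists A B' : R, A ^+ 2 + B' ^+ 2 = 1 /\
    forall x, e (l * t + N * `|l| * x) = A * cos (N * l * x) + B' * sin (N * l * x).
  case: etrig => eE.
    exists (cos (l * t)), (- (eps * sin (l * t))); split.
      by rewrite sqrrN exprMn eps2 mul1r.
    by move=> x; rewrite eE cosD cE sE; ring.
  exists (sin (l * t)), (eps * cos (l * t)); split.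
    by rewrite exprMn eps2 mul1r addrC.
  by move=> x; rewrite eE sinD cE sE; ring.
under eq_Rintegral do rewrite eAB.
rewrite lin -[leRHS]mul1r -AB -subr_ge0.
by rewrite [X in 0 <= X](_ : _ = (B' * c - A * s) ^+ 2) ?sqr_ge0//; ring.
Qed.

End TrigPlancherel.

Lemma measurable_fun_comp2 d d1 d2 d3 (T : measurableType d) (T1 : measurableType d1)
  (T2 : measurableType d2) (T3 : measurableType d3) (F : T1 * T2 -> T3) (f : T -> T1) (g : T -> T2) :
  measurable_fun setT F -> measurable_fun setT f -> measurable_fun setT g ->
  measurable_fun setT (fun w => F (f w, g w)).
Proof. by move=> mF mf mg; apply: (measurableT_comp mF); exact: measurable_fun_pair. Qed.

(** * Estimates at a fixed degree *)

Section FixedDegree.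
Context {R : realType}.
Local Notation mR := (measurableTypeR R).
Local Notation mu := (@lebesgue_measure R).
Variables (n k : nat) (A : seq (n.-tuple nat)).
Hypotheses (n0 : (0 < n)%N) (uA : uniq A).
Hypothesis Ak : forall a, a \in A -> (\sum_(j < n) tnth a j)%N = k.
Variables (B : R) (e : R -> R) (t : R).
Hypotheses (B0 : 0 < B) (etrig : e = cos \/ e = sin).
Local Notation mX := (lebesgue_tuple n : {sigma_finite_measure set (n.-tuple mR) -> \bar R}).
Local Notation mZ := (sfprod mX mu).

Let N : R := (2 * k + n)%:R.
Let b : R := B / N.
Let chi l : R := \1_(window b) l.
Let phase (l s : R) : R := e (l * t + N * `|l| * s).

Let N0 : 0 < N. Proof. by rewrite ltr0n addn_gt0 n0 orbT. Qed.

Let b0 : 0 < b. Proof. by rewrite divr_gt0. Qed.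

(** The coefficient of a slice at fixed t, with nu already replaced by N |l| and the complex
    exponential by one of its two real components. *)
Definition degree_coef (a : n.-tuple nat) (l : R) (g : n.-tuple mR * mR -> R) : R :=
  \int[mZ]_z (g z * (phase l z.2 * scaled_hermite a l z.1)).

Definition degree_energy (g : n.-tuple mR * mR -> R) : \bar R :=
  (\sum_(a <- A) \int[mu]_l (chi l * degree_coef a l g ^+ 2)%:E)%E.

Let chi_sqr l : chi l ^+ 2 = chi l.
Proof. by rewrite /chi indicE; case: (_ \in _); rewrite ?expr1n ?expr0n. Qed.

Let chi_ge0 l : 0 <= chi l.
Proof. by rewrite /chi indicE. Qed.

Let measurable_chi : measurable_fun setT chi.
Proof. exact: measurable_fun_window. Qed.

Let phase_le1 l s : `|phase l s| <= 1.
Proof. exact: (trig_le1 etrig). Qed.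

Let phase_sqr l s : phase l s ^+ 2 <= 1.
Proof. by rewrite -real_normK ?num_real// exprn_ile1. Qed.

Let measurable_phase : measurable_fun setT (fun w : mR * mR => phase w.2 w.1).
Proof.
apply: (measurableT_comp (measurable_trig etrig)); apply: measurable_funD.
  exact: measurable_funM.
by apply: measurable_funM => //; apply: measurable_funM => //; exact: measurableT_comp.
Qed.

Let measurable_sh a : measurable_fun setT (fun w : n.-tuple mR * mR => scaled_hermite a w.2 w.1).
Proof.
exact: (measurableT_comp (measurable_scaled_hermite a) (@measurable_swap _ _ _ _)).
Qed.

Let kernel a l (z : n.-tuple mR * mR) := phase l z.2 * scaled_hermite a l z.1.

Let measurable_kernel a :
  measurable_fun setT (fun w : (n.-tuple mR * mR) * mR => kernel a w.2 w.1).
Proof.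
have m11 : measurable_fun setT (fun w : (n.-tuple mR * mR) * mR => w.1.1) by exact: measurableT_comp.
have m12 : measurable_fun setT (fun w : (n.-tuple mR * mR) * mR => w.1.2) by exact: measurableT_comp.
apply: measurable_funM.
  exact: (measurable_fun_comp2 measurable_phase m12 measurable_snd).
exact: (measurable_fun_comp2 (measurable_sh a) m11 measurable_snd).
Qed.

Let measurable_kernel1 a l : measurable_fun setT (kernel a l).
Proof. exact: (measurableT_comp (measurable_kernel a) (pair2_measurable l)). Qed.

(** A crude bound from u <= 1 + u^2, uniform in x; it serves only to secure integrability against
    the kernel. *)
Lemma scaled_hermite_bound (a : n.-tuple nat) (l : R) (x : n.-tuple mR) : `|scaled_hermite a l x| <=
  1 + `|l| `^ (n%:R / 2) * hermite_sum_const n (\sum_(j < n) tnth a j)%N.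
Proof.
have := @scaled_hermite_sum_bound R n _ [:: a] l x n0 isT.
move=> /(_ (\sum_(j < n) tnth a j)%N); rewrite big_seq1 => h.
have {}h : scaled_hermite a l x ^+ 2 <= `|l| `^ (n%:R / 2) * hermite_sum_const n (\sum_(j < n) tnth a j)%N.
  by apply: h => c; rewrite inE => /eqP ->.
rewrite -real_normK ?num_real// in h; move: h.
have := normr_ge0 (scaled_hermite a l x); set u := `|scaled_hermite a l x|; nra.
Qed.

Lemma measurable_degree_coef a g : measurable_fun setT g ->
  measurable_fun setT (fun l => degree_coef a l g).
Proof.
move=> mg; apply: (@measurable_param_Rintegral _ _ _ _ _ mZ
  (fun w : (n.-tuple mR * mR) * mR => g w.1 * kernel a w.2 w.1)).
by apply: measurable_funM => //; exact: (measurableT_comp mg measurable_fst).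
Qed.

Let fully_kernel a l g : fully_integrable mX mu g ->
  fully_integrable mX mu (fun z => g z * kernel a l z).
Proof.
move=> fg; apply: fully_integrableM (measurable_kernel1 a l) _ => //.
move=> z; rewrite /kernel normrM; apply: le_trans (scaled_hermite_bound a l z.1).
by rewrite ler_piMl.
Qed.

Let measurable_weight a g : measurable_fun setT g ->
  measurable_fun setT (fun l => (chi l * degree_coef a l g ^+ 2)%:E).
Proof.
move=> mg; apply/measurable_EFinP; apply: measurable_funM => //.
by apply: measurable_funX; exact: measurable_degree_coef.
Qed.

(** [Minkowski_integral] in z = (x, s) reduces to one point z: the window has length 2b, and on it
    the sum of [scaled_hermite a l x ^+ 2] is at most b^(n/2) times [hermite_sum_const n k]. *)
Lemma degree_energy_L1 g : measurable_fun setT g ->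
  (degree_energy g <= (2 * b * (b `^ (n%:R / 2) * hermite_sum_const n k))%:E *
     (\int[mZ]_z `|g z|%:E * \int[mZ]_z `|g z|%:E))%E.
Proof.
move=> mg.
have hs0 : 0 <= hermite_sum_const n k :> R.
  by rewrite /hermite_sum_const mulr_ge0// ?exprn_ge0// ltW// ladder_gt0.
have bh0 : 0 <= b `^ (n%:R / 2) * hermite_sum_const n k.
  by apply: mulr_ge0 => //; exact: powR_ge0.
pose G a (w : (n.-tuple mR * mR) * mR) := chi w.2 * (g w.1 * kernel a w.2 w.1).
have mG a : measurable_fun setT (G a).
  apply: measurable_funM; first exact: measurableT_comp.
  by apply: measurable_funM => //; exact: (measurableT_comp mg measurable_fst).
apply: le_trans (@Minkowski_integral _ _ _ _ _ mZ mu _ A G (fun z => `|g z|)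
  (2 * b * (b `^ (n%:R / 2) * hermite_sum_const n k)) _ mG _ _ _) => //; last 3 first.
- by apply: mulr_ge0 => //; rewrite pmulr_rge0// ltW.
- exact: measurableT_comp.
- move=> z; rewrite -ge0_integral_sum//; last 2 first.
  + by move=> a; apply/measurable_EFinP; apply: measurable_funX; exact: measurable_fun_pair2.
  + by move=> a l _; rewrite lee_fin sqr_ge0.
  apply: (@le_trans _ _ (\int[mu]_l ((b `^ (n%:R / 2) * hermite_sum_const n k * `|g z| ^+ 2)%:E * (chi l)%:E))%E).
    apply: ge0_le_integral => //.
    * by move=> l _; apply: sume_ge0 => a _; rewrite lee_fin sqr_ge0.
    * apply: emeasurable_sum => a; apply/measurable_EFinP.
      by apply: measurable_funX; exact: measurable_fun_pair2.
    * by apply: measurable_funeM; exact/measurable_EFinP.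
    move=> l _; rewrite sumEFin -EFinM lee_fin.
    rewrite (eq_bigr (fun a => chi l * g z ^+ 2 * (phase l z.2 ^+ 2 * scaled_hermite a l z.1 ^+ 2))); last first.
      by move=> a _; rewrite /G/= -[in RHS]chi_sqr /kernel; ring.
    rewrite -mulr_sumr [leRHS]mulrC -mulrA real_normK ?num_real//.
    rewrite /chi indicE; case: (boolP (l \in _)); last by rewrite !mul0r.
    rewrite mem_window !mul1r => lb; rewrite [leRHS]mulrC ler_wpM2l ?sqr_ge0//.
    apply: (@le_trans _ _ (\sum_(a <- A) scaled_hermite a l z.1 ^+ 2)).
      by apply: ler_sum => a _; rewrite ler_piMl// sqr_ge0.
    apply: le_trans (scaled_hermite_sum_bound _ _ n0 uA Ak) _.
    by rewrite ler_wpM2r// ge0_ler_powR// ?nnegrE// (ltW b0).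
  rewrite ge0_integralZl_EFin//; last 3 first.
  + by move=> l _; rewrite lee_fin.
  + exact/measurable_EFinP.
  + by apply: mulr_ge0 => //; exact: sqr_ge0.
  rewrite integral_window ?(ltW b0)// -EFinM lee_fin le_eqVlt; apply/orP; left; apply/eqP; ring.
apply: lee_sum => a _; apply: ge0_le_integral => //.
- by move=> l _; rewrite lee_fin mulr_ge0 ?sqr_ge0.
- exact: measurable_weight.
- have mI : measurable_fun setT (fun l => \int[mZ]_z `|G a (z, l)|%:E)%E.
    apply: (@measurable_param_integral _ _ _ _ _ mZ (fun w => `|G a w|%:E)).
    by apply/measurable_EFinP; exact: measurableT_comp.
  exact: emeasurable_funM.
(* The indicator equals its own square, so it can be moved under the integral before the square is
   estimated. *)
move=> l _; rewrite -[X in (X * _)%:E]chi_sqr -exprMn.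
rewrite (_ : chi l * degree_coef a l g = \int[mZ]_z (G a (z, l))).
  by apply: sqr_Rintegral_le; exact: measurable_fun_pair1.
rewrite /G/= /degree_coef.
have [l0|l0] : chi l = 0 \/ chi l = 1.
- by rewrite /chi indicE; case: (_ \in _); [right|left].
- by rewrite l0 mul0r; under eq_Rintegral do rewrite mul0r; rewrite Rintegral_cst// mul0r.
- by rewrite l0 mul1r; under [RHS]eq_Rintegral do rewrite mul1r.
Qed.

Lemma degree_energy_L1L2 g (v : R -> R) : fully_integrable mX mu g ->
  measurable_fun setT v -> (forall s, 0 <= v s) ->
  (forall s, \int[mX]_x (g (x, s) ^+ 2)%:E <= (v s ^+ 2)%:E)%E ->
  (degree_energy g <= (2 * b)%:E * (\int[mu]_s (v s)%:E * \int[mu]_s (v s)%:E))%E.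
Proof.
move=> fg mv v0 gv.
have mg := fully_integrable_measurable fg.
pose I a (w : mR * mR) := \int[mX]_x (g (x, w.1) * scaled_hermite a w.2 x).
have mI a : measurable_fun setT (I a).
  apply: (@measurable_param_Rintegral _ _ _ _ _ mX
    (fun w : n.-tuple mR * (mR * mR) => g (w.1, w.2.1) * scaled_hermite a w.2.2 w.1)).
  have m21 : measurable_fun setT (fun w : n.-tuple mR * (mR * mR) => w.2.1) by exact: measurableT_comp.
  have m22 : measurable_fun setT (fun w : n.-tuple mR * (mR * mR) => w.2.2) by exact: measurableT_comp.
  apply: measurable_funM.
    exact: (measurable_fun_comp2 mg measurable_fst m21).
  exact: (measurable_fun_comp2 (measurable_sh a) measurable_fst m22).
pose G a (w : mR * mR) := chi w.2 * (phase w.2 w.1 * I a w).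
have mG a : measurable_fun setT (G a).
  apply: measurable_funM; first exact: measurableT_comp.
  exact: measurable_funM.
apply: le_trans (@Minkowski_integral _ _ _ _ _ mu mu _ A G v (2 * b) _ mG mv v0 _); last 2 first.
- by rewrite mulr_ge0 ?(ltW b0).
- move=> s; rewrite -ge0_integral_sum//; last 2 first.
  + by move=> a; apply/measurable_EFinP; apply: measurable_funX; exact: measurable_fun_pair2.
  + by move=> a l _; rewrite lee_fin sqr_ge0.
  apply: (@le_trans _ _ (\int[mu]_l ((v s ^+ 2)%:E * (chi l)%:E))%E).
    apply: ge0_le_integral => //.
    * by move=> l _; apply: sume_ge0 => a _; rewrite lee_fin sqr_ge0.
    * apply: emeasurable_sum => a; apply/measurable_EFinP.
      by apply: measurable_funX; exact: measurable_fun_pair2.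
    * by apply: measurable_funeM; exact/measurable_EFinP.
    move=> l _; rewrite sumEFin -EFinM lee_fin.
    rewrite (eq_bigr (fun a => chi l * (phase l s ^+ 2 * I a (s, l) ^+ 2))); last first.
      by move=> a _; rewrite /G/= -[in RHS]chi_sqr; ring.
    rewrite -mulr_sumr mulrC ler_wpM2r//.
    apply: (@le_trans _ _ (\sum_(a <- A) I a (s, l) ^+ 2)).
      by apply: ler_sum => a _; rewrite ler_piMl// sqr_ge0.
    rewrite -lee_fin; apply: le_trans (gv s).
    by apply: scaled_hermite_bessel => //; exact: measurable_fun_pair1.
  rewrite ge0_integralZl_EFin ?sqr_ge0//; last 2 first.
  + by move=> l _; rewrite lee_fin.
  + exact/measurable_EFinP.
  by rewrite integral_window ?(ltW b0)// -EFinM lee_fin mulrC.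
apply: lee_sum => a _; apply: ge0_le_integral => //.
- by move=> l _; rewrite lee_fin mulr_ge0 ?sqr_ge0.
- exact: measurable_weight.
- have mJ : measurable_fun setT (fun l => \int[mu]_z `|G a (z, l)|%:E)%E.
    apply: (@measurable_param_integral _ _ _ _ _ mu (fun w => `|G a w|%:E)).
    by apply/measurable_EFinP; exact: measurableT_comp.
  exact: emeasurable_funM.
move=> l _; rewrite -[X in (X * _)%:E]chi_sqr -exprMn.
rewrite (_ : chi l * degree_coef a l g = \int[mu]_s (G a (s, l))).
  by apply: sqr_Rintegral_le; exact: measurable_fun_pair1.
rewrite /G/= /degree_coef (Rintegral_fubini21 (fully_kernel a l fg)).
have e1 s : \int[mX]_x (g (x, s) * kernel a l (x, s)) = phase l s * I a (s, l).
  rewrite /I/= -RintegralZl//; first by apply: eq_Rintegral => x _; rewrite /kernel/=; ring.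
  have [_ _ /(_ s) h] := fully_kernel a l fg.
  have [_ _ g2] := fg.
  apply: (@le_integrable _ _ _ mX setT measurableT _ (fun x => ((1 + `|l| `^ (n%:R / 2) *
     hermite_sum_const n (\sum_(j < n) tnth a j)%N) * g (x, s))%:E)).
  + apply/measurable_EFinP; apply: measurable_funM; first exact: measurable_fun_pair1.
    exact: (measurableT_comp (measurable_sh a) (pair2_measurable l)).
  + move=> x _ /=; rewrite lee_fin normrM [leRHS]normrM mulrC ler_wpM2r//.
    by apply: le_trans (scaled_hermite_bound a l x) _; exact: ler_norm.
  + by apply: (integrableZl measurableT _ (g2 s)).
under [in LHS]eq_Rintegral do rewrite e1.
have [l0|l0] : chi l = 0 \/ chi l = 1.
- by rewrite /chi indicE; case: (_ \in _); [right|left].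
- by rewrite l0 mul0r; under eq_Rintegral do rewrite mul0r; rewrite Rintegral_cst// mul0r.
- by rewrite l0 mul1r; under [RHS]eq_Rintegral do rewrite mul1r.
Qed.

(** The s-integral is taken first, giving [J]. Bessel in x at fixed l removes the sum over a; after
    exchanging x and l, [trig_Plancherel] applies to each g(x, .). *)
Lemma degree_energy_L2 g : fully_integrable mX mu g ->
  (degree_energy g <= (plancherel_const B / N)%:E * \int[mZ]_z (g z ^+ 2)%:E)%E.
Proof.
move=> fg; have mg := fully_integrable_measurable fg.
pose J (w : n.-tuple mR * mR) := \int[mu]_s (g (w.1, s) * phase w.2 s).
have mJ : measurable_fun setT J.
  apply: (@measurable_param_Rintegral _ _ _ _ _ mu
    (fun w : mR * (n.-tuple mR * mR) => g (w.2.1, w.1) * phase w.2.2 w.1)).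
  have m21 : measurable_fun setT (fun w : mR * (n.-tuple mR * mR) => w.2.1) by exact: measurableT_comp.
  have m22 : measurable_fun setT (fun w : mR * (n.-tuple mR * mR) => w.2.2) by exact: measurableT_comp.
  apply: measurable_funM.
    exact: (measurable_fun_comp2 mg m21 measurable_fst).
  exact: (measurable_fun_comp2 measurable_phase measurable_fst m22).
have cE a l : degree_coef a l g = \int[mX]_x (J (x, l) * scaled_hermite a l x).
  rewrite /degree_coef (Rintegral_fubini12 (fully_kernel a l fg)).
  apply: eq_Rintegral => x _; rewrite /J/= mulrC -RintegralZl//.
    by apply: eq_Rintegral => s _; rewrite /kernel/=; ring.
  have [_ g1 _] := fg.
  apply: le_integrable (g1 x) => //.
    apply/measurable_EFinP; apply: measurable_funM; first exact: measurable_fun_pair2.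
    exact: (measurableT_comp measurable_phase (pair2_measurable l)).
  by move=> s _ /=; rewrite lee_fin normrM ler_piMr.
pose F (w : n.-tuple mR * mR) := (chi w.2 * J w ^+ 2)%:E.
have mF : measurable_fun setT F.
  apply/measurable_EFinP; apply: measurable_funM; first exact: measurableT_comp.
  exact: measurable_funX.
have F0 w : (0 <= F w)%E by rewrite lee_fin mulr_ge0// sqr_ge0.
apply: (@le_trans _ _ (\int[mu]_l \int[mX]_x F (x, l))%E).
  rewrite /degree_energy -ge0_integral_sum//; last 2 first.
  - by move=> a; exact: measurable_weight.
  - by move=> a l _; rewrite lee_fin mulr_ge0 ?sqr_ge0.
  apply: ge0_le_integral => //.
  - by move=> l _; apply: sume_ge0 => a _; rewrite lee_fin mulr_ge0 ?sqr_ge0.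
  - by apply: emeasurable_sum => a; exact: measurable_weight.
  - exact: (@measurable_param_integral _ _ _ _ _ mX F mF).
  move=> l _; rewrite sumEFin -mulr_sumr.
  rewrite (_ : (\int[mX]_x F (x, l) = (chi l)%:E * \int[mX]_x (J (x, l) ^+ 2)%:E)%E); last first.
    rewrite -ge0_integralZl_EFin//.
    - by move=> x _; rewrite lee_fin sqr_ge0.
    - by apply/measurable_EFinP; apply: measurable_funX; exact: measurable_fun_pair1.
  rewrite [leLHS]EFinM; apply: lee_wpmul2l; first by rewrite lee_fin.
  under eq_bigr do rewrite cE.
  by apply: scaled_hermite_bessel => //; exact: measurable_fun_pair1.
have -> : (\int[mu]_l \int[mX]_x F (x, l) = \int[mX]_x \int[mu]_l F (x, l))%E.
  by rewrite -(@fubini_tonelli _ _ _ _ _ mX mu F mF F0).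
pose g2 z := (g z ^+ 2)%:E.
have mg2 : measurable_fun setT g2 by apply/measurable_EFinP; exact: measurable_funX.
have g20 z : (0 <= g2 z)%E by rewrite lee_fin sqr_ge0.
have -> : (\int[mZ]_z (g z ^+ 2)%:E = \int[mX]_x \int[mu]_s g2 (x, s))%E.
  exact: (@fubini_tonelli1 _ _ _ _ _ mX mu g2 mg2 g20).
have C0 : 0 <= plancherel_const B / N.
  rewrite divr_ge0 ?(ltW N0)// /plancherel_const mulr_ge0 ?pi_ge0//.
  apply: addr_ge0; [apply: mulr_ge0|apply: divr_ge0] => //; rewrite ?sqr_ge0 ?(ltW B0)//.
rewrite -ge0_integralZl_EFin//; last 2 first.
- by move=> x _; exact: integral_ge0.
- exact: (@measurable_fun_fubini_tonelli_F _ _ _ _ _ mu g2 mg2 g20).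
apply: ge0_le_integral => //.
- by move=> x _; exact: integral_ge0.
- exact: (@measurable_fun_fubini_tonelli_F _ _ _ _ _ mu F mF F0).
- apply: measurable_funeM.
  exact: (@measurable_fun_fubini_tonelli_F _ _ _ _ _ mu g2 mg2 g20).
move=> x _; have [_ g1 _] := fg.
exact: (@trig_Plancherel R e etrig N B t (fun s => g (x, s)) N0 B0 (g1 x)).
Qed.

Lemma degree_energyD3 g g1 g2 g3 :
  fully_integrable mX mu g1 -> fully_integrable mX mu g2 -> fully_integrable mX mu g3 ->
  (forall z, g z = g1 z + g2 z + g3 z) ->
  (degree_energy g <= 3%:E * (degree_energy g1 + degree_energy g2 + degree_energy g3))%E.
Proof.
move=> f1 f2 f3 gE.
have m1 := fully_integrable_measurable f1.
have m2 := fully_integrable_measurable f2.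
have m3 := fully_integrable_measurable f3.
have w0 a l h : (0 <= (chi l * degree_coef a l h ^+ 2)%:E)%E.
  by rewrite lee_fin mulr_ge0 ?sqr_ge0.
have -> : g = fun z => g1 z + g2 z + g3 z by exact/funext.
have cD a l : degree_coef a l (fun z => g1 z + g2 z + g3 z) =
    degree_coef a l g1 + degree_coef a l g2 + degree_coef a l g3.
  have [i1 _ _] := fully_kernel a l f1; have [i2 _ _] := fully_kernel a l f2.
  have [i3 _ _] := fully_kernel a l f3.
  rewrite /degree_coef -RintegralD// -RintegralD//; last exact: (integrableD measurableT i1 i2).
  by apply: eq_Rintegral => z _; rewrite !mulrDl.
rewrite /degree_energy -!big_split/= ge0_sume_distrr; last first.
  have E0 a h : (0 <= \int[mu]_l (chi l * degree_coef a l h ^+ 2)%:E)%E.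
    by apply: integral_ge0 => l _; exact: w0.
  by move=> a _; apply: adde_ge0 => //; exact: adde_ge0.
apply: lee_sum => a _; pose w h l := (chi l * degree_coef a l h ^+ 2)%:E.
have mw h : measurable_fun setT h -> measurable_fun setT (w h) by exact: measurable_weight.
rewrite -ge0_integralD//; [|exact: mw..].
rewrite -ge0_integralD//; [|by move=> l _; rewrite adde_ge0// ?w0|by apply: emeasurable_funD; exact: mw|exact: mw].
rewrite -ge0_integralZl_EFin//; last 2 first.
- by move=> l _; rewrite !adde_ge0// ?w0.
- by apply: emeasurable_funD; [apply: emeasurable_funD|]; exact: mw.
apply: ge0_le_integral => //.
- by apply: mw; do 2 ?apply: measurable_funD.
- by apply: measurable_funeM; apply: emeasurable_funD; [apply: emeasurable_funD|]; exact: mw.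
move=> l _; rewrite /w cD -!EFinD -EFinM lee_fin.
set u := degree_coef a l g1; set v := degree_coef a l g2; set y := degree_coef a l g3.
rewrite -subr_ge0 [X in 0 <= X](_ : _ = chi l * ((u - v) ^+ 2 + (u - y) ^+ 2 + (v - y) ^+ 2)); last by ring.
by rewrite mulr_ge0// !addr_ge0 ?sqr_ge0.
Qed.

End FixedDegree.

(** * Truncation adapted to the mixed norm *)

Section MixedNormSplit.
Context {R : realType}.
Local Notation mR := (measurableTypeR R).
Local Notation mu := (@lebesgue_measure R).
Variables (n k : nat) (A : seq (n.-tuple nat)).
Hypotheses (n0 : (0 < n)%N) (uA : uniq A).
Hypothesis Ak : forall a, a \in A -> (\sum_(j < n) tnth a j)%N = k.
Variables (B : R) (e : R -> R) (t : R).
Hypotheses (B0 : 0 < B) (etrig : e = cos \/ e = sin).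
Variables (p q : R).
Hypotheses (q1 : 1 <= q) (qp : q <= p) (p2 : p < 2).
Local Notation mX := (lebesgue_tuple n : {sigma_finite_measure set (n.-tuple mR) -> \bar R}).
Local Notation mZ := (sfprod mX mu).

Let b : R := B / (2 * k + n)%:R.

(* Above the height tau * max(phi, c) the function g is measured in L^1, below it
   in L^1_s L^2_x where phi > c, and in L^2 where phi <= c. *)
Lemma degree_energy_split (g : n.-tuple mR * mR -> R) (phi : mR -> R) (c tau : R) :
  fully_integrable mX mu g -> measurable_fun setT phi -> (forall s, 0 <= phi s) ->
  (forall s, \int[mX]_x (`|g (x, s)| `^ p)%:E = (phi s `^ p)%:E)%E ->
  0 < c -> (\int[mu]_s (phi s `^ q)%:E <= (c `^ q)%:E)%E -> 0 < tau ->
  (degree_energy k A B e t g <=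
   (3 * (2 * b * (b `^ (n%:R / 2) * hermite_sum_const n k) * tau `^ (1 - p) ^+ 2 +
         2 * b * tau `^ (1 - p / 2) ^+ 2 +
         plancherel_const B / (2 * k + n)%:R * tau `^ (2 - p)) * c ^+ 2)%:E)%E.
Proof.
move=> fg mphi phi0 phiE c0 phic tau0.
have mg := fully_integrable_measurable fg.
have q0 : 0 < q by exact: lt_le_trans q1.
have p0 : 0 < p by exact: lt_le_trans qp.
have p1 : 1 <= p by exact: le_trans qp.
have b0 : 0 < b by rewrite divr_gt0// ltr0n addn_gt0 n0 orbT.
(* Both lower bounds on m serve in the L^1 part: m >= phi turns phi^p into m^(p-q) phi^q, and m >= c
   bounds the remaining m^(1-q) by c^(1-q). *)
pose m s := Num.max (phi s) c.
have m0 s : 0 < m s by rewrite lt_max c0 orbT.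
pose E1 (z : n.-tuple mR * mR) := tau * m z.2 < `|g z|.
pose E2 (z : n.-tuple mR * mR) := c < phi z.2.
pose g1 z := if E1 z then g z else 0.
pose g2 z := if E1 z then 0 else if E2 z then g z else 0.
pose g3 z := if E1 z then 0 else if E2 z then 0 else g z.
have mE1 : measurable_fun setT E1.
  apply: measurable_fun_ltr; last exact: measurableT_comp.
  apply: measurable_funM => //; apply: measurable_maxr => //.
  exact: (measurableT_comp mphi measurable_snd).
have mE2 : measurable_fun setT E2.
  by apply: measurable_fun_ltr => //; exact: (measurableT_comp mphi measurable_snd).
have mg1 : measurable_fun setT g1 by exact: measurable_fun_ifT.
have mg2 : measurable_fun setT g2.
  by apply: measurable_fun_ifT => //; exact: measurable_fun_ifT.
have mg3 : measurable_fun setT g3.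
  by apply: measurable_fun_ifT => //; exact: measurable_fun_ifT.
have f1 : fully_integrable mX mu g1.
  by apply: le_fully_integrable fg => // z; rewrite /g1; case: ifP; rewrite ?normr0.
have f2 : fully_integrable mX mu g2.
  apply: le_fully_integrable fg => // z; rewrite /g2.
  by case: ifP; rewrite ?normr0//; case: ifP; rewrite ?normr0.
have f3 : fully_integrable mX mu g3.
  apply: le_fully_integrable fg => // z; rewrite /g3.
  by case: ifP; rewrite ?normr0//; case: ifP; rewrite ?normr0.
have gE z : g z = g1 z + g2 z + g3 z.
  by rewrite /g1 /g2 /g3; case: ifP => _; [|case: ifP => _]; rewrite ?addr0 ?add0r.
have mgp s : measurable_fun setT (fun x : n.-tuple mR => (`|g (x, s)| `^ p)%:E).
  apply/measurable_EFinP; apply: (measurableT_comp (measurable_powR p)).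
  by apply: measurableT_comp => //; exact: (measurableT_comp mg (pair2_measurable s)).
(* [slice] integrates in x against the L^p_x norm phi, and [total] below integrates in s against the
   L^q_s norm c. *)
have slice (u : n.-tuple mR -> R) s K : measurable_fun setT u -> (forall x, 0 <= u x) ->
    0 <= K -> (forall x, u x <= K * `|g (x, s)| `^ p) ->
    (\int[mX]_x (u x)%:E <= (K * phi s `^ p)%:E)%E.
  move=> mu' u0 K0 uK; rewrite EFinM -phiE -ge0_integralZl_EFin//.
  apply: ge0_le_integral => //.
  - by move=> x _; rewrite lee_fin.
  - exact/measurable_EFinP.
  - exact: measurable_funeM.
  - by move=> x _; rewrite -EFinM lee_fin.
have mphiq : measurable_fun setT (fun s => (phi s `^ q)%:E).
  by apply/measurable_EFinP; exact: (measurableT_comp (measurable_powR q) mphi).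
have total (u : mR -> \bar R) K : measurable_fun setT u -> (forall s, 0 <= u s)%E ->
    0 <= K -> (forall s, u s <= (K * phi s `^ q)%:E)%E ->
    (\int[mu]_s u s <= (K * c `^ q)%:E)%E.
  move=> mu' u0 K0 uK; apply: (@le_trans _ _ (K%:E * \int[mu]_s (phi s `^ q)%:E)%E).
    rewrite -ge0_integralZl_EFin//; last by move=> s _; rewrite lee_fin powR_ge0.
    apply: ge0_le_integral => //; first exact: measurable_funeM.
  by rewrite EFinM; apply: lee_wpmul2l; rewrite ?lee_fin.
have I1 : (\int[mZ]_z `|g1 z|%:E <= (tau `^ (1 - p) * c)%:E)%E.
  pose u z := `|g1 z|%:E.
  have mu' : measurable_fun setT u by apply/measurable_EFinP; exact: measurableT_comp.
  have u0 z : (0 <= u z)%E by rewrite lee_fin.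
  rewrite [leLHS](@fubini_tonelli2 _ _ _ _ _ mX mu u mu' u0) /fubini_G.
  have -> : tau `^ (1 - p) * c = (tau `^ (1 - p) * c `^ (1 - q)) * c `^ q.
    by rewrite -mulrA -powRD_gt0// subrK powRr1// ltW.
  apply: total.
  - exact: (@measurable_fun_fubini_tonelli_G _ _ _ _ _ mX u mu' u0).
  - by move=> s; exact: integral_ge0.
  - by rewrite mulr_ge0// powR_ge0.
  move=> s; have tm : 0 < tau * m s by rewrite mulr_gt0.
  apply: (@le_trans _ _ ((tau * m s) `^ (1 - p) * phi s `^ p)%:E).
    apply: slice => //.
    - by apply: measurableT_comp => //; exact: (measurableT_comp mg1 (pair2_measurable s)).
    - exact: powR_ge0.
    move=> x; rewrite /u /g1; case: ifP => [/ltW h|_].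
      exact: powR_split_large.
    by rewrite normr0 mulr_ge0// powR_ge0.
  rewrite lee_fin powRM ?(ltW tau0) ?(ltW (m0 s))// -!mulrA ler_wpM2l ?powR_ge0//.
  apply: (@le_trans _ _ (m s `^ (1 - p) * (m s `^ (p - q) * phi s `^ q))).
    by rewrite ler_wpM2l ?powR_ge0// powR_split_small// /m le_max lexx.
  rewrite mulrA -powRD_gt0// addrA subrK ler_wpM2r ?powR_ge0//.
  have -> : 1 - q = - (q - 1) by ring.
  rewrite !powRN lef_pV2 ?posrE ?powR_gt0//.
  by rewrite ge0_ler_powR ?subr_ge0 ?nnegrE ?(ltW c0) ?(ltW (m0 s))// /m le_max lexx orbT.
(* Below the height tau phi, the square of g integrates in x to at most (tau phi)^(2-p) phi^p =
   tau^(2-p) phi^2, which is v^2. *)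
pose v s := if c < phi s then tau `^ (1 - p / 2) * phi s else 0.
have mv : measurable_fun setT v.
  by apply: measurable_fun_ifT => //; [exact: measurable_fun_ltr|exact: measurable_funM].
have v0 s : 0 <= v s by rewrite /v; case: ifP => // _; rewrite mulr_ge0// powR_ge0.
have I2 : (\int[mu]_s (v s)%:E <= (tau `^ (1 - p / 2) * c)%:E)%E.
  have -> : tau `^ (1 - p / 2) * c = (tau `^ (1 - p / 2) * c `^ (1 - q)) * c `^ q.
    by rewrite -mulrA -powRD_gt0// subrK powRr1// ltW.
  apply: total; first exact/measurable_EFinP.
  - by move=> s; rewrite lee_fin.
  - by rewrite mulr_ge0// powR_ge0.
  move=> s; rewrite lee_fin /v; case: ifP => [h|_]; last by rewrite !mulr_ge0// powR_ge0.
  by rewrite -mulrA ler_wpM2l ?powR_ge0// powR_split_large// ltW.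
have sq (y : R) : y ^+ 2 = `|y| `^ 2.
  by rewrite powR_mulrn// real_normK// num_real.
have I2v s : (\int[mX]_x (g2 (x, s) ^+ 2)%:E <= (v s ^+ 2)%:E)%E.
  have [h|h] := ltP c (phi s); last first.
    rewrite integral0_eq ?lee_fin ?sqr_ge0// => x _.
    by rewrite /g2 /E2/= ltNge h/= if_same expr0n.
  have ph0 : 0 < phi s by exact: lt_trans h.
  have -> : v s ^+ 2 = (tau * phi s) `^ (2 - p) * phi s `^ p.
    rewrite /v h exprMn powRM// ?(ltW tau0)// -mulrA -powRD_gt0// subrK powR_mulrn//.
    by congr (_ * _); rewrite -powR_mulrn ?powR_ge0// -powRrM; congr (_ `^ _); field.
  apply: slice => //.
  - by apply: measurable_funX; exact: (measurableT_comp mg2 (pair2_measurable s)).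
  - by move=> x; exact: sqr_ge0.
  - exact: powR_ge0.
  move=> x; rewrite /g2; case: ifP => [_|]; first by rewrite expr0n mulr_ge0// powR_ge0.
  rewrite /E1/E2/= h => /negbT; rewrite -leNgt /m (max_idPl (ltW h)) => gt.
  by rewrite sq powR_split_small// ?mulr_gt0// ltW.
have I3 : (\int[mZ]_z (g3 z ^+ 2)%:E <= (tau `^ (2 - p) * c ^+ 2)%:E)%E.
  pose u z := (g3 z ^+ 2)%:E.
  have mu' : measurable_fun setT u by apply/measurable_EFinP; exact: measurable_funX.
  have u0 z : (0 <= u z)%E by rewrite lee_fin sqr_ge0.
  rewrite [leLHS](@fubini_tonelli2 _ _ _ _ _ mX mu u mu' u0) /fubini_G.
  have -> : tau `^ (2 - p) * c ^+ 2 = (tau `^ (2 - p) * c `^ (2 - q)) * c `^ q.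
    by rewrite -mulrA -powRD_gt0// subrK powR_mulrn// ltW.
  apply: total.
  - exact: (@measurable_fun_fubini_tonelli_G _ _ _ _ _ mX u mu' u0).
  - by move=> s; exact: integral_ge0.
  - by rewrite mulr_ge0// powR_ge0.
  move=> s; have [h|h] := ltP c (phi s).
    rewrite integral0_eq ?lee_fin ?mulr_ge0 ?powR_ge0// => x _.
    by rewrite /u /g3 /E2/= h if_same expr0n.
  (* Where phi <= c the height is tau c, and phi^p <= c^(p-q) phi^q passes to the exponent q. *)
  apply: (@le_trans _ _ ((tau * c) `^ (2 - p) * phi s `^ p)%:E).
    apply: slice => //.
    - by apply: measurable_funX; exact: (measurableT_comp mg3 (pair2_measurable s)).
    - by move=> x; exact: sqr_ge0.
    - exact: powR_ge0.
    move=> x; rewrite /g3; case: ifP => [_|]; first by rewrite expr0n mulr_ge0// powR_ge0.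
    rewrite /E1 /E2/= [c < _]ltNge h/= => /negbT; rewrite -leNgt /m (max_idPr h) => gt.
    by rewrite sq powR_split_small// ?mulr_gt0// ltW.
  rewrite lee_fin powRM ?(ltW tau0) ?(ltW c0)// -!mulrA ler_wpM2l ?powR_ge0//.
  have -> : c `^ (2 - q) = c `^ (2 - p) * c `^ (p - q) by rewrite -powRD_gt0// addrA subrK.
  by rewrite -mulrA ler_wpM2l ?powR_ge0// powR_split_small.
apply: le_trans (degree_energyD3 k A n0 B t etrig f1 f2 f3 gE) _.
have sqle (I : \bar R) (K y : R) : 0 <= K -> 0 <= y -> (0 <= I)%E -> (I <= y%:E)%E ->
    (K%:E * (I * I) <= (K * y ^+ 2)%:E)%E.
  move=> K0 y0 I0 Iy; rewrite EFinM expr2 EFinM; apply: lee_wpmul2l; first by rewrite lee_fin.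
  exact: lee_pmul.
have hs0 : 0 <= hermite_sum_const n k :> R.
  by rewrite /hermite_sum_const mulr_ge0// ?exprn_ge0// ltW// ladder_gt0.
have bb0 : 0 <= 2 * b by rewrite pmulr_rge0// ltW.
have T1 : (degree_energy k A B e t g1 <=
    (2 * b * (b `^ (n%:R / 2) * hermite_sum_const n k) * (tau `^ (1 - p) * c) ^+ 2)%:E)%E.
  apply: le_trans (degree_energy_L1 n0 uA Ak t B0 etrig mg1) _; apply: sqle => //.
  - by apply: mulr_ge0 => //; apply: mulr_ge0 => //; exact: powR_ge0.
  - by rewrite mulr_ge0 ?powR_ge0 ?(ltW c0).
  - exact: integral_ge0.
have T2 : (degree_energy k A B e t g2 <= (2 * b * (tau `^ (1 - p / 2) * c) ^+ 2)%:E)%E.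
  apply: le_trans (degree_energy_L1L2 k n0 uA t B0 etrig f2 mv v0 I2v) _; apply: sqle => //.
  - by rewrite mulr_ge0 ?powR_ge0 ?(ltW c0).
  - by apply: integral_ge0 => s _; rewrite lee_fin.
have T3 : (degree_energy k A B e t g3 <=
    (plancherel_const B / (2 * k + n)%:R * (tau `^ (2 - p) * c ^+ 2))%:E)%E.
  apply: le_trans (degree_energy_L2 k n0 uA t B0 etrig f3) _.
  rewrite [leRHS]EFinM; apply: lee_wpmul2l => //; rewrite lee_fin divr_ge0//.
  rewrite /plancherel_const mulr_ge0 ?pi_ge0//; apply: addr_ge0.
    by rewrite mulr_ge0// ltW.
  by rewrite divr_ge0 ?sqr_ge0// ltW.
apply: (@le_trans _ _ (3%:E *
  ((2 * b * (b `^ (n%:R / 2) * hermite_sum_const n k) * (tau `^ (1 - p) * c) ^+ 2)%:E +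
   (2 * b * (tau `^ (1 - p / 2) * c) ^+ 2)%:E +
   (plancherel_const B / (2 * k + n)%:R * (tau `^ (2 - p) * c ^+ 2))%:E))%E).
  by apply: lee_wpmul2l; rewrite ?lee_fin//; apply: leeD => //; exact: leeD.
rewrite -!EFinD -EFinM lee_fin le_eqVlt; apply/orP; left; apply/eqP; ring.
Qed.

End MixedNormSplit.

(** * Powers of N and their summation over the degree *)

Section DegreeSummation.
Context {R : realType}.
Implicit Types (eta p B x : R).

(** A discrete form of the integral test: (1 - 1/x)^(-eta) >= 1 + eta/x, from exp y >= 1 + y and
    ln(1 - 1/x) <= -1/x. *)
Lemma powR_inv_telescope x eta : 1 < x -> 0 < eta ->
  x `^ (- (1 + eta)) <= eta^-1 * ((x - 1) `^ (- eta) - x `^ (- eta)).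
Proof.
move=> x1 eta0; have x0 : 0 < x by exact: lt_trans x1.
have y0 : 0 < x - 1 by rewrite subr_gt0.
rewrite ler_pdivlMl//.
have -> : (x - 1) `^ (- eta) = x `^ (- eta) * ((x - 1) / x) `^ (- eta).
  rewrite -powRM ?divr_ge0 ?(ltW y0) ?(ltW x0)//; congr (_ `^ _); field.
  by rewrite gt_eqF.
have -> : x `^ (- (1 + eta)) = x `^ (- eta) * x^-1.
  by rewrite opprD addrC powRD_gt0// powR_inv1// ltW.
rewrite -[X in _ * _ - X]mulr1 -mulrBr mulrCA ler_wpM2l ?powR_ge0//.
rewrite lerBrDl /powR gt_eqF ?divr_gt0//.
apply: le_trans (expR_ge1Dx _); rewrite lerD2l mulNr -mulrN ler_wpM2l ?(ltW eta0)//.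
rewrite lerNr; have -> : (x - 1) / x = 1 + - x^-1 by rewrite mulrBl divff ?gt_eqF// mul1r.
by apply: le_ln1Dx; rewrite ltrNl opprK invf_lt1.
Qed.

Lemma sum_powR_inv_le m eta : 0 < eta ->
  \sum_(0 <= k < m) (k.+1%:R : R) `^ (- (1 + eta)) <= 1 + eta^-1.
Proof.
move=> eta0; case: m => [|m]; first by rewrite big_nil addr_ge0// invr_ge0 ltW.
apply: (@le_trans _ _ (1 + eta^-1 * (1 - m.+1%:R `^ (- eta)))); last first.
  by rewrite lerD2l ler_piMr ?invr_ge0 ?(ltW eta0)// gerBl powR_ge0.
elim: m => [|m IH]; first by rewrite big_nat1 !powR1 subrr mulr0 addr0.
rewrite big_nat_recr//=; apply: le_trans (lerD IH _) _.
  by apply: powR_inv_telescope => //; rewrite ltr1n.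
rewrite -addrA lerD2l -mulrDr ler_wpM2l ?invr_ge0 ?(ltW eta0)//.
by rewrite -[m.+2%:R in X in _ + (X - _)]natr1 addrK addrA subrK.
Qed.

Definition degree_decay p : R := (2 - p) / (4 * p).

(** The factor 3 comes from squaring a sum of three pieces; the summands are the constants of the
    L^1, L^1_s L^2_x and L^2 bounds without their powers of N. The root of 2 comes from [ladder k]
    <= sqrt(2N). *)
Definition energy_const n B : R :=
  3 * (2 * B * (B `^ (n%:R / 2) * (8 * Num.sqrt 2 ^+ n.-1)) + 2 * B + plancherel_const B).

Lemma energy_const_ge0 n B : 0 < B -> 0 <= energy_const n B.
Proof.
move=> B0; rewrite /energy_const /plancherel_const; apply: mulr_ge0 => //; apply: addr_ge0.
  by rewrite addr_ge0// !mulr_ge0 ?powR_ge0 ?exprn_ge0 ?sqrtr_ge0 ?(ltW B0).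
rewrite mulr_ge0 ?pi_ge0//; apply: addr_ge0; first by rewrite mulr_ge0// ltW.
by rewrite divr_ge0 ?sqr_ge0// ltW.
Qed.

(* The exponent -1/(4p) equalizes the decay in N of the three pieces. *)
Lemma energy_const_optimal n k p B (N := (2 * k + n)%:R : R) (b := B / N)
  (tau := N `^ (- (4 * p)^-1)) : (0 < n)%N -> 1 <= p -> 0 < B ->
  3 * (2 * b * (b `^ (n%:R / 2) * hermite_sum_const n k) * tau `^ (1 - p) ^+ 2 +
       2 * b * tau `^ (1 - p / 2) ^+ 2 + plancherel_const B / N * tau `^ (2 - p))
  <= energy_const n B * N `^ (- (1 + degree_decay p)).
Proof.
move=> n0 p1 B0.
have N0 : 0 < N by rewrite ltr0n addn_gt0 n0 orbT.
have p0 : 0 < p by exact: lt_le_trans p1.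
set P := N `^ _.
have tE r : tau `^ r = N `^ (- (4 * p)^-1 * r) by rewrite powRrM.
have sqE r : (N `^ r) ^+ 2 = N `^ (r * 2) by rewrite -powR_mulrn ?powR_ge0// -powRrM.
have NV : N^-1 = N `^ (-1) by rewrite powR_inv1// ltW.
have e2 : N^-1 * tau `^ (1 - p / 2) ^+ 2 = P.
  rewrite tE sqE NV -powRD_gt0//; congr (_ `^ _); rewrite /degree_decay; field.
  by rewrite gt_eqF.
have e3 : N^-1 * tau `^ (2 - p) = P.
  rewrite tE NV -powRD_gt0//; congr (_ `^ _); rewrite /degree_decay; field.
  by rewrite gt_eqF.
have Nn : (2 * k + 1)%:R <= N by rewrite ler_nat leq_add2l.
have hs : hermite_sum_const n k <= 8 * Num.sqrt 2 ^+ n.-1 * (N `^ (4^-1) * N `^ (n.-1%:R / 2)).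
  have -> : N `^ (4^-1) = Num.sqrt (Num.sqrt N).
    by rewrite -powR12_sqrt ?sqrtr_ge0// -powR12_sqrt ?(ltW N0)// -powRrM; congr (_ `^ _); field.
  have -> : N `^ (n.-1%:R / 2) = Num.sqrt N ^+ n.-1.
    by rewrite -powR12_sqrt ?(ltW N0)// -powR_mulrn ?powR_ge0// -powRrM mulrC.
  rewrite /hermite_sum_const mulrACA -exprMn -sqrtrM// -!mulrA ler_wpM2l//.
  rewrite ler_pM ?sqrtr_ge0 ?exprn_ge0 ?(ltW (ladder_gt0 _))//.
    by rewrite !ler_wsqrtr.
  rewrite lerXn2r ?nnegrE ?sqrtr_ge0 ?(ltW (ladder_gt0 _))// /ladder ler_wsqrtr//.
  rewrite ler_wpM2l// ler_nat; apply: leq_trans (leq_add (leqnn _) n0).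
  by rewrite addn1 ltnS leq_pmull.
(* Without tau the exponents add up to -1 - n/2 + 1/4 + (n-1)/2 = -5/4. *)
have e1 : N^-1 * ((N^-1) `^ (n%:R / 2) * (N `^ (4^-1) * N `^ (n.-1%:R / 2))) * tau `^ (1 - p) ^+ 2 = P.
  have -> : (N^-1) `^ (n%:R / 2) = N `^ (- (n%:R / 2)) by rewrite NV -powRrM mulN1r.
  rewrite tE sqE NV -!powRD_gt0//; congr (_ `^ _); rewrite /degree_decay.
  have -> : n.-1%:R = n%:R - 1 :> R by rewrite -subn1 natrB.
  by field; rewrite gt_eqF.
rewrite /energy_const -[leRHS]mulrA ler_wpM2l//.
rewrite [leRHS]mulrDl [X in _ <= X + _]mulrDl; apply: lerD; [apply: lerD|]; last 2 first.
- by rewrite /b -e2 le_eqVlt; apply/orP; left; apply/eqP; ring.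
- by rewrite -e3 mulrA.
rewrite -e1; have -> : b `^ (n%:R / 2) = B `^ (n%:R / 2) * N^-1 `^ (n%:R / 2).
  by rewrite powRM ?invr_ge0 ?(ltW B0) ?(ltW N0).
rewrite [leRHS](_ : _ = 2 * b * (B `^ (n%:R / 2) * N^-1 `^ (n%:R / 2) *
   (8 * Num.sqrt 2 ^+ n.-1 * (N `^ 4^-1 * N `^ (n.-1%:R / 2)))) * tau `^ (1 - p) ^+ 2); last by rewrite /b; ring.
have b2 : 0 <= 2 * b by rewrite pmulr_rge0// divr_ge0// ltW.
rewrite ler_wpM2r ?sqr_ge0//; apply: ler_wpM2l => //.
by rewrite ler_wpM2l// mulr_ge0 ?powR_ge0.
Qed.

End DegreeSummation.

Section DegreeEnergyBound.
Context {R : realType}.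
Local Notation mR := (measurableTypeR R).
Local Notation mu := (@lebesgue_measure R).

(** The truncation uses negative powers of c and so needs c > 0; a vanishing norm is reached by
    letting positive levels tend to 0. *)
Lemma le_of_gt0_scaling (X : \bar R) (K c : R) : 0 <= K -> 0 <= c ->
  (forall c', 0 < c' -> c <= c' -> (X <= (K * c' ^+ 2)%:E)%E) -> (X <= (K * c ^+ 2)%:E)%E.
Proof.
move=> K0 c0 H; have [cp|] := ltP 0 c; first exact: H.
move=> c0'; have {}H c' : 0 < c' -> (X <= (K * c' ^+ 2)%:E)%E.
  by move=> h; apply: H => //; exact: le_trans c0' (ltW h).
have -> : c = 0 by apply/eqP; rewrite eq_le c0' c0.
rewrite expr0n mulr0; apply/lee_addgt0Pr => d d0; rewrite add0e.
have K1 : 0 < K + 1 by rewrite ltr_wpDl.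
have h0 : 0 < Num.sqrt (d / (K + 1)) by rewrite sqrtr_gt0 divr_gt0.
apply: le_trans (H _ h0) _.
rewrite lee_fin sqr_sqrtr ?divr_ge0 ?(ltW d0) ?(ltW K1)// mulrCA ler_piMr ?(ltW d0)//.
by rewrite ler_pdivrMr// mul1r lerDl.
Qed.

Lemma degree_energy_le n k (A : seq (n.-tuple nat)) (B : R) (e : R -> R) (t p q : R)
    (g : n.-tuple mR * mR -> R) (phi : mR -> R) (c : R) :
  (0 < n)%N -> uniq A -> (forall a, a \in A -> (\sum_(j < n) tnth a j)%N = k) ->
  0 < B -> e = cos \/ e = sin -> 1 <= q -> q <= p -> p < 2 ->
  fully_integrable (lebesgue_tuple n) mu g -> measurable_fun setT phi -> (forall s, 0 <= phi s) ->
  (forall s, \int[lebesgue_tuple n]_x (`|g (x, s)| `^ p)%:E = (phi s `^ p)%:E)%E ->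
  0 <= c -> (\int[mu]_s (phi s `^ q)%:E <= (c `^ q)%:E)%E ->
  (degree_energy k A B e t g <=
    (energy_const n B * (2 * k + n)%:R `^ (- (1 + degree_decay p)) * c ^+ 2)%:E)%E.
Proof.
move=> n0 uA Ak B0 etrig q1 qp p2 fg mphi phi0 phiE c0 phic.
have EC0 := energy_const_ge0 n B0.
apply: le_of_gt0_scaling => //; first by rewrite mulr_ge0// powR_ge0.
move=> c' c'0 cc'.
have phic' : (\int[mu]_s (phi s `^ q)%:E <= (c' `^ q)%:E)%E.
  apply: le_trans phic _; rewrite lee_fin ge0_ler_powR ?nnegrE//.
  - exact: le_trans q1.
  - exact: ltW.
have N0 : 0 < (2 * k + n)%:R :> R by rewrite ltr0n addn_gt0 n0 orbT.
have tau0 : 0 < ((2 * k + n)%:R : R) `^ (- (4 * p)^-1) by rewrite powR_gt0.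
apply: le_trans (degree_energy_split n0 uA Ak t B0 etrig q1 qp p2 fg mphi phi0 phiE c'0 phic' tau0) _.
rewrite lee_fin ler_wpM2r ?sqr_ge0//; apply: energy_const_optimal => //.
exact: le_trans qp.
Qed.

End DegreeEnergyBound.

Lemma measurable_fun_countable d d' (T : measurableType d) (U : measurableType d') (I : countType)
  (idx : T -> I) (h : I -> U) : (forall i, measurable (idx @^-1` [set i])) ->
  measurable_fun setT (h \o idx).
Proof.
move=> midx _ Y mY; rewrite setTI.
rewrite (_ : _ @^-1` _ = \bigcup_(i in [set: I]) (if h i \in Y then idx @^-1` [set i] else set0)).
  apply: countable_bigcupT_measurable; first exact: countableP.
  by move=> i; case: ifP.
apply/seteqP; split => [w /= Yw|w [i _]].
  by exists (idx w) => //; rewrite mem_set.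
by case: ifP => // /set_mem Yi /= ->.
Qed.

(** * Schwartz functions and mixed norms *)

Section ContinuousRow.
Context {R : realType} (m : nat).

(** Rounding every coordinate down to the grid of mesh 1/(k+1) gives functions with countably many
    values, which converge pointwise by continuity of g. *)
Lemma measurable_continuous_row d (T : measurableType d) (g : 'rV[R]_m -> R) (phi : T -> 'rV[R]_m) :
  continuous g -> (forall j, measurable_fun setT (fun w => phi w 0 j)) ->
  measurable_fun setT (g \o phi).
Proof.
move=> cg mphi.
pose idx k w := [ffun j => Num.floor (k.+1%:R * phi w 0 j)].
pose grid k (i : {ffun 'I_m -> int}) : 'rV[R]_m := \row_j ((i j)%:~R / k.+1%:R).
apply: (@measurable_fun_cvg _ _ _ _ (fun k w => g (grid k (idx k w)))).
  move=> k; apply: (@measurable_fun_countable _ _ _ _ _ (idx k) (fun i => g (grid k i))) => i.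
  rewrite (_ : _ @^-1` _ = \bigcap_(j in [set: 'I_m])
      ((fun w => k.+1%:R * phi w 0 j) @^-1` `[(i j)%:~R, (i j + 1)%:~R[)).
    apply: fin_bigcap_measurable => // j _; rewrite -[X in measurable X]setTI.
    by apply: measurable_funM => //; exact: measurable_itv.
  apply/seteqP; split => w /=.
    by move=> <- j _ /=; rewrite in_itv/= ffunE floor_itv.
  by move=> H; apply/ffunP => j; rewrite ffunE; apply/eqP; rewrite floor_eq; have /= := H j I; rewrite in_itv.
move=> w _; apply: (@cvg_comp _ _ _ (fun k => grid k (idx k w)) g _ (nbhs (phi w))); last exact: cg.
apply/cvg_ballP => eps eps0.
have := @near_infty_natSinv_lt R (PosNum eps0); apply: filterS => k /= keps.
split => // i j; rewrite mxE ffunE ord1 /ball/= distrC.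
have k0 : 0 < k.+1%:R :> R by [].
apply: le_lt_trans keps; rewrite -(@ler_pM2r _ k.+1%:R)// mulVf ?gt_eqF//.
rewrite -[X in _ * X](gtr0_norm k0) -normrM mulrBl divfK ?gt_eqF//.
have := floor_itv (k.+1%:R * phi w 0 j); rewrite intrD [phi _ _ _ * _]mulrC.
set y := k.+1%:R * _; set z := (Num.floor y)%:~R => /andP[zy yz].
by rewrite ler_norml; apply/andP; split; rewrite mulr1z in yz; lra.
Qed.

(** The product of the 1 + z_j^2 expands over subsets of coordinates into monomials with exponents 0
    or 2, each controlled by a Schwartz seminorm without derivatives. *)
Lemma schwartz_decay (g : 'rV[R]_m -> R) : real_schwartz g ->
  exists2 C, 0 <= C & forall z, `|g z| <= C * \prod_(j < m) (1 + z 0 j ^+ 2)^-1.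
Proof.
move=> [_ /(_ _ [::]) H].
pose b (f : {ffun 'I_m -> bool}) j := (2 * f j)%N.
have /choice[C HC] : forall f, exists C : R, forall z : 'rV[R]_m,
    `|(\prod_(j < m) z 0 j ^+ b f j) * g z| <= C by move=> f; exact: (H (b f)).
exists (\sum_f C f).
  by apply: sumr_ge0 => f _; apply: le_trans (HC f 0); exact: normr_ge0.
move=> z; have P0 : 0 < \prod_(j < m) (1 + z 0 j ^+ 2).
  by apply: prodr_gt0 => j _; rewrite ltr_pwDl// sqr_ge0.
rewrite prodfV ler_pdivlMr// -[X in _ * X](gtr0_norm P0) -normrM mulrC.
have -> : \prod_(j < m) (1 + z 0 j ^+ 2) = \sum_(f : {ffun 'I_m -> bool}) \prod_(j < m) z 0 j ^+ b f j.
  rewrite -(bigA_distr_bigA (fun j (c : bool) => z 0 j ^+ (2 * c))).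
  by apply: eq_bigr => j _; rewrite big_bool/= muln1 muln0 expr0 addrC.
rewrite mulr_suml; apply: le_trans (ler_norm_sum _ _ _) _.
by apply: ler_sum => f _; exact: HC.
Qed.

End ContinuousRow.

(** * Functions dominated by a product weight and their mixed norms *)

Section MixedNorm.
Context {R : realType} (n : nat).
Local Notation mR := (measurableTypeR R).
Local Notation X := (n.-tuple mR).
Local Notation mu := (@lebesgue_measure R).
Local Notation mX := (lebesgue_tuple n : {sigma_finite_measure set X -> \bar R}).
Local Notation mZ := (sfprod mX mu).

Let D (y : R) : R := (1 + y ^+ 2)^-1.
Let DX (x : X) : R := \prod_(j < n) D (tnth x j).

Let D_gt0 y : 0 < D y.
Proof. by rewrite invr_gt0 oneDsqr_gt0. Qed.

Let D_le1 y : D y <= 1.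
Proof. by rewrite invf_le1 ?oneDsqr_gt0// lerDl sqr_ge0. Qed.

Let iD : mu.-integrable setT (EFin \o D).
Proof.
apply: le_integrable (@integrable_inv_oneDsqr R 1) => //.
  by apply/measurable_EFinP; exact: measurable_inv_oneDsqr.
by move=> y _ /=; rewrite div1r.
Qed.

Let DX_ge0 x : 0 <= DX x.
Proof. by apply: prodr_ge0 => j _; exact: ltW. Qed.

Let DX_le1 x : DX x <= 1.
Proof. by apply: prodr_ile1 => j _; rewrite D_le1 ltW. Qed.

Let iDX : mX.-integrable setT (EFin \o DX).
Proof. exact: (lebesgue_tuple_prod (fun=> iD)).1. Qed.

(** The only trace of the Schwartz class kept from here on: it is stable under bounded measurable
    factors, such as the transform kernel, and makes every slice integrable. *)
Definition dominated (w : X * (mR * mR) -> R) := measurable_fun setT w /\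
  exists2 C, 0 <= C & forall x t s, `|w (x, (t, s))| <=
    C * (\prod_(j < n) (1 + tnth x j ^+ 2)^-1 * ((1 + t ^+ 2)^-1 * (1 + s ^+ 2)^-1)).

Definition time_slice (w : X * (mR * mR) -> R) (t : R) (z : X * mR) : R := w (z.1, (t, z.2)).

Lemma dominatedM (w g : X * (mR * mR) -> R) (K : R) : dominated w -> measurable_fun setT g -> (forall z, `|g z| <= K) ->
  dominated (fun z => w z * g z).
Proof.
move=> [mw [C C0 wC]] mg gK; split; first exact: measurable_funM.
have K0 : 0 <= K by apply: le_trans (gK (point, (0, 0))); exact: normr_ge0.
exists (C * K); first exact: mulr_ge0.
move=> x t s; rewrite normrM mulrAC; apply: ler_pM => //; exact: wC.
Qed.

Let measurable_slice_map (t : R) : measurable_fun setT (fun z : X * mR => (z.1, (t, z.2)) : X * (mR * mR)).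
Proof.
apply: measurable_fun_pair => //; apply: measurable_fun_pair => //.
Qed.

Lemma time_slice_fully_integrable w t : dominated w -> fully_integrable mX mu (time_slice w t).
Proof.
move=> [mw [C C0 wC]].
have fi : fully_integrable mX mu (fun z => (C * D t) * (DX z.1 * D z.2)).
  by apply: fully_integrableZl; exact: fully_integrable_tensor.
apply: le_fully_integrable _ _ fi.
- exact: (measurableT_comp mw (measurable_slice_map t)).
- move=> [x s]; apply: le_trans (wC x t s) _ => /=.
  apply: le_trans (ler_norm _); rewrite le_eqVlt; apply/orP; left; apply/eqP.
  by rewrite -/(D t) -/(D s) -/(DX x); ring.
Qed.

(** Brings t, the middle variable of the transform, to the outside, where Minkowski's inequality
    needs it. The inner s-integral [J] again has a product majorant, so Fubini applies in (x, t). *)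
Lemma Rintegral_time_slice w : dominated w ->
  \int[mX]_x \int[mu]_t \int[mu]_s w (x, (t, s)) = \int[mu]_t \int[mZ]_z time_slice w t z.
Proof.
move=> dw; have [mw [C C0 wC]] := dw.
pose J (y : X * mR) := \int[mu]_s w (y.1, (y.2, s)).
have mJ : measurable_fun setT J.
  apply: (@measurable_param_Rintegral _ _ _ _ _ mu (fun v : mR * (X * mR) => w (v.2.1, (v.2.2, v.1)))).
  apply: (measurableT_comp mw); apply: measurable_fun_pair; first exact: measurableT_comp.
  by apply: measurable_fun_pair => //; exact: measurableT_comp.
have JC y : `|J y| <= `|(C * \int[mu]_s D s) * (DX y.1 * D y.2)|.
  apply: le_trans (ler_norm _).
  have iw : mu.-integrable setT (fun s => (w (y.1, (y.2, s)))%:E).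
    by have [_ + _] := time_slice_fully_integrable y.2 dw; exact.
  apply: le_trans (le_normr_Rintegral measurableT iw) _.
  rewrite -mulrA [X in _ <= _ * X]mulrC mulrA -RintegralZl//; apply: le_Rintegral => //.
  - exact: integrable_norm.
  - exact: (integrableZl measurableT _ iD).
  by move=> s _; rewrite -!mulrA; exact: wC.
have fJ : fully_integrable mX mu J.
  apply: le_fully_integrable mJ JC _.
  by apply: fully_integrableZl; exact: fully_integrable_tensor.
rewrite -[LHS](Rintegral_fubini12 fJ) (Rintegral_fubini21 fJ).
by apply: eq_Rintegral => t _; rewrite (Rintegral_fubini12 (time_slice_fully_integrable t dw)).
Qed.

Lemma integrable_time_slice w : dominated w ->
  mu.-integrable setT (EFin \o (fun t => \int[mZ]_z time_slice w t z)).
Proof.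
move=> dw; have [mw [C C0 wC]] := dw.
have fD : fully_integrable mX mu (fun z => DX z.1 * D z.2) by exact: fully_integrable_tensor.
have mI : measurable_fun setT (fun t => \int[mZ]_z time_slice w t z).
  apply: (@measurable_param_Rintegral _ _ _ _ _ mZ (fun v : (X * mR) * mR => w (v.1.1, (v.2, v.1.2)))).
  apply: (measurableT_comp mw); apply: measurable_fun_pair; first exact: measurableT_comp.
  by apply: measurable_fun_pair => //; exact: measurableT_comp.
apply: (@le_integrable _ _ _ mu setT measurableT _ (fun t => (C * (\int[mZ]_z (DX z.1 * D z.2)) * D t)%:E)).
- exact/measurable_EFinP.
- move=> t _; rewrite lee_fin; apply: le_trans (ler_norm _).
  have [iw _ _] := time_slice_fully_integrable t dw.
  apply: le_trans (le_normr_Rintegral measurableT iw) _.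
  have [iD2 _ _] := fully_integrableZl (C * D t) fD.
  rewrite mulrAC -RintegralZl//; last by have [+ _ _] := fD.
  apply: le_Rintegral => //; first exact: integrable_norm.
  move=> [x s] _; apply: le_trans (wC x t s) _.
  by rewrite le_eqVlt; apply/orP; left; apply/eqP; rewrite -/(D t) -/(D s) -/(DX x)/=; ring.
- exact: (integrableZl measurableT _ iD).
Qed.

Lemma dominatedD w1 w2 : dominated w1 -> dominated w2 -> dominated (fun z => w1 z + w2 z).
Proof.
move=> [m1 [C1 C10 w1C]] [m2 [C2 C20 w2C]]; split; first exact: measurable_funD.
exists (C1 + C2); first exact: addr_ge0.
by move=> x t s; rewrite mulrDl; apply: le_trans (ler_normD _ _) (lerD (w1C _ _ _) (w2C _ _ _)).
Qed.

Lemma Rintegral_tripleD w1 w2 : dominated w1 -> dominated w2 ->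
  \int[mX]_x \int[mu]_t \int[mu]_s (w1 (x, (t, s)) + w2 (x, (t, s))) =
  \int[mX]_x \int[mu]_t \int[mu]_s w1 (x, (t, s)) +
  \int[mX]_x \int[mu]_t \int[mu]_s w2 (x, (t, s)).
Proof.
move=> d1 d2.
rewrite [X in _ = X + _](Rintegral_time_slice d1) [X in _ = _ + X](Rintegral_time_slice d2).
rewrite [LHS](Rintegral_time_slice (dominatedD d1 d2)).
rewrite -RintegralD//; [|exact: integrable_time_slice..].
apply: eq_Rintegral => t _; have [i1 _ _] := time_slice_fully_integrable t d1.
have [i2 _ _] := time_slice_fully_integrable t d2.
by rewrite -RintegralD.
Qed.

Section Norms.
Variables p q : R.
Hypotheses (q1 : 1 <= q) (qp : q <= p).

Definition inner_norm (w : X * (mR * mR) -> R) (t s : R) : R :=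
  (\int[mX]_x (`|w (x, (t, s))| `^ p)) `^ p^-1.

Definition outer_norm (w : X * (mR * mR) -> R) (t : R) : R :=
  (\int[mu]_s (inner_norm w t s `^ q)) `^ q^-1.

Let p1 : 1 <= p. Proof. exact: le_trans qp. Qed.
Let p0 : 0 < p. Proof. exact: lt_le_trans p1. Qed.
Let q0 : 0 < q. Proof. exact: lt_le_trans q1. Qed.

Let powR_le1 (y r : R) : 1 <= r -> 0 <= y -> y <= 1 -> y `^ r <= y.
Proof.
move=> r1 y0 y1; have := @powR_split_small R r 1 1 y r1 ltr01 y0 ltr01 y1.
by rewrite powR1 mul1r powRr1.
Qed.

Let measurable_mod (w : X * (mR * mR) -> R) : measurable_fun setT w ->
  measurable_fun setT (fun z => `|w z| `^ p).
Proof.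
by move=> mw; apply: (measurableT_comp (measurable_powR p)); exact: measurableT_comp.
Qed.

Lemma inner_norm_ge0 w t s : 0 <= inner_norm w t s.
Proof. exact: powR_ge0. Qed.

Lemma outer_norm_ge0 w t : 0 <= outer_norm w t.
Proof. exact: powR_ge0. Qed.

Lemma measurable_inner_norm w : measurable_fun setT w ->
  measurable_fun setT (fun y : mR * mR => inner_norm w y.1 y.2).
Proof.
move=> mw; apply: (measurableT_comp (measurable_powR _)).
apply: (@measurable_param_Rintegral _ _ _ _ _ mX (fun z : X * (mR * mR) => `|w (z.1, (z.2.1, z.2.2))| `^ p)).
rewrite (_ : (fun _ => _) = fun z => `|w z| `^ p); first exact: measurable_mod.
by apply/funext => -[x [t s]].
Qed.

Lemma measurable_outer_norm w : measurable_fun setT w -> measurable_fun setT (outer_norm w).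
Proof.
move=> mw; apply: (measurableT_comp (measurable_powR _)).
apply: (@measurable_param_Rintegral _ _ _ _ _ mu (fun y : mR * mR => inner_norm w y.2 y.1 `^ q)).
apply: (measurableT_comp (measurable_powR q)).
exact: (measurable_fun_comp2 (measurable_inner_norm mw) measurable_snd measurable_fst).
Qed.

(** The weight in x is at most 1, so its power p >= 1 is at most itself and stays integrable; the
    weight in t is discarded. *)
Let pow_bound (w : X * (mR * mR) -> R) C t s x : 0 <= C ->
  `|w (x, (t, s))| <= C * (DX x * (D t * D s)) ->
  `|w (x, (t, s))| `^ p <= C `^ p * D s `^ p * DX x.
Proof.
move=> C0 H; apply: (@le_trans _ _ ((C * (DX x * D s)) `^ p)).
  apply: ge0_ler_powR; rewrite ?nnegrE ?(ltW p0)//.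
    by rewrite !mulr_ge0// ltW.
  apply: le_trans H _; rewrite ler_wpM2l// ler_wpM2l//.
  by rewrite ler_piMl// ltW.
rewrite powRM ?mulr_ge0 ?(ltW (D_gt0 _))// powRM ?(ltW (D_gt0 _))//.
rewrite -mulrA ler_wpM2l ?powR_ge0// mulrC ler_wpM2l ?powR_ge0//.
by apply: powR_le1.
Qed.

Lemma inner_norm_integrable w t s : dominated w ->
  mX.-integrable setT (fun x => (`|w (x, (t, s))| `^ p)%:E).
Proof.
move=> [mw [C C0 wC]].
apply: (@le_integrable _ _ _ mX setT measurableT _ (fun x => (C `^ p * D s `^ p * DX x)%:E)).
- by apply/measurable_EFinP; exact: (measurableT_comp (measurable_mod mw) (pair2_measurable (t, s))).
- move=> x _ /=; rewrite lee_fin ger0_norm ?powR_ge0//; apply: le_trans (ler_norm _).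
  exact: pow_bound (wC _ _ _).
- exact: (integrableZl measurableT _ iDX).
Qed.

Lemma inner_normE w t s : dominated w ->
  (\int[mX]_x (`|w (x, (t, s))| `^ p)%:E = (inner_norm w t s `^ p)%:E)%E.
Proof.
move=> dw; rewrite /inner_norm -powRrM mulVf ?gt_eqF// powRr1; last first.
  by apply: Rintegral_ge0 => x _; exact: powR_ge0.
rewrite fineK//; exact: integrable_fin_num (inner_norm_integrable t s dw).
Qed.

Lemma le_inner_norm w f t s : dominated w -> dominated f -> (forall z, `|w z| <= `|f z|) ->
  inner_norm w t s <= inner_norm f t s.
Proof.
move=> dw df wf; apply: ge0_ler_powR; [by rewrite invr_ge0 ltW|rewrite nnegrE..|].
- by apply: Rintegral_ge0 => x _; exact: powR_ge0.
- by apply: Rintegral_ge0 => x _; exact: powR_ge0.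
apply: le_Rintegral; [by []|exact: inner_norm_integrable|exact: inner_norm_integrable|].
by move=> x _; apply: ge0_ler_powR; rewrite ?nnegrE ?(ltW p0).
Qed.

Lemma outer_norm_integrable w t : dominated w ->
  mu.-integrable setT (fun s => (inner_norm w t s `^ q)%:E).
Proof.
move=> dw; have [mw [C C0 wC]] := dw.
pose K := (C `^ p * \int[mX]_x DX x) `^ p^-1.
have IX0 : 0 <= \int[mX]_x DX x by exact: Rintegral_ge0.
have le_inner s : inner_norm w t s <= K * D s.
  have -> : K * D s = (C `^ p * D s `^ p * \int[mX]_x DX x) `^ p^-1.
    rewrite mulrAC powRM ?mulr_ge0 ?powR_ge0//; congr (_ * _).
    by rewrite -powRrM mulfV ?gt_eqF// powRr1// ltW.
  apply: ge0_ler_powR; rewrite ?nnegrE ?invr_ge0 ?(ltW p0)//.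
  - by apply: Rintegral_ge0 => x _; exact: powR_ge0.
  - by rewrite !mulr_ge0 ?powR_ge0.
  rewrite -RintegralZl//; apply: le_Rintegral => //.
  - exact: inner_norm_integrable.
  - exact: (integrableZl measurableT _ iDX).
  - by move=> x _; exact: pow_bound (wC _ _ _).
apply: (@le_integrable _ _ _ mu setT measurableT _ (fun s => (K `^ q * D s)%:E)).
- apply/measurable_EFinP; apply: (measurableT_comp (measurable_powR q)).
  exact: (measurableT_comp (measurable_inner_norm mw) (pair1_measurable t)).
- move=> s _ /=; rewrite lee_fin ger0_norm ?powR_ge0//; apply: le_trans (ler_norm _).
  apply: (@le_trans _ _ ((K * D s) `^ q)).
    apply: ge0_ler_powR; rewrite ?nnegrE ?inner_norm_ge0 ?(ltW q0)//.
    by rewrite mulr_ge0 ?powR_ge0// ltW.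
  rewrite powRM ?powR_ge0 ?(ltW (D_gt0 _))// ler_wpM2l ?powR_ge0//.
  by apply: powR_le1 => //; exact: ltW.
- exact: (integrableZl measurableT _ iD).
Qed.

Lemma outer_normE w t : dominated w ->
  (\int[mu]_s (inner_norm w t s `^ q)%:E = (outer_norm w t `^ q)%:E)%E.
Proof.
move=> dw; rewrite /outer_norm -powRrM mulVf ?gt_eqF// powRr1; last first.
  by apply: Rintegral_ge0 => x _; exact: powR_ge0.
rewrite fineK//; exact: integrable_fin_num (outer_norm_integrable t dw).
Qed.

(** In the truncation phi must be the exact norm of the slice of w, whereas c need only be an upper
    bound; the modulus of f thus supplies one c for its real and imaginary parts. *)
Lemma le_integral_inner_norm w f t : dominated w -> dominated f ->
  (forall z, `|w z| <= `|f z|) ->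
  (\int[mu]_s (inner_norm w t s `^ q)%:E <= (outer_norm f t `^ q)%:E)%E.
Proof.
move=> dw df wf.
apply: (@le_trans _ _ (\int[mu]_s (inner_norm f t s `^ q)%:E)%E); last by rewrite (outer_normE t df).
have mI h : measurable_fun setT h -> measurable_fun setT (fun s => (inner_norm h t s `^ q)%:E).
  move=> mh; apply/measurable_EFinP; apply: (measurableT_comp (measurable_powR q)).
  exact: (measurableT_comp (measurable_inner_norm mh) (pair1_measurable t)).
apply: ge0_le_integral.
- exact: measurableT.
- by move=> s _; rewrite lee_fin; exact: powR_ge0.
- exact: mI dw.1.
- exact: mI df.1.
- move=> s _; rewrite lee_fin; apply: ge0_ler_powR; first exact: ltW.
  + by rewrite nnegrE; exact: inner_norm_ge0.
  + by rewrite nnegrE; exact: inner_norm_ge0.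
  + exact: le_inner_norm.
Qed.

End Norms.

End MixedNorm.

(** * Minkowski's inequality in t *)

Section Transform.
Context {R : realType} (n k : nat).
Hypothesis n0 : (0 < n)%N.
Local Notation mR := (measurableTypeR R).
Local Notation X := (n.-tuple mR).
Local Notation mu := (@lebesgue_measure R).
Local Notation mX := (lebesgue_tuple n : {sigma_finite_measure set X -> \bar R}).
Local Notation mZ := (sfprod mX mu).
Variables (e : R -> R).
Hypothesis etrig : e = cos \/ e = sin.

Definition degree_transform (a : n.-tuple nat) (l : R) (w : X * (mR * mR) -> R) : R :=
  \int[mu]_t degree_coef k e t a l (time_slice w t).

Lemma measurable_degree_coef_slice a (w : X * (mR * mR) -> R) : measurable_fun setT w ->
  measurable_fun setT (fun y : mR * mR => degree_coef k e y.1 a y.2 (time_slice w y.1)).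
Proof.
move=> mw; apply: (@measurable_param_Rintegral _ _ _ _ _ mZ (fun v : (X * mR) * (mR * mR) =>
  w (v.1.1, (v.2.1, v.1.2)) *
  (e (v.2.2 * v.2.1 + (2 * k + n)%:R * `|v.2.2| * v.1.2) * scaled_hermite a v.2.2 v.1.1))).
have m11 : measurable_fun setT (fun v : (X * mR) * (mR * mR) => v.1.1) by exact: measurableT_comp.
have m12 : measurable_fun setT (fun v : (X * mR) * (mR * mR) => v.1.2) by exact: measurableT_comp.
have m21 : measurable_fun setT (fun v : (X * mR) * (mR * mR) => v.2.1) by exact: measurableT_comp.
have m22 : measurable_fun setT (fun v : (X * mR) * (mR * mR) => v.2.2) by exact: measurableT_comp.
apply: measurable_funM.
  by apply: (measurable_fun_comp2 mw) => //; exact: measurable_fun_pair.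
apply: measurable_funM.
  apply: (measurableT_comp (measurable_trig etrig)); apply: measurable_funD.
    exact: measurable_funM.
  by apply: measurable_funM => //; apply: measurable_funM => //; exact: measurableT_comp.
exact: (measurable_fun_comp2 (measurable_scaled_hermite a)).
Qed.

Lemma measurable_degree_transform a (w : X * (mR * mR) -> R) : measurable_fun setT w ->
  measurable_fun setT (fun l => degree_transform a l w).
Proof.
by move=> mw; exact: (@measurable_param_Rintegral _ _ _ _ _ mu
  (fun y => degree_coef k e y.1 a y.2 (time_slice w y.1)) (measurable_degree_coef_slice a mw)).
Qed.

Lemma dominated_kernel a l (w : X * (mR * mR) -> R) : dominated w ->
  dominated (fun z => w z *
    (e (l * z.2.1 + (2 * k + n)%:R * `|l| * z.2.2) * scaled_hermite a l z.1)).
Proof.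
move=> dw; pose g (z : X * (mR * mR)) :=
  e (l * z.2.1 + (2 * k + n)%:R * `|l| * z.2.2) * scaled_hermite a l z.1.
have mg : measurable_fun setT g.
  apply: measurable_funM; last first.
    exact: (measurableT_comp (measurableT_comp (measurable_scaled_hermite a) (pair1_measurable l)) measurable_fst).
  apply: (measurableT_comp (measurable_trig etrig)); apply: measurable_funD.
    by apply: measurable_funM => //; exact: measurableT_comp.
  by apply: measurable_funM => //; exact: measurableT_comp.
have gK z : `|g z| <= 1 + `|l| `^ (n%:R / 2) * hermite_sum_const n (\sum_(j < n) tnth a j)%N.
  rewrite normrM; apply: le_trans (scaled_hermite_bound n0 a l z.1).
  by rewrite ler_piMl// trig_le1.
exact: (dominatedM dw mg gK).
Qed.

Lemma degree_transformE a l (w : X * (mR * mR) -> R) : dominated w ->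
  \int[mX]_x \int[mu]_t \int[mu]_s
    (w (x, (t, s)) * (e (l * t + (2 * k + n)%:R * `|l| * s) * scaled_hermite a l x)) =
  degree_transform a l w.
Proof. by move=> dw; exact: (Rintegral_time_slice (dominated_kernel a l dw)). Qed.

(** [Minkowski_integral] with t as outer variable; at each t [degree_energy_le] gives a bound whose
    constant is independent of t. *)
Lemma degree_transform_energy (A : seq (n.-tuple nat)) (B p q : R) (w f : X * (mR * mR) -> R) :
  uniq A -> (forall a, a \in A -> (\sum_(j < n) tnth a j)%N = k) ->
  0 < B -> 1 <= q -> q <= p -> p < 2 ->
  dominated w -> dominated f -> (forall z, `|w z| <= `|f z|) ->
  (\sum_(a <- A) \int[mu]_l (\1_(window (B / (2 * k + n)%:R)) l * degree_transform a l w ^+ 2)%:E <=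
    (energy_const n B * (2 * k + n)%:R `^ (- (1 + degree_decay p)))%:E *
    (\int[mu]_t (outer_norm p q f t)%:E * \int[mu]_t (outer_norm p q f t)%:E))%E.
Proof.
move=> uA Ak B0 q1 qp p2 dw df wf.
have p1 : 1 <= p by exact: le_trans qp.
have p0 : 0 < p by exact: lt_le_trans p1.
have q0 : 0 < q by exact: lt_le_trans q1.
have [mw _] := dw; have [mf _] := df.
pose chi l : R := \1_(window (B / (2 * k + n)%:R)) l.
have chi_sqr l : chi l ^+ 2 = chi l.
  by rewrite /chi indicE; case: (_ \in _); rewrite ?expr1n ?expr0n.
have mchi : measurable_fun setT chi by exact: measurable_fun_window.
pose G a (y : mR * mR) := chi y.2 * degree_coef k e y.1 a y.2 (time_slice w y.1).
have mG a : measurable_fun setT (G a).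
  apply: measurable_funM; first exact: measurableT_comp.
  exact: measurable_degree_coef_slice.
apply: le_trans (@Minkowski_integral _ _ _ _ _ mu mu _ A G (outer_norm p q f)
  (energy_const n B * (2 * k + n)%:R `^ (- (1 + degree_decay p))) _ mG _ _ _); last 4 first.
- by apply: mulr_ge0; [exact: energy_const_ge0|exact: powR_ge0].
- exact: measurable_outer_norm.
- by move=> t; exact: outer_norm_ge0.
- move=> t; rewrite (_ : (\sum_(a <- A) _ = degree_energy k A B e t (time_slice w t))%E); last first.
    apply: eq_bigr => a _; apply: eq_integral => l _.
    by rewrite /G/= exprMn chi_sqr.
  apply: (@degree_energy_le _ _ _ _ _ _ _ _ q _ (inner_norm p w t)) => //.
  + exact: time_slice_fully_integrable.
  + exact: (measurableT_comp (measurable_inner_norm p mw) (pair1_measurable t)).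
  + by move=> s; exact: inner_norm_ge0.
  + by move=> s; exact: inner_normE.
  + exact: outer_norm_ge0.
  exact: le_integral_inner_norm.
apply: lee_sum => a _; apply: ge0_le_integral => //.
- by move=> l _; rewrite lee_fin mulr_ge0 ?sqr_ge0// indicE.
- apply/measurable_EFinP; apply: measurable_funM => //; apply: measurable_funX.
  exact: measurable_degree_transform.
- have mI : measurable_fun setT (fun l => \int[mu]_t `|G a (t, l)|%:E)%E.
    apply: (@measurable_param_integral _ _ _ _ _ mu (fun v => `|G a v|%:E)).
    by apply/measurable_EFinP; exact: measurableT_comp.
  exact: emeasurable_funM.
move=> l _; rewrite -/(chi l) -[X in (X * _)%:E]chi_sqr -exprMn.
rewrite (_ : chi l * degree_transform a l w = \int[mu]_t (G a (t, l))).
  by apply: sqr_Rintegral_le; exact: measurable_fun_pair1.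
rewrite /G/= /degree_transform.
have [l0|l0] : chi l = 0 \/ chi l = 1.
- by rewrite /chi indicE; case: (_ \in _); [right|left].
- by rewrite l0 mul0r; under eq_Rintegral do rewrite mul0r; rewrite Rintegral_cst// mul0r.
- by rewrite l0 mul1r; under [RHS]eq_Rintegral do rewrite mul1r.
Qed.

End Transform.

(** * The transform of a Schwartz function in real form *)

Section SchwartzFunctions.
Context {R : realType} (n : nat).
Local Notation mR := (measurableTypeR R).
Local Notation X := (n.-tuple mR).
Local Notation mu := (@lebesgue_measure R).

Definition coordinate_form (u : 'rV[R]_(n + 2) -> R) (z : X * (mR * mR)) : R :=
  u (xts z.1 z.2.1 z.2.2).

Lemma dominated_schwartz (u : 'rV[R]_(n + 2) -> R) : real_schwartz u -> dominated (coordinate_form u).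
Proof.
move=> su; split.
  apply: (@measurable_continuous_row R _ _ _ u (fun z : X * (mR * mR) => xts z.1 z.2.1 z.2.2)).
    exact: (su.1 [::]).1.
  move=> j; rewrite /xts; case: (splitP j) => i ji.
    have -> : j = lshift 2 i by apply/val_inj.
    under eq_fun do rewrite row_mxEl mxE.
    exact: (measurableT_comp (measurable_tnth i) measurable_fst).
  have -> : j = rshift n i by apply/val_inj.
  case: (@splitP 1 1 i) => i' ii.
    have -> : i = @lshift 1 1 i' by apply/val_inj.
    rewrite (_ : (fun _ => _) = fun z : X * (mR * mR) => z.2.1); first exact: measurableT_comp.
    by apply/funext => z; rewrite row_mxEr (@row_mxEl _ _ 1 1) mxE !ord1 mulr1n.
  have -> : i = @rshift 1 1 i' by apply/val_inj.
  rewrite (_ : (fun _ => _) = fun z : X * (mR * mR) => z.2.2); first exact: measurableT_comp.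
  by apply/funext => z; rewrite row_mxEr (@row_mxEr _ _ 1 1) mxE !ord1 mulr1n.
have [C C0 uC] := schwartz_decay su; exists C => // x t s.
rewrite /coordinate_form/=; apply: le_trans (uC _) _.
rewrite le_eqVlt; apply/orP; left; apply/eqP; congr (_ * _).
rewrite big_split_ord/=; congr (_ * _).
  by apply: eq_bigr => j _; rewrite row_mxEl mxE.
rewrite (@big_split_ord _ _ _ 1 1) !big_ord1/=.
by rewrite !row_mxEr (@row_mxEl _ _ 1 1) (@row_mxEr _ _ 1 1) !mxE !mulr1n.
Qed.

Definition modulus_form (f : 'rV[R]_(n + 2) -> R[i]) : X * (mR * mR) -> R :=
  coordinate_form (fun z => Normc.normc (f z)).

Lemma normc_sqr (z : R[i]) : Normc.normc z ^+ 2 = complex.Re z ^+ 2 + complex.Im z ^+ 2.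
Proof. by case: z => a b /=; rewrite sqr_sqrtr// addr_ge0 ?sqr_ge0. Qed.

Lemma normc_ge0 (z : R[i]) : 0 <= Normc.normc z.
Proof. by case: z => a b; exact: sqrtr_ge0. Qed.

Lemma Re_le_normc (z : R[i]) : `|complex.Re z| <= `|Normc.normc z|.
Proof.
rewrite -(@ler_pXn2r _ 2) ?nnegrE//.
by rewrite !real_normK ?num_real// normc_sqr lerDl sqr_ge0.
Qed.

Lemma Im_le_normc (z : R[i]) : `|complex.Im z| <= `|Normc.normc z|.
Proof.
rewrite -(@ler_pXn2r _ 2) ?nnegrE//.
by rewrite !real_normK ?num_real// normc_sqr lerDr sqr_ge0.
Qed.

Lemma dominated_modulus (f : 'rV[R]_(n + 2) -> R[i]) : schwartz f -> dominated (modulus_form f).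
Proof.
move=> [sR sI]; have [mRe [C1 C10 h1]] := dominated_schwartz sR.
have [mIm [C2 C20 h2]] := dominated_schwartz sI; split.
  rewrite (_ : modulus_form f = fun z => Num.sqrt (coordinate_form (fun z => complex.Re (f z)) z ^+ 2
     + coordinate_form (fun z => complex.Im (f z)) z ^+ 2)).
    apply: (measurableT_comp (continuous_measurable_fun (@sqrt_continuous R))).
    by apply: measurable_funD; exact: measurable_funX.
  by apply/funext => z; rewrite /modulus_form /coordinate_form; case: (f _).
exists (C1 + C2); first exact: addr_ge0.
move=> x t s; rewrite mulrDl; apply: le_trans (lerD (h1 x t s) (h2 x t s)).
rewrite /modulus_form /coordinate_form/=; move: (f _) => z.
rewrite ger0_norm ?normc_ge0//.
rewrite -(@ler_pXn2r _ 2) ?nnegrE ?normc_ge0 ?addr_ge0//.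
rewrite normc_sqr sqrrD !real_normK ?num_real// -addrA lerD2l lerDr.
by rewrite mulrn_wge0// mulr_ge0.
Qed.

Lemma mixed_normE (f : 'rV[R]_(n + 2) -> R[i]) (p q : R) : schwartz f -> 1 <= q -> q <= p ->
  mixed_norm 1 q%:E p%:E f = (\int[mu]_t (outer_norm p q (modulus_form f) t)%:E)%E.
Proof.
move=> sf q1 qp; have df := dominated_modulus sf.
have q0 : 0 < q by exact: lt_le_trans q1.
have p0 : 0 < p by exact: lt_le_trans qp.
rewrite /mixed_norm Lnorm1; apply: eq_integral => t _.
have inner s : Lnorm (lebesgue_tuple n) p%:E (fun x => (Normc.normc (f (xts x t s)))%:E) =
    (inner_norm p (modulus_form f) t s)%:E.
  rewrite unlock/=; have := inner_normE q1 qp t s df => e.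
  rewrite [X in (X `^ _)%E](_ : _ = (inner_norm p (modulus_form f) t s `^ p)%:E).
    by rewrite poweR_EFin -powRrM mulfV ?gt_eqF// powRr1// inner_norm_ge0.
  by rewrite -e.
under eq_Lnorm do rewrite inner.
rewrite unlock/=.
rewrite [X in (X `^ _)%E](_ : _ = (outer_norm p q (modulus_form f) t `^ q)%:E).
  by rewrite poweR_EFin -powRrM mulfV ?gt_eqF// powRr1 ?outer_norm_ge0//= ger0_norm// outer_norm_ge0.
rewrite -(outer_normE q1 qp t df); apply: eq_integral => s _.
by rewrite /= ger0_norm ?inner_norm_ge0.
Qed.

Lemma dominatedN (w : X * (mR * mR) -> R) : dominated w -> dominated (fun z => - w z).
Proof.
move=> [mw [C C0 wC]]; split; first exact: measurable_funN.
by exists C => // x t s; rewrite normrN.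
Qed.

Lemma expi_mul (x y c : R) (z : R[i]) : expi x * expi y * z * (c%:C)%C =
  Complex (complex.Re z * (cos (x + y) * c) + - complex.Im z * (sin (x + y) * c))
          (complex.Re z * (sin (x + y) * c) + complex.Im z * (cos (x + y) * c)).
Proof.
case: z => u v; rewrite cosD sinD; apply/eqP; rewrite eq_complex.
by apply/andP; split; apply/eqP => /=; ring.
Qed.

(** On the surface the two exponentials merge into one with phase l t + N |l| s. The sign of the
    sine term is carried by -v, so that each of the four terms is a [degree_transform]. *)
Lemma hermite_fourierE (f : 'rV[R]_(n + 2) -> R[i]) (a : n.-tuple nat) (l : R)
  (k := (\sum_(j < n) tnth a j)%N)
  (u := coordinate_form (fun z => complex.Re (f z)))
  (v := coordinate_form (fun z => complex.Im (f z))) :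
  (0 < n)%N -> schwartz f ->
  hermite_fourier f (a, l, frequency a l) =
  Complex (degree_transform k cos a l u + degree_transform k sin a l (fun z => - v z))
          (degree_transform k sin a l u + degree_transform k cos a l v).
Proof.
move=> n0 sf; have du := dominated_schwartz sf.1; have dv := dominated_schwartz sf.2.
have dNv := dominatedN dv.
pose T (e : R -> R) (w : X * (mR * mR) -> R) (z : X * (mR * mR)) :=
  w z * (e (l * z.2.1 + (2 * k + n)%:R * `|l| * z.2.2) * scaled_hermite a l z.1).
have dT e w : e = cos \/ e = sin -> dominated w -> dominated (T e w).
  by move=> he dw; exact: dominated_kernel.
have TE e w : e = cos \/ e = sin -> dominated w ->
  \int[lebesgue_tuple n]_x \int[mu]_t \int[mu]_s T e w (x, (t, s)) = degree_transform k e a l w.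
  by move=> he dw; exact: (degree_transformE k n0 he).
have hc : @cos R = cos \/ @cos R = sin by left.
have hs : @sin R = cos \/ @sin R = sin by right.
rewrite /hermite_fourier /Cintegral.
apply/eqP; rewrite eq_complex; apply/andP; split; apply/eqP => /=.
  transitivity (\int[lebesgue_tuple n]_x \int[mu]_t \int[mu]_s
     (T cos u (x, (t, s)) + T sin (fun z => - v z) (x, (t, s)))).
    by do 3 (apply: eq_Rintegral => ? _); rewrite expi_mul.
  rewrite [LHS]Rintegral_tripleD; [|exact: dT|exact: dT].
  by congr (_ + _); exact: TE.
transitivity (\int[lebesgue_tuple n]_x \int[mu]_t \int[mu]_s
     (T sin u (x, (t, s)) + T cos v (x, (t, s)))).
  by do 3 (apply: eq_Rintegral => ? _); rewrite expi_mul.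
rewrite [LHS]Rintegral_tripleD; [|exact: dT|exact: dT].
by congr (_ + _); exact: TE.
Qed.

End SchwartzFunctions.

Lemma cutoff_bound (R : realType) (psi : R -> R) : (forall x, 0 <= psi x) -> continuous psi ->
  compactly_supported psi ->
  exists2 B : R, 0 < B & exists2 M : R, 0 <= M & forall x, psi x <= M * \1_(window B) x.
Proof.
move=> psi0 cpsi cs; have [B0 [_ HB]] := compact_bounded cs.
pose B := `|B0| + 1; have B0lt : B0 < B by rewrite ltr_pwDr// ler_norm.
have Bgt0 : 0 < B by rewrite ltr_wpDl.
have [c _ cmax] := EVT_max (ltW (gtrN Bgt0)) (continuous_subspaceT cpsi).
exists B => //; exists (psi c) => // x; rewrite indicE mem_window; have [xB|xB] := leP `|x| B.
  by rewrite mulr1; apply: cmax; rewrite in_itv/= -ler_norml.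
rewrite mulr0 leNgt; apply/negP => px; move: xB; rewrite ltNge => /negP; apply.
by apply: (HB B B0lt); apply: subset_closure; rewrite /= gt_eqF.
Qed.

Lemma le_sum4 (R : realType) (I : Type) (A : seq I) (E1 E2 E3 E4 : I -> \bar R) (d : R) (Y : \bar R) :
  0 <= d ->
  (\sum_(a <- A) E1 a <= d%:E * Y)%E -> (\sum_(a <- A) E2 a <= d%:E * Y)%E ->
  (\sum_(a <- A) E3 a <= d%:E * Y)%E -> (\sum_(a <- A) E4 a <= d%:E * Y)%E ->
  (\sum_(a <- A) (E1 a + E2 a + E3 a + E4 a) <= (4 * d)%:E * Y)%E.
Proof.
move=> d0 h1 h2 h3 h4; rewrite !big_split/=.
have -> : (4 * d)%:E = (d%:E + d%:E + d%:E + d%:E)%E by rewrite -!EFinD; congr EFin; ring.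
rewrite !ge0_muleDl ?adde_ge0 ?lee_fin//.
by do 3 (apply: leeD => //).
Qed.

(** * Summation over the degree *)

Section FinalEstimate.
Context {R : realType} (n : nat).
Hypothesis n0 : (0 < n)%N.
Local Notation mR := (measurableTypeR R).
Local Notation X := (n.-tuple mR).
Local Notation mu := (@lebesgue_measure R).
Variables (psi : R -> R) (B M p q : R).
Hypotheses (psi0 : forall x, 0 <= psi x) (cpsi : continuous psi).
Hypotheses (B0 : 0 < B) (M0 : 0 <= M) (psiM : forall x, psi x <= M * \1_(window B) x).
Hypotheses (q1 : 1 <= q) (qp : q <= p) (p2 : p < 2).
Variable f : 'rV[R]_(n + 2) -> R[i].
Hypothesis sf : schwartz f.

Let m : \bar R := (\int[mu]_t (outer_norm p q (modulus_form f) t)%:E)%E.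

Let energy (a : n.-tuple nat) : \bar R :=
  (\int[mu]_(l in [set~ (0%R : R)])
    ((Normc.normc (restriction f (a, l, frequency a l)) ^+ 2)%:E * (psi (frequency a l))%:E))%E.

Let energy_ge0 a : (0 <= energy a)%E.
Proof. by apply: integral_ge0 => l _; rewrite -EFinM lee_fin mulr_ge0 ?sqr_ge0. Qed.

Let u := coordinate_form (fun z => complex.Re (f z)).
Let v := coordinate_form (fun z => complex.Im (f z)).

Let decay k : R := energy_const n B * (2 * k + n)%:R `^ (- (1 + degree_decay p)).

(** The constant is 8 M = 2 M times 4: each square of a sum of two transforms costs 2, psi costs M,
    and four real transforms each contribute [decay k]. *)
Lemma fixed_degree_estimate k (A : seq (n.-tuple nat)) : uniq A ->
  (forall a, a \in A -> (\sum_(j < n) tnth a j)%N = k) ->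
  (\sum_(a <- A) energy a <= (8 * M * decay k)%:E * (m * m))%E.
Proof.
move=> uA Ak.
have du := dominated_schwartz sf.1; have dv := dominated_schwartz sf.2.
have dNv := dominatedN dv; have df := dominated_modulus sf.
have hc : @cos R = cos \/ @cos R = sin by left.
have hs : @sin R = cos \/ @sin R = sin by right.
have u_le z : `|u z| <= `|modulus_form f z| by exact: Re_le_normc.
have v_le z : `|v z| <= `|modulus_form f z| by exact: Im_le_normc.
have Nv_le z : `|- v z| <= `|modulus_form f z| by rewrite normrN.
pose chi l : R := \1_(window (B / (2 * k + n)%:R)) l.
pose E e w (a : n.-tuple nat) : \bar R := (\int[mu]_l (chi l * degree_transform k e a l w ^+ 2)%:E)%E.
have chi0 l : 0 <= chi l by rewrite /chi indicE.
have mT e w (a : n.-tuple nat) : e = cos \/ e = sin -> dominated w ->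
    measurable_fun setT (fun l => degree_transform k e a l w).
  by move=> he dw; exact: measurable_degree_transform dw.1.
have mE e w (a : n.-tuple nat) : e = cos \/ e = sin -> dominated w ->
    measurable_fun setT (fun l => (chi l * degree_transform k e a l w ^+ 2)%:E).
  move=> he dw; apply/measurable_EFinP; apply: measurable_funM.
    exact: measurable_fun_window.
  by apply: measurable_funX; exact: mT.
have E0 e w (a : n.-tuple nat) l : (0 <= (chi l * degree_transform k e a l w ^+ 2)%:E)%E.
  by rewrite lee_fin mulr_ge0// sqr_ge0.
have EI0 e w a : (0 <= E e w a)%E by exact: integral_ge0.
have EE e w : e = cos \/ e = sin -> dominated w -> (forall z, `|w z| <= `|modulus_form f z|) ->
    (\sum_(a <- A) E e w a <= (decay k)%:E * (m * m))%E.
  by move=> he dw wf; exact: degree_transform_energy.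
have energyE a : a \in A -> (energy a <= (2 * M)%:E *
    (E cos u a + E sin (fun z => (- v z)%R) a + E sin u a + E cos v a))%E.
  move=> aA; have ka := Ak a aA.
  pose T1 l := degree_transform k cos a l u.
  pose T2 l := degree_transform k sin a l (fun z => - v z).
  pose T3 l := degree_transform k sin a l u.
  pose T4 l := degree_transform k cos a l v.
  have m1 : measurable_fun setT T1 by exact: mT.
  have m2 : measurable_fun setT T2 by exact: mT.
  have m3 : measurable_fun setT T3 by exact: mT.
  have m4 : measurable_fun setT T4 by exact: mT.
  pose F l := (((T1 l + T2 l) ^+ 2 + (T3 l + T4 l) ^+ 2) * psi (frequency a l))%:E.
  have mF : measurable_fun setT F.
    apply/measurable_EFinP; apply: measurable_funM.
      exact: (measurable_funD (measurable_funX 2 (measurable_funD m1 m2)) (measurable_funX 2 (measurable_funD m3 m4))).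
    apply: (measurableT_comp (continuous_measurable_fun cpsi)).
    by apply: measurable_funM => //; exact: measurableT_comp.
  have F0 l : (0 <= F l)%E by rewrite lee_fin mulr_ge0// addr_ge0// sqr_ge0.
  have -> : energy a = (\int[mu]_(l in [set~ (0%R : R)]) F l)%E.
    apply: eq_integral => l; rewrite inE/= => /eqP l0.
    rewrite -EFinM /F /restriction /patch mem_set; last by split.
    by rewrite (hermite_fourierE a l n0 sf) normc_sqr/= ka.
  apply: (@le_trans _ _ (\int[mu]_l F l)%E).
    by apply: ge0_subset_integral => //; exact: measurableC.
  rewrite /E -ge0_integralD; [|by []|by []|exact: mE|by []|exact: mE].
  rewrite -ge0_integralD; [|by []|by move=> l _; exact: adde_ge0
    |exact: emeasurable_funD (mE _ _ _ _ _) (mE _ _ _ _ _)|by []|exact: mE].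
  rewrite -ge0_integralD; [|by []|by move=> l _; do 2 (apply: adde_ge0 => //)
    |apply: emeasurable_funD; [apply: emeasurable_funD|]; exact: mE|by []|exact: mE].
  have mS : measurable_fun setT (fun l => (chi l * T1 l ^+ 2)%:E + (chi l * T2 l ^+ 2)%:E +
      (chi l * T3 l ^+ 2)%:E + (chi l * T4 l ^+ 2)%:E)%E.
    by do 3 (apply: emeasurable_funD; last exact: mE); exact: mE.
  rewrite -ge0_integralZl_EFin; [|by []|by move=> l _; do 3 (apply: adde_ge0 => //)|exact: mS|by rewrite mulr_ge0].
  apply: ge0_le_integral => //; first exact: measurable_funeM.
  move=> l _; rewrite -!EFinD -EFinM lee_fin.
  (* On the surface [frequency a l] is N |l|, so the window B in nu becomes B / N in l. *)
  have psichi : psi (frequency a l) <= M * chi l.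
    apply: le_trans (psiM _) _; rewrite ler_wpM2l// /chi !indicE !mem_window /frequency ka.
    rewrite normrM normr_id ger0_norm// ler_pdivlMr ?ltr0n ?addn_gt0 ?n0 ?orbT//.
    by rewrite mulrC.
  have sq0 : 0 <= (T1 l + T2 l) ^+ 2 + (T3 l + T4 l) ^+ 2 by rewrite addr_ge0 ?sqr_ge0.
  apply: le_trans (ler_wpM2l sq0 psichi) _.
  rewrite -subr_ge0 [X in 0 <= X](_ : _ = M * chi l * ((T1 l - T2 l) ^+ 2 + (T3 l - T4 l) ^+ 2)).
    by rewrite mulr_ge0 ?addr_ge0 ?sqr_ge0// mulr_ge0.
  by rewrite -/(T1 l) -/(T2 l) -/(T3 l) -/(T4 l); ring.
have S0 e w : (0 <= \sum_(a <- A) E e w a)%E by exact: sume_ge0.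
apply: (@le_trans _ _ (\sum_(a <- A) ((2 * M)%:E *
    (E cos u a + E sin (fun z => (- v z)%R) a + E sin u a + E cos v a)))%E).
  rewrite [leLHS]big_seq [leRHS]big_seq; apply: lee_sum => a aA; exact: energyE.
rewrite -ge0_sume_distrr; last by move=> a _; do 3 (apply: adde_ge0 => //).
have d0 : 0 <= decay k by apply: mulr_ge0; [exact: energy_const_ge0|exact: powR_ge0].
have -> : (8 * M * decay k)%:E = ((2 * M)%:E * (4 * decay k)%:E)%E.
  by rewrite -EFinM; congr EFin; ring.
rewrite -muleA; apply: lee_wpmul2l; first by rewrite lee_fin mulr_ge0.
by apply: le_sum4 => //; exact: EE.
Qed.

(** Grouping A by degree and summing the series over all degrees gives a bound that does not depend
    on A. *)
Lemma finite_sum_estimate (A : seq (n.-tuple nat)) : uniq A ->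
  (\sum_(a <- A) energy a <=
    (8 * M * (energy_const n B * (1 + (degree_decay p)^-1)))%:E * (m * m))%E.
Proof.
move=> uA; pose deg (a : n.-tuple nat) := (\sum_(j < n) tnth a j)%N.
have p0 : 0 < p by exact: lt_le_trans (le_trans q1 qp).
have eta0 : 0 < degree_decay p by rewrite divr_gt0 ?subr_gt0// mulr_gt0.
(* The sum of the degrees bounds each of them, so [inord] into ['I_K.+1] preserves the degree. *)
pose K := (\sum_(a <- A) deg a)%N.
have degK a : a \in A -> (deg a < K.+1)%N.
  by move=> aA; rewrite ltnS /K (big_rem a)//= leq_addr.
have mm0 : (0 <= m * m)%E.
  by apply: mule_ge0; apply: integral_ge0 => t _; rewrite lee_fin outer_norm_ge0.
have EC0 := energy_const_ge0 n B0.
rewrite (partition_big (fun a => inord (deg a) : 'I_K.+1) predT)//=.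
apply: (@le_trans _ _ (\sum_(k < K.+1) (8 * M * decay k)%:E * (m * m))%E).
  apply: lee_sum => k _; rewrite -big_filter.
  rewrite (eq_filter (a2 := fun a => inord (deg a) == k))//.
  apply: fixed_degree_estimate; first exact: filter_uniq.
  by move=> a; rewrite mem_filter => /andP[/eqP <- aA]; rewrite inordK// degK.
rewrite -ge0_sume_distrl; last first.
  move=> k _; rewrite lee_fin; apply: mulr_ge0; first by rewrite mulr_ge0.
  by rewrite mulr_ge0// powR_ge0.
apply: lee_wpmul2r => //; rewrite sumEFin lee_fin -mulr_sumr ler_wpM2l ?mulr_ge0//.
rewrite -mulr_sumr ler_wpM2l//; apply: le_trans (sum_powR_inv_le K.+1 eta0).
(* Since n >= 1, N = 2k + n is at least k + 1, which reduces to the series of (k+1)^(-(1+eta)). *)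
rewrite big_mkord; apply: ler_sum => k _.
have k1 : 0 < k.+1%:R :> R by [].
have N1 : 0 < (2 * k + n)%:R :> R by rewrite ltr0n addn_gt0 n0 orbT.
rewrite !powRN lef_pV2 ?posrE ?powR_gt0//.
rewrite ge0_ler_powR ?nnegrE ?(ltW k1) ?(ltW N1) ?addr_ge0 ?(ltW eta0)// ler_nat.
apply: (@leq_trans (k + 1)); first by rewrite addn1.
by rewrite leq_add// leq_pmull.
Qed.

(** The sum over all multi-indices is a supremum over finite sets, and the square root turns [m * m]
    into [m]. The added 1 keeps the constant positive, so that its product with an infinite norm is
    infinite. *)
Lemma sigma_loc_estimate : (L2_sigma_loc psi (restriction f) <=
  (Num.sqrt (8 * M * (energy_const n B * (1 + (degree_decay p)^-1))) + 1)%:E *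
  mixed_norm 1 q%:E p%:E f)%E.
Proof.
set K := 8 * M * _; have p0 : 0 < p by exact: lt_le_trans (le_trans q1 qp).
have K0 : 0 <= K.
  have eta0 : 0 < degree_decay p by rewrite divr_gt0 ?subr_gt0// mulr_gt0.
  apply: mulr_ge0; first by rewrite mulr_ge0.
  by rewrite mulr_ge0 ?energy_const_ge0// addr_ge0// invr_ge0 ltW.
rewrite (mixed_normE sf q1 qp) -/m.
have sK0 : 0 < Num.sqrt K + 1 by rewrite ltr_wpDl.
have m0 : (0 <= m)%E by apply: integral_ge0 => t _; rewrite lee_fin outer_norm_ge0.
have main : (sigma_loc_integral psi (fun z => (Normc.normc (restriction f z) ^+ 2)%:E) <=
    K%:E * (m * m))%E.
  apply: ge_ereal_sup => _ [A [finA _] <-].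
  by rewrite fsbig_finite//; apply: finite_sum_estimate; exact: finmap.fset_uniq.
have sigma0 : (0 <= sigma_loc_integral psi (fun z => (Normc.normc (restriction f z) ^+ 2)%:E))%E.
  by apply: esum_ge0 => a _; exact: energy_ge0.
have [mfin|] := boolP (m \is a fin_num); last first.
  rewrite ge0_fin_numE// -leNgt leye_eq => /eqP ->.
  by rewrite gt0_muley ?leey// lte_fin.
rewrite /L2_sigma_loc -(fineK mfin) in main *.
set r := fine m in main *; have r0 : 0 <= r by exact: fine_ge0.
apply: (@le_trans _ _ ((K%:E * (r%:E * r%:E)) `^ 2^-1)%E).
  apply: gt0_ler_poweR => //; rewrite ?in_itv/= ?andbT ?leey ?andbT//.
  by apply: mule_ge0; [rewrite lee_fin|apply: mule_ge0; rewrite lee_fin].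
rewrite -!EFinM poweR_EFin lee_fin powR12_sqrt; last by apply: (mulr_ge0 K0); exact: mulr_ge0.
by rewrite sqrtrM// -expr2 sqrtr_sqr ger0_norm// ler_wpM2r// lerDl.
Qed.

End FinalEstimate.

Theorem theorem1p5 (R : realType) (n : nat) (n_ge1 : (1 <= n)%N)
    (psi : R -> R)
    (psi_ge0 : forall x, 0 <= psi x)
    (psi_smooth : smooth1 psi)
    (psi_even : even_fun psi)
    (psi_supp : compactly_supported psi)
    (psi_le1 : (Lnorm lebesgue_measure +oo (EFin \o psi) <= 1)%E)
    (p q : R) (q_ge1 : 1 <= q) (le_qp : q <= p) (p_lt2 : p < 2) :
  exists C : R, forall f : 'rV[R]_(n + 2) -> R[i], schwartz f ->
    (L2_sigma_loc psi (restriction f) <= C%:E * mixed_norm 1 q%:E p%:E f)%E.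
Proof.
have cpsi : continuous psi.
  move=> x; apply: differentiable_continuous; apply/derivable1_diffP.
  exact: (psi_smooth 0 x).
have [B B0 [M M0 psiM]] := cutoff_bound psi_ge0 cpsi psi_supp.
eexists => f sf.
exact: (sigma_loc_estimate n_ge1 psi_ge0 cpsi B0 M0 psiM q_ge1 le_qp p_lt2 sf).
Qed.
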